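(* Let $\sigma\in C([0,\infty);\mathbb{R}^{d\times r})$, let $A$ be a $d\times d$ real matrix, and for $\xi\in\mathbb{R}^d$ let $X(\cdot,\xi)$ be the unique continuous adapted process obeying \[ dX(t)=AX(t)\,dt+\sigma(t)\,dB(t),\quad t\ge 0;\quad X(0)=\xi. \] Let $c>0$ and define \[ \varsigma_c(t)=\left(\int_t^{t+c}\|\sigma(s)\|_F^2\,ds\right)^{1/2},\quad t\ge 0, \] \[ I_c(\epsilon)=\int_0^\infty \varsigma_c(t)\exp\left(-\frac{\epsilon^2/2}{\varsigma_c(t)^2}\right)\chi_{(0,\infty)}(\varsigma_c(t))\,dt,\quad \epsilon>0. \] Then the following are equivalent: (A) All the eigenvalues of $A$ have negative real parts, and $I_c(\epsilon)<+\infty$ for all $\epsilon>0$; (B) There is a basis $(\xi_i)_{i=1}^d$ of $\mathbb{R}^d$ such that the event \[ C=\{\omega:\lim_{t\to\infty}X(t,\xi_i,\omega)=0\text{ for } i=1,\ldots,d,\ \lim_{t\to\infty}X(t,0,\omega)=0\} \] satisfies $\mathbb{P}[C]>0$; (C) For each $\xi\in\mathbb{R}^d$ we have $\lim_{t\to\infty}X(t,\xi)=0$ a.s.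
   Context: $d,r$ are positive integers, $B$ is an $r$-dimensional standard Brownian motion (the same one for all initial conditions $\xi$), $\sigma$ is deterministic, $\|\cdot\|_F$ is the Frobenius norm on $\mathbb{R}^{d\times r}$, and $\chi_{(0,\infty)}$ is the indicator function of $(0,\infty)$, so the integrand of $I_c(\epsilon)$ is $0$ where $\varsigma_c(t)=0$. *)

(* Defs.v *)
From HB Require Import structures.
From mathcomp Require Export all_boot all_order all_algebra.
From mathcomp Require Import complex.
From mathcomp Require Export all_classical all_reals all_analysis.

Set Implicit Arguments.
Unset Strict Implicit.
Unset Printing Implicit Defensive.

Import Order.TTheory GRing.Theory Num.Theory.
Export numFieldNormedType.Exports.

Local Open Scope classical_set_scope.
Local Open Scope ring_scope.

(* On column vectors this is the Euclidean norm. *)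
Definition frobenius_norm (R : realType) (m n : nat) (M : 'M[R]_(m, n)) : R :=
  Num.sqrt (\sum_i \sum_j M i j ^+ 2).

Definition cv_integral (R : realType) (d : nat) (D : set R)
    (f : R -> 'cV[R]_d) : 'cV[R]_d :=
  \col_i \int[lebesgue_measure]_(s in D) (f s i 0).

(* The eigenvalues of a real matrix are its complex ones. *)
Definition stable_mx (R : realType) (d : nat) (A : 'M[R]_d) : Prop :=
  forall z : R[i],
    eigenvalue (map_mx (real_complex R) A) z -> complex.Re z < 0.

(* Processes are functions [R -> T -> 'cV[R]_n] of which only the times t >= 0
   matter; the same holds for filtrations, which need not be complete. *)
Section StochasticCalculus.
Context {disp : measure_display} {T : measurableType disp} {R : realType}.
Variable P : probability T R.

Definition is_filtration (F : R -> set (set T)) : Prop :=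
  [/\ forall t, 0 <= t -> sigma_algebra [set: T] (F t),
      forall t, 0 <= t -> F t `<=` measurable &
      forall s t, 0 <= s -> s <= t -> F s `<=` F t].

(* The sigma-algebra generated by a random vector. *)
Definition sigma_gen (n : nat) (Y : T -> 'cV[R]_n) : set (set T) :=
  g_sigma_preimage (fun i w => Y w i 0 : measurableTypeR R).

Definition adapted (n : nat) (F : R -> set (set T)) (Y : R -> T -> 'cV[R]_n)
  : Prop := forall t, 0 <= t -> sigma_gen (Y t) `<=` F t.

Definition continuous_paths (n : nat) (Y : R -> T -> 'cV[R]_n) : Prop :=
  forall w, {within `[0, +oo[, continuous (fun t => Y t w)}.

Definition indep_sigma (G H : set (set T)) : Prop :=
  forall E E', G E -> H E' -> P (E `&` E') = (P E * P E')%E.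

(* Y has law N(0, v I_n) with v > 0: the product of n copies of N(0, v). *)
Definition centered_gaussian (n : nat) (v : R) (Y : T -> 'cV[R]_n) : Prop :=
  forall U : 'I_n -> set (measurableTypeR R), (forall i, measurable (U i)) ->
    P [set w | forall i, U i (Y w i 0)] =
    (\prod_(i < n) fine (normal_prob 0 (Num.sqrt v) (U i)))%:E.

Definition brownian_motion (r : nat) (F : R -> set (set T))
    (B : R -> T -> 'cV[R]_r) : Prop :=
  [/\ adapted F B,
      continuous_paths B,
      {ae P, forall w, B 0 w = 0},
      forall s t, 0 <= s -> s < t ->
        centered_gaussian (t - s) (fun w => B t w - B s w) &
      forall s t, 0 <= s -> s < t ->
        indep_sigma (F s) (sigma_gen (fun w => B t w - B s w))].

Section Ito.
Variables d r : nat.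

(* sum_(i < n) c_i 1_(]t_i, t_(i+1)]), with deterministic coefficients c_i. *)
Record stepfun := StepFun {
  step_size : nat ;
  step_node : nat -> R ;
  step_coef : nat -> 'M[R]_(d, r) }.

Definition stepfun_on (t : R) (phi : stepfun) : Prop :=
  [/\ step_node phi 0 = 0, step_node phi (step_size phi) = t &
      forall i, (i < step_size phi)%N -> step_node phi i <= step_node phi i.+1].

Definition step_eval (phi : stepfun) (s : R) : 'M[R]_(d, r) :=
  \sum_(i < step_size phi)
    (\1_(`]step_node phi i, step_node phi i.+1]%classic) s : R)
      *: step_coef phi i.

Definition step_ito (B : R -> T -> 'cV[R]_r) (phi : stepfun) (w : T)
    : 'cV[R]_d :=
  \sum_(i < step_size phi)
    step_coef phi i *m (B (step_node phi i.+1) w - B (step_node phi i) w).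

(* Y is (a version of) the Ito integral over [0, t] of the deterministic
   integrand f: the L^2(P)-limit of the integrals of step functions, along any
   sequence of step functions that converges to f in L^2([0, t]). *)
Definition is_ito_integral_at (B : R -> T -> 'cV[R]_r) (f : R -> 'M[R]_(d, r))
    (t : R) (Y : T -> 'cV[R]_d) : Prop :=
  forall phi : nat -> stepfun,
    (forall k, stepfun_on t (phi k)) ->
    (\int[lebesgue_measure]_(s in `[0%R, t])
       (frobenius_norm (step_eval (phi k) s - f s) ^+ 2)%:E)%E
      @[k --> \oo] --> 0%E ->
    (\int[P]_w (frobenius_norm (step_ito B (phi k) w - Y w) ^+ 2)%:E)%E
      @[k --> \oo] --> 0%E.

Definition is_ito_integral (F : R -> set (set T)) (B : R -> T -> 'cV[R]_r)
    (f : R -> 'M[R]_(d, r)) (M : R -> T -> 'cV[R]_d) : Prop :=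
  [/\ adapted F M, continuous_paths M &
      forall t, 0 <= t -> is_ito_integral_at B f t (M t)].

Definition is_solution (F : R -> set (set T)) (B : R -> T -> 'cV[R]_r)
    (A : 'M[R]_d) (sigma : R -> 'M[R]_(d, r)) (xi : 'cV[R]_d)
    (X : R -> T -> 'cV[R]_d) : Prop :=
  [/\ adapted F X, continuous_paths X &
      exists2 M : R -> T -> 'cV[R]_d, is_ito_integral F B sigma M &
        {ae P, forall w, forall t, 0 <= t ->
          X t w = xi + cv_integral `[0, t] (fun s => A *m X s w) + M t w}].

End Ito.
End StochasticCalculus.

Section Criterion.
Context {R : realType}.
Variables (d r : nat) (sigma : R -> 'M[R]_(d, r)) (c : R).

Definition varsigma (t : R) : R :=
  Num.sqrt (\int[lebesgue_measure]_(s in `[t, t + c])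
              (frobenius_norm (sigma s) ^+ 2)).

Definition I_crit (eps : R) : \bar R :=
  (\int[lebesgue_measure]_(t in `[0%R, +oo[)
     (varsigma t * expR (- ((eps ^+ 2 / 2) / varsigma t ^+ 2))
        * \1_(`]0%R, +oo[%classic) (varsigma t))%:E)%E.

End Criterion.

(* Main.v *)
From HB Require Import structures.
Require Import Defs.
From mathcomp Require Import complex.
From mathcomp Require Import measurable_realfun simple_functions.
From mathcomp Require Import measurable_fun_approximation ring lra.
Import Order.TTheory GRing.Theory Num.Theory.
Local Open Scope classical_set_scope.
Local Open Scope ring_scope.

Set Implicit Arguments.
Unset Strict Implicit.
Unset Printing Implicit Defensive.

(** The equation is solved path by path: [X t = xi + \int_0^t A X + M t], where the
    continuous process M is the Ito integral of sigma. Both conditions on X are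
    conditions on A and on the increments of M over the windows from [n h] to
    [(n + 1) h].

    The deterministic part. Call a path of M flat if its oscillation over the n-th
    window tends to 0. If A is stable and M is flat, then subtracting from X the
    difference between M and its moving average leaves a solution Z of
    [Z' = A Z + o(1)], and so X tends to 0 ([solution_cvg0]). The decay of Z comes from
    the factors of the characteristic polynomial of A, removed one at a time, each of
    which amounts to a damped rotation of the complex plane ([stable_forced_cvg0]).
    Conversely, if X tends to 0, so do the increments of M
    ([solution_noise_increments]); and the differences of solutions with the same noise
    solve [D' = A D], so that their decay from a basis of initial values makes A stable
    ([common_noise_stable]).

    The probabilistic part. Let V_n be the integral of the squared Frobenius norm of
    sigma over the n-th window, here called its energy. The increments of M are
    independent and Gaussian, and V_n is the total variance over the n-th window, so
    by the two Borel-Cantelli lemmas the flatness of M amounts to the convergence, for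
    all K > 0, of the series of the [exp (- K / V_n)]. The tail bounds are proved for the
    sums of the [sigma(t_i) (B(t_{i+1}) - B(t_i))] over dyadic grids, whose moment
    generating functions are explicit, also given the past ([gaussian_increments]): an
    exponential maximal inequality ([maximal_two_sided]) and a lower bound of
    Paley-Zygmund type ([gaussian_lower_tail]). They pass to M, the limit of these sums
    in probability, at the price of a factor 3 in the threshold ([window_exceeds_le],
    [small_windows_le]), and give [noise_flat] and [exp_weight_bounded]. Such factors do
    no harm, since eps ranges over all positive numbers in the criterion; for the same
    reason the prefactor in the integrand of I_c is immaterial.

    The criterion. Comparing the sliding window from t to [t + c] with fixed windows
    relates I_c to the series ([I_crit_sum], [I_crit_fin]).

    The equivalence is proved in the order (A), (C), (B), (A). In the last step
    convergence only holds with positive probability; this is enough, because an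
    unbounded series would make M almost surely not flat, and because one path
    suffices for the stability of A once the noises of all the solutions are known to
    agree almost surely ([noise_unique]). *)

(** * Calculus on the half line *)

Section RealAnalysis.
Context {R : realType}.
Implicit Types f g W : R -> R.
Local Notation mu := (@lebesgue_measure R).

(** Functions that are continuous on the half line are extended by a constant to
    the negative axis, so that two-sided derivatives make sense at 0. *)
Lemma continuous_within_max0 (V : topologicalType) (f : R -> V) :
  {within `[0%R, +oo[, continuous f} -> continuous (fun t : R => f (Num.max t 0)).
Proof.
move=> cf t.
have t0 : `[(0:R), +oo[%classic (Num.max t (0 : R)) by rewrite /= in_itv/= andbT le_max lexx orbT.
have cmax : (Num.max x 0) @[x --> t] --> (Num.max t 0).
  exact: (@continuous_max R R id (cst 0) t (fun U => id) (@cst_continuous _ _ _ _)).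
move=> U nU; have := cf (Num.max t 0) U nU; rewrite /nbhs/= -nbhs_subspace_in// => H.
have := cmax _ H; apply: (@filterS _ (nbhs t)) => s /= hs; apply: hs.
by rewrite in_itv/= andbT le_max lexx orbT.
Qed.

Lemma integrable_continuous_itv f (a b : R) : continuous f ->
  mu.-integrable `[a, b] (EFin \o f).
Proof.
move=> cf; apply: continuous_compact_integrable; first exact: segment_compact.
exact: continuous_subspaceT.
Qed.

Lemma continuous_primitive f : continuous f -> exists Phi : R -> R,
  (forall x : R, 0 <= x -> is_derive x 1 Phi (f x)) /\
  (forall a b : R, 0 <= a -> a <= b ->
    \int[mu]_(s in `[a, b]) f s = Phi b - Phi a).
Proof.
(* Integrating from -1 makes the primitive differentiable at 0 too. *)
move=> cf; exists (fun x => \int[mu]_(s in `[-1, x]) f s); split=> [x x0|a b a0 ab].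
- have x1 : -1 < x by rewrite (lt_le_trans _ x0)// ltrN10.
  have xx1 : x < x + 1 by rewrite ltrDl.
  have [dF F'] := continuous_FTC1_closed xx1 (integrable_continuous_itv (-1) (x + 1) cf) x1 (cf x).
  by apply: DeriveDef; [exact: dF|rewrite -derive1E; exact: F'].
- have a1 : -1 <= a by rewrite (le_trans _ a0)// lerN10.
  rewrite (@Rintegral_itvB _ f (BLeft (-1)) (BRight b) a).
  + rewrite Rintegral_itv_obnd_cbnd//.
    apply: integrableS (@integrable_continuous_itv f a b cf) => //.
    exact: subset_itv_oc_cc.
  + exact: integrable_continuous_itv.
  + by rewrite bnd_simp.
  + by rewrite bnd_simp.
Qed.

Lemma is_derive_within_continuous f f' (a : R) :
  (forall x : R, a <= x -> is_derive x 1 f (f' x)) ->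
  {within `[a, +oo[, continuous f}.
Proof.
move=> df; apply: derivable_within_continuous => x.
rewrite in_itv/= andbT => ax.
by case: (df x ax).
Qed.

Lemma increment_bound f f' (a b e : R) : 0 <= e -> a <= b ->
  (forall x : R, a <= x -> is_derive x 1 f (f' x)) ->
  (forall x : R, a <= x -> x <= b -> `|f' x| <= e) -> `|f b - f a| <= e * (b - a).
Proof.
move=> e0 ab df lef; have [||c cab ->] := @MVT_segment _ f f' a b ab.
- by move=> x; rewrite in_itv/= => /andP[/ltW ax _]; exact: df.
- have := is_derive_within_continuous df; apply: continuous_subspaceW.
  by move=> x/=; rewrite !in_itv/= andbT => /andP[].
- rewrite normrM (ger0_norm (_ : 0 <= b - a)) ?subr_ge0// ler_wpM2r ?subr_ge0//.
  by move: cab; rewrite in_itv/= => /andP[? ?]; exact: lef.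
Qed.

Lemma expRN_cvg0 (k C e : R) : 0 < k -> 0 < e ->
  exists T0 : R, forall t, T0 <= t -> expR (- (k * t)) * C <= e.
Proof.
move=> k0 e0; exists (`|C| / (k * e)) => t ht.
have kt : `|C| / e <= k * t.
  have : k * (`|C| / (k * e)) <= k * t by rewrite ler_pM2l.
  by have -> : k * (`|C| / (k * e)) = `|C| / e by field; rewrite !gt_eqF.
apply: (@le_trans _ _ (expR (- (k * t)) * `|C|)).
  by rewrite ler_wpM2l ?expR_ge0 ?ler_norm.
rewrite expRN mulrC ler_pdivrMr ?expR_gt0// mulrC -ler_pdivrMr//.
by rewrite (le_trans kt)// (le_trans _ (expR_ge1Dx _))// lerDr.
Qed.

Lemma is_derive_add f g (t df dg : R) : is_derive t 1 f df -> is_derive t 1 g dg ->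
  is_derive t 1 (fun t => f t + g t) (df + dg).
Proof. by move=> hf hg; exact: is_deriveD. Qed.

Lemma is_derive_mul f g (t df dg : R) : is_derive t 1 f df -> is_derive t 1 g dg ->
  is_derive t 1 (fun t => f t * g t) (f t * dg + g t * df).
Proof. by move=> hf hg; exact: is_deriveM. Qed.

Lemma is_derive_scale f (c t df : R) : is_derive t 1 f df ->
  is_derive t 1 (fun t => c * f t) (c * df).
Proof. by move=> hf; exact: is_deriveZ. Qed.

(** Gronwall's lemma in differential form: once [g <= k e / 2], the function
    [exp (k t) (W t - e / 2)] is nonincreasing. *)
Lemma decay_cvg0 W W' g (k T0 : R) : 0 < k ->
  (forall t : R, T0 <= t -> is_derive t 1 W (W' t)) ->
  (forall t : R, T0 <= t -> W' t <= - (k * W t) + g t) ->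
  (forall t, 0 <= W t) ->
  g t @[t --> +oo] --> 0 -> W t @[t --> +oo] --> 0.
Proof.
move=> k0 dW leW' W0 g0; apply/cvgrPdist_le => e e0.
have ke0 : 0 < k * (e / 2) by rewrite mulr_gt0// divr_gt0.
have /cvgrPdist_le/(_ _ ke0)[T1 [_ hT1]] := g0.
pose T := Num.max T0 (T1 + 1).
have TT0 : T0 <= T by rewrite le_max lexx.
have TT1 : T1 < T by rewrite lt_max ltrDl ltr01 orbT.
pose U t := expR (k * t) * (W t - e / 2).
have dU t : T <= t -> is_derive t 1 U (expR (k * t) * (k * (W t - e / 2) + W' t)).
  move=> Tt; have dWt := dW _ (le_trans TT0 Tt).
  have dk : is_derive t 1 (fun t => k * t) k.
    by rewrite -[X in is_derive _ _ _ X]mulr1; exact: is_derive_scale.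
  have de : is_derive t 1 (fun t => expR (k * t)) (expR (k * t) * k).
    exact: is_derive1_comp.
  apply: (is_derive_eq (is_derive_mul de (is_derive_add dWt (is_derive_cst (- (e / 2)) t 1)))).
  by rewrite /cst; ring.
have U_nincr x y : T <= x -> x <= y -> U y <= U x.
  apply: ler0_derive1_nincry.
  - by move=> r; rewrite in_itv/= andbT => /ltW/dU[].
  - move=> r; rewrite in_itv/= andbT => /ltW Tr.
    have [_] := dU r Tr; rewrite derive1E => ->.
    rewrite mulr_ge0_le0 ?expR_ge0//.
    have := leW' _ (le_trans TT0 Tr).
    have := hT1 r (lt_le_trans TT1 Tr); rewrite sub0r normrN => /(le_trans (ler_norm _)).
    by move=> ? ?; lra.
  - exact: is_derive_within_continuous dU.
have e20 : 0 < e / 2 by rewrite divr_gt0.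
have [T2 hT2] := expRN_cvg0 (U T) k0 e20.
exists (Num.max T T2); split; first exact: num_real.
move=> t; rewrite gt_max => /andP[Tt T2t].
rewrite sub0r normrN ger0_norm//.
have := U_nincr _ _ (lexx T) (ltW Tt); rewrite {1}/U => h.
have h2 : W t - e / 2 <= expR (- (k * t)) * U T.
  by rewrite expRN [_^-1 * _]mulrC ler_pdivlMr ?expR_gt0// mulrC.
have := hT2 t (ltW T2t); lra.
Qed.

(** [y = a + i b] solves [y' = (alpha + i beta) y + f1 + i f2]. The rotation beta
    cancels in the derivative of |y|^2, and half of the damping absorbs the
    forcing, which leaves an instance of [decay_cvg0]. *)
Lemma damped_rotation_cvg0 (a b f1 f2 : R -> R) (alpha beta T0 : R) : alpha < 0 ->
  (forall t : R, T0 <= t -> is_derive t 1 a (alpha * a t - beta * b t + f1 t)) ->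
  (forall t : R, T0 <= t -> is_derive t 1 b (alpha * b t + beta * a t + f2 t)) ->
  f1 t @[t --> +oo] --> 0 -> f2 t @[t --> +oo] --> 0 ->
  a t @[t --> +oo] --> 0 /\ b t @[t --> +oo] --> 0.
Proof.
move=> al0 da db f10 f20.
pose W t := a t * a t + b t * b t.
have W0 t : 0 <= W t by rewrite addr_ge0// -expr2 sqr_ge0.
have k0 : 0 < - alpha by rewrite oppr_gt0.
have Wcv : W t @[t --> +oo] --> 0.
  apply: (@decay_cvg0 W
    (fun t => 2 * (a t * (alpha * a t - beta * b t + f1 t)) +
              2 * (b t * (alpha * b t + beta * a t + f2 t)))
    (fun t => (- alpha)^-1 * (f1 t * f1 t + f2 t * f2 t)) (- alpha) T0 k0) => //.
  - move=> t T0t; have ha := da _ T0t; have hb := db _ T0t.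
    apply: (is_derive_eq (is_derive_add (is_derive_mul ha ha) (is_derive_mul hb hb))).
    by ring.
  - move=> t _; rewrite /W.
    have H (x y : R) : 2 * (x * y) <= - alpha * (x * x) + (- alpha)^-1 * (y * y).
      have -> : 2 * (x * y) = - alpha * (x * x) + (- alpha)^-1 * (y * y)
          - (- alpha)^-1 * (- alpha * x - y) ^+ 2.
        by field; rewrite lt_eqF.
      by rewrite gerBl mulr_ge0 ?sqr_ge0// invr_ge0 ltW.
    have := H (a t) (f1 t); have := H (b t) (f2 t); lra.
  - rewrite -[X in _ --> X](mulr0 (- alpha)^-1); apply: cvgMr.
    by rewrite -[X in _ --> X](addr0 0) -[in X in _ --> X](mulr0 0); apply: cvgD; apply: cvgM.
have H (c : R -> R) : (forall t, c t * c t <= W t) -> c t @[t --> +oo] --> 0.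
  move=> cW; apply/cvgrPdist_le => e e0.
  have ee0 : 0 < e * e by rewrite mulr_gt0.
  move/cvgrPdist_le : Wcv => /(_ _ ee0); apply: filterS => t.
  rewrite !sub0r !normrN (ger0_norm (W0 t)) => Wt.
  have := le_trans (cW t) Wt.
  by rewrite -!expr2 -[in X in X -> _]real_normK ?num_real// ler_pXn2r// nnegrE// ltW.
by split; apply: H => t; rewrite /W ?lerDl ?lerDr -expr2 sqr_ge0.
Qed.

End RealAnalysis.

(** * Stable linear systems with vanishing forcing *)

Section LinearSystems.
Context {R : realType}.
Local Notation mu := (@lebesgue_measure R).
Local Notation Re := complex.Re.
Local Notation Im := complex.Im.

Lemma cvg_mxP (I : Type) (F : set_system I) (FF : Filter F) m n (f : I -> 'M[R]_(m, n)) (l : 'M[R]_(m, n)) :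
  f x @[x --> F] --> l <-> forall i j, f x i j @[x --> F] --> l i j.
Proof.
split=> [fl i j|fl].
  by apply: (@cvg_comp _ _ _ f (fun M : 'M[R]_(m, n) => M i j) F (nbhs l) (nbhs (l i j))) => //; exact: coord_continuous.
apply/cvgrPdist_le => /= e e0; near=> x.
rewrite /Num.Def.normr/= mx_normrE (bigmax_le _ (ltW e0))//= => i _.
rewrite !mxE/=; move: i; near: x; apply: filter_forall => /= i.
by move/cvgrPdist_le : (fl i.1 i.2); exact.
Unshelve. all: by end_near. Qed.

Lemma cvg_sum0 (I : Type) (F : set_system I) (FF : Filter F) n (c : 'I_n -> R) (f : 'I_n -> I -> R) :
  (forall j, f j x @[x --> F] --> 0) ->
  (\sum_j c j * f j x) @[x --> F] --> (0 : R).
Proof.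
move=> f0; rewrite [X in _ --> X](_ : _ = \sum_(j < n) c j * 0); last first.
  by rewrite big1// => j _; rewrite mulr0.
apply: cvg_big => [|j _]; [exact: add_continuous|apply: cvgMr; exact: f0].
Qed.

Lemma ReD (z w : R[i]) : Re (z + w) = Re z + Re w. Proof. by case: z; case: w. Qed.
Lemma ImD (z w : R[i]) : Im (z + w) = Im z + Im w. Proof. by case: z; case: w. Qed.
Lemma ReM (z w : R[i]) : Re (z * w) = Re z * Re w - Im z * Im w.
Proof. by case: z; case: w. Qed.
Lemma ImM (z w : R[i]) : Im (z * w) = Re z * Im w + Im z * Re w.
Proof. by case: z; case: w. Qed.
Lemma Re_sum n (f : 'I_n -> R[i]) : Re (\sum_i f i) = \sum_i Re (f i).
Proof. exact: (big_morph _ ReD). Qed.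
Lemma Im_sum n (f : 'I_n -> R[i]) : Im (\sum_i f i) = \sum_i Im (f i).
Proof. exact: (big_morph _ ImD). Qed.

Variable d : nat.
Implicit Types (A : 'M[R]_d) (v : 'rV[R[i]]_d) (z : 'cV[R]_d).
Local Notation toC A := (map_mx (real_complex R) A).

(** The real and imaginary parts of the pairing of a complex row vector with a
    real column vector are kept apart, so that derivatives and limits stay real. *)
Definition re_pair v z : R := \sum_j Re (v 0 j) * z j 0.
Definition im_pair v z : R := \sum_j Im (v 0 j) * z j 0.

Lemma re_pair_mul v A z : re_pair (v *m toC A) z = \sum_j Re (v 0 j) * (A *m z) j 0.
Proof.
rewrite /re_pair; under [RHS]eq_bigr do rewrite mxE big_distrr/=.
rewrite [RHS]exchange_big/=; apply: eq_bigr => k _.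
rewrite mxE Re_sum big_distrl/=; apply: eq_bigr => j _.
by rewrite mxE ReM/= mulr0 subr0 mulrA.
Qed.

Lemma im_pair_mul v A z : im_pair (v *m toC A) z = \sum_j Im (v 0 j) * (A *m z) j 0.
Proof.
rewrite /im_pair; under [RHS]eq_bigr do rewrite mxE big_distrr/=.
rewrite [RHS]exchange_big/=; apply: eq_bigr => k _.
rewrite mxE Im_sum big_distrl/=; apply: eq_bigr => j _.
by rewrite mxE ImM/= mulr0 add0r mulrA.
Qed.

Lemma re_pairD v w z : re_pair (v + w) z = re_pair v z + re_pair w z.
Proof. by rewrite /re_pair -big_split/=; apply: eq_bigr => j _; rewrite mxE ReD mulrDl. Qed.

Lemma im_pairD v w z : im_pair (v + w) z = im_pair v z + im_pair w z.
Proof. by rewrite /im_pair -big_split/=; apply: eq_bigr => j _; rewrite mxE ImD mulrDl. Qed.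

Lemma re_pairZ (l : R[i]) v z : re_pair (l *: v) z = Re l * re_pair v z - Im l * im_pair v z.
Proof.
rewrite /re_pair /im_pair !big_distrr/= -sumrB; apply: eq_bigr => j _.
by rewrite mxE ReM mulrBl !mulrA.
Qed.

Lemma im_pairZ (l : R[i]) v z : im_pair (l *: v) z = Re l * im_pair v z + Im l * re_pair v z.
Proof.
rewrite /re_pair /im_pair !big_distrr/= -big_split/=; apply: eq_bigr => j _.
by rewrite mxE ImM mulrDl !mulrA.
Qed.

Lemma is_derive_lincomb n (c : 'I_n -> R) (f : 'I_n -> R -> R) (df : 'I_n -> R) (t : R) :
  (forall j, is_derive t 1 (f j) (df j)) ->
  is_derive t 1 (fun t => \sum_j c j * f j t) (\sum_j c j * df j).
Proof.
move=> hf; have := @is_derive_sum _ _ _ n (fun j t => c j * f j t) t 1 (fun j => c j * df j)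
  (fun j => is_derive_scale _ (hf j)).
by congr is_derive; apply/funext => s; rewrite fct_sumE.
Qed.

Definition pair_cvg0 (Z : R -> 'cV[R]_d) v :=
  re_pair v (Z t) @[t --> +oo] --> 0 /\ im_pair v (Z t) @[t --> +oo] --> 0.

(** The pairing y of v with Z satisfies [y' = l y + g], where g is the pairing of
    [v A - l v] with Z plus that of v with f, both of which vanish at infinity.
    So a factor [A - l] of a product that kills v can be removed. *)
Lemma pair_cvg0_factor A (Z f : R -> 'cV[R]_d) (l : R[i]) v : Re l < 0 ->
  (forall (t : R) i, 0 <= t -> is_derive t 1 (fun t => Z t i 0) ((A *m Z t) i 0 + f t i 0)) ->
  (forall i, f t i 0 @[t --> +oo] --> 0) ->
  pair_cvg0 Z (v *m toC A - l *: v) -> pair_cvg0 Z v.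
Proof.
move=> l0 dZ f0; set w := (v *m toC A - l *: v) => -[rw iw].
have vA : v *m toC A = l *: v + w by rewrite addrC subrK.
apply: (@damped_rotation_cvg0 R (fun t => re_pair v (Z t)) (fun t => im_pair v (Z t))
  (fun t => re_pair w (Z t) + re_pair v (f t))
  (fun t => im_pair w (Z t) + im_pair v (f t)) (Re l) (Im l) 0 l0).
- move=> t t0; rewrite addrA -re_pairZ -re_pairD -vA re_pair_mul -big_split/=.
  under eq_bigr do rewrite -mulrDr.
  by apply: is_derive_lincomb => j; exact: dZ.
- move=> t t0; rewrite addrA -im_pairZ -im_pairD -vA im_pair_mul -big_split/=.
  under eq_bigr do rewrite -mulrDr.
  by apply: is_derive_lincomb => j; exact: dZ.
- by rewrite -[X in _ --> X](addr0 0); apply: cvgD => //; exact: cvg_sum0.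
- by rewrite -[X in _ --> X](addr0 0); apply: cvgD => //; exact: cvg_sum0.
Qed.

End LinearSystems.

Section StableSystems.
Context {R : realType}.
Variable d' : nat.
Let d := d'.+1.
Local Notation mu := (@lebesgue_measure R).
Local Notation Re := complex.Re.
Local Notation Im := complex.Im.
Local Notation toC A := (map_mx (real_complex R) A).

(** By the Cayley-Hamilton theorem, the product of the factors [A - l] over the
    roots l of the characteristic polynomial kills every row vector;
    [pair_cvg0_factor] removes the factors one by one. *)
Lemma stable_forced_cvg0 (A : 'M[R]_d) (Z f : R -> 'cV[R]_d) : stable_mx A ->
  (forall (t : R) i, 0 <= t -> is_derive t 1 (fun t => Z t i 0) ((A *m Z t) i 0 + f t i 0)) ->
  (forall i, f t i 0 @[t --> +oo] --> 0) ->
  forall i, Z t i 0 @[t --> +oo] --> 0.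
Proof.
move=> stA dZ f0.
suff H v : pair_cvg0 Z v.
  move=> i; have [h _] := H (\row_j (if j == i then 1 else 0)).
  rewrite (_ : (fun t => Z t i 0) =
    (fun t => re_pair (\row_j (if j == i then 1 else 0)) (Z t)))//; apply/funext => t.
  rewrite /re_pair (bigD1 i)//= big1 => [|j ji]; first by rewrite mxE eqxx mul1r addr0.
  by rewrite mxE (negbTE ji) mul0r.
have [rs] := closed_field_poly_normal (char_poly (toC A)).
have /monicP -> := char_poly_monic (toC A); rewrite scale1r => rsE.
have rsneg l : l \in rs -> Re l < 0.
  by move=> lrs; apply: stA; rewrite eigenvalue_root_char rsE root_prod_XsubC.
have : forall v, pair_cvg0 Z (v *m horner_mx (toC A) (\prod_(l <- rs) ('X - l%:P))).
  move=> u; rewrite -rsE Cayley_Hamilton mulmx0.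
  split; apply: cvg_near_cst; near=> t; rewrite /re_pair /im_pair big1// => j _; by rewrite mxE mul0r.
move: rsneg {rsE}; elim: rs v => [|l rs IH] v rsneg Hv.
  by have := Hv v; rewrite big_nil rmorph1 mulmx1.
apply: IH => [r rrs|u]; first by apply: rsneg; rewrite inE rrs orbT.
apply: (@pair_cvg0_factor _ _ A Z f l) => //; first by apply: rsneg; rewrite mem_head.
have := Hv u; rewrite big_cons mulrC rmorphM/= -mulmxE mulmxA.
by rewrite rmorphB/= horner_mx_X horner_mx_C mulmxBr mul_mx_scalar.
Unshelve. all: by end_near. Qed.

End StableSystems.

(** * Smoothing of flat paths *)

Section Smoothing.
Context {R : realType}.
Implicit Types (m : R -> R) (h : R).

(** The oscillation over the windows of length h between consecutive multiples of
    h vanishes at infinity; the Borel-Cantelli lemma speaks of these windows. *)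
Definition flat h m := forall e : R, 0 < e -> exists N : nat, forall n u,
  (N <= n)%N -> 0 <= u -> u <= h -> `|m (n%:R * h + u) - m (n%:R * h)| <= e.

(** A window with an arbitrary left end t meets at most two of the windows between
    multiples of h, whence the three terms. *)
Lemma flat_uniform h m : 0 < h -> flat h m -> forall e : R, 0 < e ->
  exists T0 : R, 0 <= T0 /\ forall t u, T0 <= t -> 0 <= u -> u <= h -> `|m (t + u) - m t| <= e.
Proof.
move=> h0 fm e e0; have e30 : 0 < e / 3 by rewrite divr_gt0.
have [N hN] := fm _ e30.
exists (N%:R * h); split=> [|t u ht u0 uh]; first by rewrite mulr_ge0// ltW.
have t0 : 0 <= t by rewrite (le_trans _ ht)// mulr_ge0// ltW.
have th0 : 0 <= t / h by rewrite divr_ge0// ltW.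
have /andP[] := truncn_itv th0; set n := Num.truncn _ => nle ltn.
have {nle}nht : n%:R * h <= t by rewrite -ler_pdivlMr.
have {ltn}tnh : t < n.+1%:R * h by rewrite -ltr_pdivrMr.
have Nn : (N <= n)%N.
  by rewrite -ltnS -(ltr_nat R) -(ltr_pM2r h0) (le_lt_trans ht).
have nS : n.+1%:R * h = n%:R * h + h by rewrite -natr1 mulrDl mul1r.
have [s0 sh] : 0 <= t - n%:R * h /\ t - n%:R * h <= h.
  by split; [rewrite subr_ge0|rewrite lerBlDl -nS ltW].
have h1 := hN n _ Nn s0 sh; rewrite subrKC in h1.
have [tu|/ltW tu] := lerP (t + u - n%:R * h) h.
  have := hN n (t + u - n%:R * h) Nn _ tu; rewrite subrKC.
  have -> : 0 <= t + u - n%:R * h by lra.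
  move=> /(_ isT) h2.
  have := ler_normB (m (t + u) - m (n%:R * h)) (m t - m (n%:R * h)).
  have -> : m (t + u) - m (n%:R * h) - (m t - m (n%:R * h)) = m (t + u) - m t by ring.
  lra.
have h2 := hN n h Nn (ltW h0) (lexx _).
rewrite -nS in h2.
have := hN n.+1 (t + u - n.+1%:R * h) (leqW Nn); rewrite subrKC.
have -> : 0 <= t + u - n.+1%:R * h by lra.
have -> : t + u - n.+1%:R * h <= h by lra.
move=> /(_ isT isT) h3.
have := ler_normD (m (t + u) - m (n.+1%:R * h)) (m (n.+1%:R * h) - m (n%:R * h) - (m t - m (n%:R * h))).
have := ler_normB (m (n.+1%:R * h) - m (n%:R * h)) (m t - m (n%:R * h)).
have -> : m (t + u) - m (n.+1%:R * h) +
   (m (n.+1%:R * h) - m (n%:R * h) - (m t - m (n%:R * h))) = m (t + u) - m t by ring.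
lra.
Qed.

(** The moving average [mt] of m over a window stays within o(1) of m, and its
    derivative is [(m (t + h) - m t) / h]. *)
Lemma flat_smoothing h m : 0 < h -> {within `[0%R, +oo[, continuous m} -> flat h m ->
  exists mt mt' : R -> R,
  [/\ forall t : R, 0 <= t -> is_derive t 1 mt (mt' t),
      mt' t @[t --> +oo] --> 0 &
      m t - mt t @[t --> +oo] --> 0].
Proof.
move=> h0 cm /(flat_uniform h0) fm.
have cmh := continuous_within_max0 cm.
have [Phi [dPhi _]] := continuous_primitive cmh.
pose mh t := m (Num.max t 0).
have mhE (t : R) : 0 <= t -> mh t = m t by move=> t0; rewrite /mh max_l.
exists (fun t => h^-1 * (Phi (t + h) - Phi t)), (fun t => h^-1 * (mh (t + h) - mh t)); split.
- move=> t t0; apply: is_derive_scale.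
  have d1 : is_derive t 1 (fun t => Phi (t + h)) (mh (t + h)).
    have dPhi1 := dPhi (t + h) (addr_ge0 t0 (ltW h0)).
    have dsh : is_derive t 1 (fun t => t + h) 1.
      by apply: (is_derive_eq (is_derive_add (is_derive_id t 1) (is_derive_cst h t 1))); rewrite addr0.
    by apply: (is_derive_eq (@is_derive1_comp R Phi (fun t => t + h) t _ _ dPhi1 dsh)); rewrite mulr1.
  exact: (is_derive_add d1 (is_deriveN (dPhi t t0))).
- apply/cvgrPdist_le => e e0.
  have [T0 [T00 hT]] := fm (h * e) (mulr_gt0 h0 e0).
  exists T0; split; first exact: num_real.
  move=> t /ltW Tt; rewrite sub0r normrN normrM gtr0_norm ?invr_gt0//.
  have t0 := le_trans T00 Tt.
  by rewrite ler_pdivrMl// !mhE ?addr_ge0//; [exact: hT (ltW h0) _|exact: ltW].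
- apply/cvgrPdist_le => e e0.
  have [T0 [T00 hT]] := fm e e0.
  exists T0; split; first exact: num_real.
  move=> t /ltW Tt; have t0 := le_trans T00 Tt.
  have tth : t <= t + h by rewrite lerDl ltW.
  have := @increment_bound R (fun s => Phi s - m t * s) (fun s => mh s - m t) t (t + h) e (ltW e0) tth.
  have -> : ((Phi (t + h) - m t * (t + h)) - (Phi t - m t * t)) = - (h * (m t - h^-1 * (Phi (t + h) - Phi t))) :> R.
    by field; rewrite gt_eqF.
  rewrite normrN normrM (gtr0_norm h0) addrAC subrr add0r mulrC ler_pM2r// sub0r normrN.
  apply.
  + move=> x tx; have x0 := le_trans t0 tx.
    apply: (is_derive_eq (is_derive_add (dPhi x x0) (is_deriveN (is_derive_scale (m t) (is_derive_id x 1))))).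
    by rewrite mulr1.
  + move=> x tx xth; rewrite mhE ?(le_trans t0 tx)//.
    by have := hT t (x - t) Tt; rewrite subrKC; apply; [rewrite subr_ge0|rewrite lerBlDl].
Qed.

End Smoothing.

(** * Solutions driven by a given path *)

Section Paths.
Context {R : realType}.
Local Notation mu := (@lebesgue_measure R).
Local Notation Re := complex.Re.
Local Notation Im := complex.Im.
Local Notation toC A := (map_mx (real_complex R) A).
Variable d : nat.
Implicit Types (A : 'M[R]_d) (xi : 'cV[R]_d) (X M : R -> 'cV[R]_d).

Definition drift_equation A xi X M := forall t, 0 <= t ->
  X t = xi + cv_integral `[0, t] (fun s => A *m X s) + M t.

Lemma within_continuous_coord m n (f : R -> 'M[R]_(m, n)) i j :
  {within `[0%R, +oo[, continuous f} -> {within `[0%R, +oo[, continuous (fun t => f t i j)}.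
Proof.
move=> cf t.
apply: (@cvg_comp _ _ _ f (fun M : 'M[R]_(m, n) => M i j) _ (nbhs (f t)) _ (cf t)).
exact: coord_continuous.
Qed.

(** Turns the integral equation into a differential equation for [X - M]. *)
Lemma drift_primitive A X : {within `[0%R, +oo[, continuous X} ->
  exists Phi : 'I_d -> R -> R, forall i,
    (forall t : R, 0 <= t -> is_derive t 1 (Phi i) ((A *m X t) i 0)) /\
    (forall t : R, 0 <= t ->
       cv_integral `[0, t] (fun s => A *m X s) i 0 = Phi i t - Phi i 0).
Proof.
move=> cX.
suff /choice[Phi] : forall i, exists Phi : R -> R,
    (forall t : R, 0 <= t -> is_derive t 1 Phi ((A *m X t) i 0)) /\
    (forall t : R, 0 <= t ->
       cv_integral `[0, t] (fun s => A *m X s) i 0 = Phi t - Phi 0) by exists Phi.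
move=> i; pose f (t : R) := (A *m X (Num.max t 0)) i 0.
have cf : continuous f.
  move=> t; rewrite /continuous_at /f.
  rewrite (_ : (fun t => (A *m X (Num.max t 0)) i 0) = fun t => \sum_j A i j * X (Num.max t 0) j 0); last first.
    by apply/funext => s; rewrite mxE.
  rewrite mxE; apply: cvg_big => [|j _]; first exact: add_continuous.
  apply: cvgMr; exact: (continuous_within_max0 (within_continuous_coord (i:=j) (j:=0) cX)).
have [Phi [dPhi iPhi]] := continuous_primitive cf; exists Phi; split=> t t0.
  by have := dPhi t t0; rewrite /f max_l.
rewrite -iPhi// mxE; apply: eq_Rintegral => s.
by rewrite inE/= in_itv/= => /andP[s0 _]; rewrite /f max_l.
Qed.

(** Let Mt be the moving average of M. Then [Z = X - (M - Mt)] is differentiable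
    and solves [Z' = A Z + A (X - Z) + Mt'], where [X - Z = M - Mt] and Mt' vanish
    at infinity. *)
Lemma solution_cvg0 A xi X M h : (0 < d)%N -> stable_mx A -> 0 < h ->
  {within `[0%R, +oo[, continuous X} -> {within `[0%R, +oo[, continuous M} ->
  drift_equation A xi X M -> (forall i, flat h (fun t => M t i 0)) ->
  X t @[t --> +oo] --> (0 : 'cV[R]_d).
Proof.
move=> d0 stA h0 cX cM eqX fM.
have [Phi hPhi] := drift_primitive A cX.
have /choice[ms] : forall i, exists ms : (R -> R) * (R -> R),
  [/\ forall t : R, 0 <= t -> is_derive t 1 ms.1 (ms.2 t),
      ms.2 t @[t --> +oo] --> 0 & M t i 0 - ms.1 t @[t --> +oo] --> 0].
  move=> i; have [mt [mt' hm]] := flat_smoothing h0 (within_continuous_coord (i:=i) (j:=0) cM) (fM i).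
  by exists (mt, mt').
move=> hms.
pose Z t : 'cV[R]_d := \col_i (xi i 0 + (Phi i t - Phi i 0) + (ms i).1 t).
have XZ t : 0 <= t -> forall i, X t i 0 = Z t i 0 + (M t i 0 - (ms i).1 t).
  move=> t0 i; rewrite {1}eqX// !mxE -(hPhi i).2//.
  by rewrite /cv_integral !mxE; ring.
have XZ0 j : X t j 0 - Z t j 0 @[t --> +oo] --> 0.
  have [_ _] := hms j; apply: cvg_trans; apply: near_eq_cvg.
  exists 0; split; first exact: num_real.
  by move=> t /ltW t0; rewrite XZ// addrAC subrr add0r.
have Z0 : forall i, Z t i 0 @[t --> +oo] --> 0.
  pose f t : 'cV[R]_d := \col_i ((A *m (X t - Z t)) i 0 + (ms i).2 t).
  have dZ : forall (t : R) i, 0 <= t ->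
      is_derive t 1 (fun t => Z t i 0) ((A *m Z t) i 0 + f t i 0).
    move=> t i t0; have [dm _ _] := hms i.
    rewrite (_ : (fun t => Z t i 0) = fun t => (xi i 0 - Phi i 0 + Phi i t) + (ms i).1 t); last first.
      by apply/funext => s; rewrite mxE; ring.
    apply: (is_derive_eq (is_derive_add (is_derive_add
      (is_derive_cst (xi i 0 - Phi i 0) t 1) ((hPhi i).1 t t0)) (dm t t0))).
    have -> : f t i 0 = (A *m (X t - Z t)) i 0 + (ms i).2 t by rewrite mxE.
    by rewrite add0r addrA mulmxBr !mxE subrKC.
  have f0 i : f t i 0 @[t --> +oo] --> 0.
    have [_ m0 _] := hms i.
    rewrite (_ : (fun t => f t i 0) = fun t => (\sum_j A i j * (X t j 0 - Z t j 0)) + (ms i).2 t); last first.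
      apply/funext => t; rewrite [LHS]mxE; congr (_ + _); rewrite mxE.
      by apply: eq_bigr => j _; rewrite !mxE.
    by rewrite -[X in _ --> X](addr0 0); apply: cvgD => //; exact: cvg_sum0.
  move: d0 => {hms hPhi XZ XZ0 eqX fM cX cM}; clear -stA dZ f0.
  by case: d A Z f stA dZ f0 => // d' A Z f stA dZ f0 _; exact: (stable_forced_cvg0 stA dZ f0).
apply/cvg_mxP => i j; rewrite (ord1 j) mxE.
rewrite -[X in _ --> X](addr0 0).
rewrite (_ : (fun t => X t i 0) = fun t => (X t i 0 - Z t i 0) + Z t i 0); last first.
  by apply/funext => t; rewrite subrK.
exact: cvgD.
Qed.

(** [M (t + h) - M t] is [X (t + h) - X t] minus the integral of [A X] over a window
    of fixed length. *)
Lemma solution_noise_increments A xi X M h : 0 < h ->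
  {within `[0%R, +oo[, continuous X} -> drift_equation A xi X M ->
  X t @[t --> +oo] --> (0 : 'cV[R]_d) ->
  forall i (e : R), 0 < e -> exists N, forall n : nat, (N <= n)%N ->
    `|M (n.+1%:R * h) i 0 - M (n%:R * h) i 0| <= e.
Proof.
move=> h0 cX eqX /cvg_mxP X0 i e e0.
have [Phi hPhi] := drift_primitive A cX.
have X0i j : X t j 0 @[t --> +oo] --> 0 by have := X0 j 0; rewrite mxE.
have AX0 : (A *m X t) i 0 @[t --> +oo] --> 0.
  rewrite (_ : (fun t => (A *m X t) i 0) = fun t => \sum_j A i j * X t j 0); last first.
    by apply/funext => t; rewrite mxE.
  exact: cvg_sum0.
have e30 : 0 < e / 3 by rewrite divr_gt0.
have eh0 : 0 < e / 3 / h by rewrite divr_gt0.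
move/cvgrPdist_le : (X0i i) => /(_ _ e30)[T1 [_ hT1]].
move/cvgrPdist_le : AX0 => /(_ _ eh0)[T2 [_ hT2]].
pose T0 := Num.max T1 T2.
exists (Num.truncn (T0 / h)).+1 => n hn.
have Tn : T0 < n%:R * h.
  rewrite -ltr_pdivrMr// (lt_le_trans (truncnS_gt _))// ler_nat.
  exact: hn.
have nn : n%:R * h <= n.+1%:R * h by rewrite ler_wpM2r ?ler_nat// ltW.
have [T1n T2n] : T1 < n%:R * h /\ T2 < n%:R * h.
  by move: Tn; rewrite /T0 gt_max => /andP[].
have n0 k : 0 <= k%:R * h by rewrite mulr_ge0// ltW.
have ME k : M (k%:R * h) i 0 = X (k%:R * h) i 0 - xi i 0 - (Phi i (k%:R * h) - Phi i 0).
  rewrite eqX// !mxE -(hPhi i).2// /cv_integral mxE; ring.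
rewrite !ME.
have h1 := hT1 _ T1n; have h2 := hT1 _ (lt_le_trans T1n nn).
rewrite !sub0r !normrN in h1 h2.
have h3 : `|Phi i (n.+1%:R * h) - Phi i (n%:R * h)| <= e / 3.
  have := @increment_bound R (Phi i) (fun t => (A *m X t) i 0) _ _ _ (ltW eh0) nn.
  rewrite -mulrBl -natr1 addrAC subrr add0r mul1r divfK ?gt_eqF//; apply.
    by move=> x nx; apply: (hPhi i).1; rewrite (le_trans _ nx).
  by move=> x nx _; have := hT2 x (lt_le_trans T2n nx); rewrite sub0r normrN.
move: h1 h2 h3; set x1 := X _ _ _; set x2 := X _ _ _; set p1 := Phi _ _; set p2 := Phi _ _.
set p0 := Phi _ _; move=> h1 h2 h3.
have -> : x2 - xi i 0 - (p1 - p0) - (x1 - xi i 0 - (p2 - p0)) = x2 - x1 - (p1 - p2) by ring.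
have := ler_normB (x2 - x1) (p1 - p2); have := ler_normB x2 x1; lra.
Qed.

(** The noise cancels in the differences D of the solutions and [X0]: they solve
    [D' = A D]. If v is a left eigenvector for l with [0 <= Re l], then |v D|^2 is
    nondecreasing; it tends to 0, so it vanishes at time 0, where D runs through a
    basis. *)
Lemma common_noise_stable A (xi : d.-tuple 'cV[R]_d) (Xs : 'I_d -> R -> 'cV[R]_d)
    (X0 M : R -> 'cV[R]_d) :
  basis_of fullv xi ->
  (forall i, {within `[0%R, +oo[, continuous (Xs i)}) ->
  {within `[0%R, +oo[, continuous X0} ->
  (forall i, drift_equation A (tnth xi i) (Xs i) M) -> drift_equation A 0 X0 M ->
  (forall i, Xs i t @[t --> +oo] --> (0 : 'cV[R]_d)) ->
  X0 t @[t --> +oo] --> (0 : 'cV[R]_d) -> stable_mx A.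
Proof.
move=> bxi cXs cX0 eqXs eqX0 Xs0 X00 l /eigenvalueP[v vA v_neq0].
rewrite ltNge; apply/negP => l0.
have [Phi0 hPhi0] := drift_primitive A cX0.
suff H i : re_pair v (tnth xi i) = 0 /\ im_pair v (tnth xi i) = 0.
  suff Hz z : re_pair v z = 0 /\ im_pair v z = 0.
    move/eqP: v_neq0; apply; apply/rowP => j.
    have [h1 h2] := Hz (\col_k (k == j)%:R).
    move: h1 h2; rewrite /re_pair /im_pair (bigD1 j)//= big1 => [|k kj]; last first.
      by rewrite mxE (negbTE kj) mulr0.
    rewrite mxE eqxx mulr1 addr0 => h1; rewrite (bigD1 j)//= big1 => [|k kj]; last first.
      by rewrite mxE (negbTE kj) mulr0.
    by rewrite mxE eqxx mulr1 addr0 => h2; apply/eqP; rewrite mxE eq_complex h1 h2/= !eqxx.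
  have -> := coord_basis bxi (memvf z).
  split.
    rewrite /re_pair; under eq_bigr do rewrite summxE big_distrr/=.
    rewrite exchange_big/= big1// => k _; have [+ _] := H k.
    rewrite /re_pair (tnth_nth 0) => h.
    under eq_bigr do rewrite mxE mulrCA.
    by rewrite -big_distrr/= h mulr0.
  rewrite /im_pair; under eq_bigr do rewrite summxE big_distrr/=.
  rewrite exchange_big/= big1// => k _; have [_] := H k.
  rewrite /im_pair (tnth_nth 0) => h.
  under eq_bigr do rewrite mxE mulrCA.
  by rewrite -big_distrr/= h mulr0.
have [Phi hPhi] := drift_primitive A (cXs i).
pose D t : 'cV[R]_d := \col_k (tnth xi i k 0 + (Phi k t - Phi k 0) - (Phi0 k t - Phi0 k 0)).
have DE (t : R) : 0 <= t -> D t = Xs i t - X0 t.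
  move=> t0; apply/colP => k; rewrite eqXs// eqX0// !mxE -(hPhi k).2// -(hPhi0 k).2//.
  by rewrite /cv_integral !mxE; ring.
have dD (t : R) k : 0 <= t -> is_derive t 1 (fun t => D t k 0) ((A *m D t) k 0).
  move=> t0; rewrite (_ : (fun t => D t k 0) =
      fun t => (tnth xi i k 0 - Phi k 0 + Phi0 k 0) + (Phi k t + - Phi0 k t)); last first.
    by apply/funext => s; rewrite mxE; ring.
  apply: (is_derive_eq (is_derive_add (is_derive_cst (tnth xi i k 0 - Phi k 0 + Phi0 k 0) t 1)
    (is_derive_add ((hPhi k).1 t t0) (is_deriveN ((hPhi0 k).1 t t0))))).
  by rewrite add0r DE// mulmxBr !mxE.
pose a t := re_pair v (D t); pose b t := im_pair v (D t).
have da (t : R) : 0 <= t -> is_derive t 1 a (Re l * a t - Im l * b t).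
  move=> t0; rewrite /a /b -re_pairZ -vA re_pair_mul.
  by apply: is_derive_lincomb => j; exact: dD.
have db (t : R) : 0 <= t -> is_derive t 1 b (Re l * b t + Im l * a t).
  move=> t0; rewrite /a /b -im_pairZ -vA im_pair_mul.
  by apply: is_derive_lincomb => j; exact: dD.
pose W t := a t * a t + b t * b t.
have dW (t : R) : 0 <= t -> is_derive t 1 W (2 * Re l * W t).
  move=> t0; apply: (is_derive_eq (is_derive_add (is_derive_mul (da t t0) (da t t0))
    (is_derive_mul (db t t0) (db t t0)))).
  by rewrite /W; ring.
have Wge0 t : 0 <= W t by rewrite addr_ge0// -expr2 sqr_ge0.
have Wnd (t : R) : 0 <= t -> W 0 <= W t.
  move=> t0; apply: (@ger0_derive1_ndecry _ W 0) => //.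
  - by move=> r; rewrite in_itv/= andbT => /ltW/dW[].
  - move=> r; rewrite in_itv/= andbT => /ltW r0; have [_] := dW r r0.
    by rewrite derive1E => ->; rewrite !mulr_ge0.
  - exact: is_derive_within_continuous dW.
have D0 k : D t k 0 @[t --> +oo] --> 0.
  have /cvg_mxP/(_ k 0) := Xs0 i; have /cvg_mxP/(_ k 0) := X00; rewrite !mxE => h1 h2.
  have h := cvgB h2 h1; rewrite subr0 in h; 
  apply: (@cvg_trans _ ((Xs i t k 0 - X0 t k 0) @[t --> +oo])); last exact: h.
  apply: near_eq_cvg.
  exists 0; split; first exact: num_real.
  by move=> t /ltW t0; rewrite DE// !mxE.
have W0 : W t @[t --> +oo] --> 0.
  rewrite -[X in _ --> X](addr0 0) -[in X in _ --> X](mulr0 0).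
  by apply: cvgD; apply: cvgM; apply: cvg_sum0 => k; exact: D0.
have {W0}W00 : W 0 <= 0.
  rewrite leNgt; apply/negP => Wgt0.
  have Whalf : 0 < W 0 / 2 by rewrite divr_gt0.
  move/cvgrPdist_le : W0 => /(_ _ Whalf)[T1 [_ hT1]].
  pose t := Num.max 0 (T1 + 1).
  have t0 : 0 <= t by rewrite le_max lexx.
  have T1t : T1 < t by rewrite lt_max ltrDl ltr01 orbT.
  have := hT1 _ T1t; rewrite sub0r normrN ger0_norm// => h.
  have := Wnd t t0; lra.
have D0E : D 0 = tnth xi i by apply/colP => k; rewrite mxE !subrr addr0 subr0.
have W0E : W 0 = 0 by apply/eqP; rewrite eq_le W00 Wge0.
have [] : a 0 = 0 /\ b 0 = 0.
  move: W0E; rewrite /W => /eqP; rewrite paddr_eq0 -?expr2 ?sqr_ge0// => /andP[].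
  by rewrite !sqrf_eq0 => /eqP-> /eqP->.
by rewrite /a /b D0E.
Qed.

End Paths.

(** * The integral criterion and the energies of fixed windows *)

Section Criterion.
Context {R : realType}.
Local Notation mu := (@lebesgue_measure R).

Lemma frobenius_sq m n (M : 'M[R]_(m, n)) :
  frobenius_norm M ^+ 2 = \sum_i \sum_j M i j ^+ 2.
Proof. by rewrite sqr_sqrtr// sumr_ge0// => i _; rewrite sumr_ge0// => j _; rewrite sqr_ge0. Qed.

(** The integrand of [I_crit]; at [x = 0] the factor x replaces the indicator. *)
Definition tail_weight (eps x : R) : R := x * expR (- ((eps ^+ 2 / 2) / x ^+ 2)).

Lemma tail_weight_ge0 eps x : 0 <= x -> 0 <= tail_weight eps x.
Proof. by move=> x0; rewrite mulr_ge0// expR_ge0. Qed.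

Lemma tail_weight_le eps x y : 0 <= x -> x <= y -> tail_weight eps x <= tail_weight eps y.
Proof.
rewrite le_eqVlt => /predU1P[<- y0|x0 xy].
  by rewrite /tail_weight mul0r mulr_ge0// expR_ge0.
have y0 := lt_le_trans x0 xy.
apply: ler_pM; rewrite ?expR_ge0 ?(ltW x0)//.
rewrite ler_expR lerN2 ler_wpM2l//; first by rewrite divr_ge0// sqr_ge0.
by rewrite lef_pV2 ?posrE ?exprn_gt0// lerXn2r// nnegrE ltW.
Qed.

(** By monotonicity on the half line. *)
Lemma measurable_tail_weight eps (D : set R) (f : R -> R) : measurable D ->
  measurable_fun D f -> (forall x, D x -> 0 <= f x) ->
  measurable_fun D (fun x => tail_weight eps (f x)).
Proof.
move=> mD mf f0.
apply: (@eq_measurable_fun _ _ _ _ D ((fun x => tail_weight eps (Num.max x 0)) \o f)).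
  by move=> x; rewrite inE => Dx/=; rewrite max_l// f0.
apply: measurableT_comp => //; apply: nondecreasing_measurable => //.
move=> x y xy; apply: tail_weight_le; first by rewrite le_max lexx orbT.
by rewrite ge_max !le_max xy lexx orbT.
Qed.

(** The case [V = 0] is singled out because the exponential equals 1 there, by the
    convention [0^-1 = 0]. *)
Definition exp_weight (K V : R) : R := if 0 < V then expR (- (K / V)) else 0.

Lemma exp_weight_ge0 K V : 0 <= exp_weight K V.
Proof. by rewrite /exp_weight; case: ifP => // _; exact: expR_ge0. Qed.

Variables (d r : nat) (sigma : R -> 'M[R]_(d, r)).
Hypothesis hsigma : {within `[0, +oo[, continuous sigma}.

Definition energy (a b : R) := \int[mu]_(s in `[a, b]) frobenius_norm (sigma s) ^+ 2.

Lemma continuous_frobenius_max0 :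
  continuous (fun t : R => frobenius_norm (sigma (Num.max t 0)) ^+ 2).
Proof.
move=> t; rewrite /continuous_at.
rewrite (_ : (fun t => frobenius_norm (sigma (Num.max t 0)) ^+ 2) =
   (fun t => \sum_i \sum_j sigma (Num.max t 0) i j ^+ 2)); last first.
  by apply/funext => s; rewrite frobenius_sq.
rewrite frobenius_sq.
apply: cvg_big => [|i _]; first exact: add_continuous.
apply: cvg_big => [|j _]; first exact: add_continuous.
have c := continuous_within_max0 (within_continuous_coord (i:=i) (j:=j) hsigma).
by rewrite expr2; apply: cvgM; exact: c.
Qed.

Lemma energy_primitive : exists Phi : R -> R,
  (forall t : R, 0 <= t -> is_derive t 1 Phi (frobenius_norm (sigma t) ^+ 2)) /\
  (forall a b : R, 0 <= a -> a <= b -> energy a b = Phi b - Phi a).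
Proof.
pose q t := frobenius_norm (sigma (Num.max t 0)) ^+ 2.
have cq : continuous q by exact: continuous_frobenius_max0.
have [Phi [dPhi iPhi]] := continuous_primitive cq.
exists Phi; split=> [t t0|a b a0 ab]; first by have := dPhi _ t0; rewrite /q max_l.
rewrite -iPhi//; apply: eq_Rintegral => s; rewrite inE/= in_itv/= => /andP[sa _].
by rewrite /q max_l// (le_trans a0).
Qed.

Lemma energy_ge0 a b : 0 <= energy a b.
Proof. by apply: Rintegral_ge0 => s _; rewrite sqr_ge0. Qed.

Lemma energyD a b c : 0 <= a -> a <= b -> b <= c -> energy a c = energy a b + energy b c.
Proof.
move=> a0 ab bc; have [Phi [_ hPhi]] := energy_primitive.
by rewrite !hPhi ?(le_trans a0)// ?(le_trans ab)//; ring.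
Qed.

Lemma energy_le a a' b' b : 0 <= a -> a <= a' -> a' <= b' -> b' <= b ->
  energy a' b' <= energy a b.
Proof.
move=> a0 aa' ab bb; rewrite (@energyD a a' b)// ?(le_trans ab)//.
rewrite (@energyD a' b' b)// ?(le_trans a0)//.
by have := energy_ge0 a a'; have := energy_ge0 b' b; lra.
Qed.

Variable c : R.
Hypothesis c0 : 0 < c.

Lemma varsigmaE t : varsigma sigma c t = Num.sqrt (energy t (t + c)).
Proof. by []. Qed.

Let D : set R := `[0%R, +oo[.

Lemma measurable_varsigma : measurable_fun D (varsigma sigma c).
Proof.
have [Phi [dPhi hPhi]] := energy_primitive.
have cPhi := continuous_within_max0 (is_derive_within_continuous dPhi).
apply: (@eq_measurable_fun _ _ _ _ D
  (fun t => Num.sqrt (Phi (Num.max (t + c) 0) - Phi (Num.max t 0)))).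
  move=> t; rewrite inE /D/= in_itv/= andbT => t0.
  by rewrite varsigmaE hPhi// ?lerDl ?ltW// !max_l// addr_ge0// ltW.
apply: measurable_funTS; apply: continuous_measurable_fun => t.
apply: (@cvg_comp _ _ _ _ Num.sqrt _ (nbhs (Phi (Num.max (t + c) 0) - Phi (Num.max t 0))) _); last exact: sqrt_continuous.
apply: cvgB; last exact: cPhi.
apply: (@cvg_comp _ _ _ (fun t => t + c) (fun t => Phi (Num.max t 0)) _ (nbhs (t + c)) _); last exact: cPhi.
by apply: cvgD; [exact: cvg_id|exact: cvg_cst].
Qed.

Let G eps t := (tail_weight eps (varsigma sigma c t))%:E.

Let G_ge0 eps t : (0 <= G eps t)%E.
Proof. by rewrite lee_fin tail_weight_ge0// sqrtr_ge0. Qed.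

Let measurable_G eps : measurable_fun D (G eps).
Proof.
have h : measurable_fun D (fun t => tail_weight eps (varsigma sigma c t)).
  apply: measurable_tail_weight; [exact: measurable_itv|exact: measurable_varsigma|].
  by move=> x _; exact: sqrtr_ge0.
exact/measurable_EFinP.
Qed.

Lemma I_critE eps : I_crit sigma c eps = (\int[mu]_(t in D) G eps t)%E.
Proof.
apply: eq_integral => t _; rewrite /G /tail_weight; congr EFin.
have [->|v0] := eqVneq (varsigma sigma c t) 0; first by rewrite !mul0r.
rewrite indicE mem_set ?mulr1//= in_itv/= andbT lt_neqAle eq_sym v0.
exact: sqrtr_ge0.
Qed.

Let cell h (n : nat) : set R := `[n%:R * h, n.+1%:R * h[%classic.

Lemma integral_cells h (f : R -> \bar R) : 0 < h -> measurable_fun D f -> (forall x, 0 <= f x)%E ->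
  (\int[mu]_(t in D) f t = \sum_(n <oo) \int[mu]_(t in cell h n) f t)%E.
Proof.
move=> h0 mf f0.
have DE : D = \bigcup_n cell h n.
  apply/seteqP; split=> [t|t [n _]]; rewrite /D /cell/= !in_itv/= ?andbT; last first.
    by move=> /andP[h1 _]; rewrite (le_trans _ h1)// mulr_ge0// ltW.
  move=> t0; have /truncn_itv/andP[h1 h2] : 0 <= t / h by rewrite divr_ge0// ltW.
  exists (Num.truncn (t / h)) => //=; rewrite in_itv/=.
  by rewrite -ler_pdivlMr// h1 -ltr_pdivrMr.
rewrite DE ge0_integral_bigcup//; first by move=> n; exact: measurable_itv.
- by rewrite -DE.
- apply/trivIsetP => i j _ _ ij; apply/seteqP; split=> // t [].
  rewrite /cell/= !in_itv/= => /andP[it ti] /andP[jt tj].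
  have lt_cells (k l : nat) : l%:R * h <= t -> t < k.+1%:R * h -> (k < l)%N = false.
    move=> lt tk; apply/negP => kl.
    have klh : k.+1%:R * h <= l%:R * h by rewrite ler_wpM2r ?ler_nat// ltW.
    by have := lt_le_trans (le_lt_trans lt tk) klh; rewrite ltxx.
  by move: ij; rewrite neq_ltn (lt_cells i j)// (lt_cells j i).
Qed.

Let measurable_cell h n : measurable (cell h n). Proof. exact: measurable_itv. Qed.

Let cell_measure h n : 0 < h -> mu (cell h n) = h%:E.
Proof.
move=> h0; rewrite /cell lebesgue_measure_itv/= lte_fin ltr_pM2r// ltr_nat ltnSn.
by rewrite -EFinB -mulrBl -natr1 addrAC subrr add0r mul1r.
Qed.

Let cell_sub h n : 0 < h -> cell h n `<=` D.
Proof.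
move=> h0 t; rewrite /cell /D/= !in_itv/= andbT => /andP[h1 _].
by rewrite (le_trans _ h1)// mulr_ge0// ltW.
Qed.

(** If t lies in a cell of length [c / 2], then the window from t to [t + c] contains
    the next cell, so that the integral over the cell is at least [c / 2] times the
    weight of the next one. *)
Lemma I_crit_sum eps : (I_crit sigma c eps < +oo)%E ->
  (\sum_(n <oo) (tail_weight eps
     (Num.sqrt (energy (n.+1%:R * (c / 2)) (n.+2%:R * (c / 2)))))%:E < +oo)%E.
Proof.
set h := c / 2; have h0 : 0 < h by rewrite divr_gt0.
set V := fun n : nat => energy (n.+1%:R * h) (n.+2%:R * h).
have W0 n : 0 <= tail_weight eps (Num.sqrt (V n)) by rewrite tail_weight_ge0// sqrtr_ge0.
rewrite I_critE (integral_cells h0 (@measurable_G eps) (@G_ge0 eps)) => Ifin.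
have : (\sum_(n <oo) h%:E * (tail_weight eps (Num.sqrt (V n)))%:E < +oo)%E.
  apply: le_lt_trans Ifin; apply: lee_nneseries => [i _ _|n _].
    by rewrite mule_ge0 ?lee_fin// ltW.
  have -> : (h%:E * (tail_weight eps (Num.sqrt (V n)))%:E =
      \int[mu]_(t in cell h n) cst (tail_weight eps (Num.sqrt (V n)))%:E t)%E.
    rewrite integral_cst; last exact: measurable_cell.
    rewrite muleC; congr (_ * _)%E; exact/esym/(cell_measure n h0).
  apply: ge0_le_integral.
  - exact: measurable_cell.
  - by move=> t _; rewrite /= lee_fin.
  - exact: measurable_cst.
  - apply: measurable_funS (@cell_sub _ n h0) (@measurable_G eps).
    exact: measurable_itv.
  move=> t; rewrite /cell/= in_itv/= => /andP[nt tn].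
  rewrite lee_fin; apply: tail_weight_le; first exact: sqrtr_ge0.
  rewrite varsigmaE ler_sqrt ?energy_ge0//.
  apply: energy_le.
  - by rewrite (le_trans _ nt)// mulr_ge0// ltW.
  - exact: ltW.
  - by rewrite ler_wpM2r ?ler_nat// ltW.
  - have -> : n.+2%:R * h = n%:R * h + c :> R by rewrite -natr1 -natr1 /h; field.
    by rewrite lerD2r.
rewrite nneseriesZl; last by move=> i _; rewrite lee_fin.
move=> hS; rewrite ltey; apply/eqP => Soo.
by move: hS; rewrite Soo gt0_muley ?lte_fin// ltxx.
Qed.

(** As long as the energies stay bounded, the prefactor of [tail_weight] does not
    matter. *)
Lemma sqrtr_exp_weight_bound (eps V B : R) : 0 < eps -> 0 <= V -> V <= B ->
  tail_weight eps (Num.sqrt (2 * V)) <= Num.sqrt (2 * B) * exp_weight (eps ^+ 2 / 4) V.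
Proof.
move=> e0 V0 VB; rewrite /tail_weight /exp_weight; case: ifPn => [V0'|].
  apply: ler_pM; rewrite ?sqrtr_ge0 ?expR_ge0//.
    by rewrite ler_sqrt ?ler_wpM2l// mulr_ge0// (le_trans V0).
  rewrite ler_expR lerN2 sqr_sqrtr; last by rewrite mulr_ge0.
  by rewrite le_eqVlt; apply/orP; left; apply/eqP; field; rewrite gt_eqF.
rewrite -leNgt => V0'; have -> : V = 0 by apply/eqP; rewrite eq_le V0 V0'.
by rewrite mulr0 sqrtr0 mul0r mulr0.
Qed.

(** The window from t to [t + c] meets two consecutive cells of length c, and its
    energy is at most twice the larger of theirs. *)
Lemma I_crit_fin eps : 0 < eps ->
  (forall K, 0 < K -> exists S, forall N : nat,
    \sum_(n < N) exp_weight K (energy (n%:R * c) (n.+1%:R * c)) <= S) ->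
  (I_crit sigma c eps < +oo)%E.
Proof.
move=> e0 H.
set V := fun n : nat => energy (n%:R * c) (n.+1%:R * c).
have V0 n : 0 <= V n by exact: energy_ge0.
have K0 : 0 < eps ^+ 2 / 4 by rewrite divr_gt0// exprn_gt0.
set K := eps ^+ 2 / 4 in K0; have [S hS] := H K K0.
(* The terms of a convergent series tend to 0, so the energies are bounded. *)
have [B [B0 hB]] : exists B, 0 <= B /\ forall n, V n <= B.
  have : cvgn (series (fun n => exp_weight K (V n))).
    apply: nondecreasing_is_cvgn.
      by apply/nondecreasing_seqP => n; rewrite /series/= big_nat_recr//= lerDl exp_weight_ge0.
    by exists S => _ [N _ <-]; rewrite /series/= big_mkord.
  move/cvg_series_cvg_0/cvgrPdist_lt => /(_ _ (expR_gt0 (-1)))[N _ hN].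
  exists (K + \sum_(n < N) V n); split; first by rewrite addr_ge0 ?(ltW K0) ?sumr_ge0.
  move=> n; have [Nn|nN] := leqP N n; last first.
    rewrite (bigD1 (Ordinal nN))//= addrCA lerDl.
    by rewrite addr_ge0 ?(ltW K0) ?sumr_ge0.
  have := hN _ Nn; rewrite /= sub0r normrN ger0_norm ?exp_weight_ge0// /exp_weight.
  case: ifPn => [Vn0|]; last first.
    by rewrite -leNgt => h _; rewrite (le_trans h)// addr_ge0 ?(ltW K0) ?sumr_ge0.
  rewrite ltr_expR ltrN2 => h; apply: (@le_trans _ _ K); last by rewrite lerDl sumr_ge0.
  by rewrite ltW//; move: h; rewrite ltr_pdivlMr// mul1r.
pose C := c * Num.sqrt (2 * B).
have C0 : 0 <= C by rewrite mulr_ge0 ?sqrtr_ge0// ltW.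
rewrite I_critE (integral_cells c0 (@measurable_G eps) (@G_ge0 eps)).
apply: (@le_lt_trans _ _ (C * (S + S))%:E); last exact: ltry.
apply: lime_le; first by apply: is_cvg_nneseries => n _ _; apply: integral_ge0 => t _; exact: G_ge0.
apply: nearW => N.
apply: (@le_trans _ _ (\sum_(0 <= n < N) (C * (exp_weight K (V n) + exp_weight K (V n.+1)))%:E)%E).
  apply: lee_sum => n _.
  apply: (@le_trans _ _ (\int[mu]_(t in cell c n) cst (Num.sqrt (2 * B) * (exp_weight K (V n) + exp_weight K (V n.+1)))%:E t)%E).
    apply: ge0_le_integral.
    - exact: measurable_cell.
    - by move=> t _; exact: G_ge0.
    - apply: measurable_funS (@cell_sub _ n c0) (@measurable_G eps).
      exact: measurable_itv.
    - exact: measurable_cst.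
    - move=> t; rewrite /cell/= in_itv/= => /andP[nt tn].
      have n0 : 0 <= n%:R * c by rewrite mulr_ge0// ltW.
      have nS k : k.+1%:R * c = k%:R * c + c by rewrite -natr1 mulrDl mul1r.
      have vle : energy t (t + c) <= V n + V n.+1.
        have nle k : k%:R * c <= k.+1%:R * c by rewrite ler_wpM2r ?ler_nat// ltW.
        have -> : V n + V n.+1 = energy (n%:R * c) (n.+2%:R * c).
          by rewrite (@energyD _ (n.+1%:R * c)).
        apply: energy_le; rewrite ?lerDl ?(ltW c0)//.
        by rewrite (nS n.+1) lerD2r ltW.
      rewrite lee_fin mulrDr.
      have [VV|/ltW VV] := leP (V n) (V n.+1).
        apply: (@le_trans _ _ (tail_weight eps (Num.sqrt (2 * V n.+1)))).
          apply: tail_weight_le; first exact: sqrtr_ge0.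
          by rewrite varsigmaE ler_sqrt ?mulr_ge0//; lra.
        rewrite (le_trans (sqrtr_exp_weight_bound e0 (V0 _) (hB _)))//.
        by rewrite lerDr mulr_ge0 ?sqrtr_ge0 ?exp_weight_ge0.
      apply: (@le_trans _ _ (tail_weight eps (Num.sqrt (2 * V n)))).
        apply: tail_weight_le; first exact: sqrtr_ge0.
        by rewrite varsigmaE ler_sqrt ?mulr_ge0//; lra.
      rewrite (le_trans (sqrtr_exp_weight_bound e0 (V0 _) (hB _)))//.
      by rewrite lerDl mulr_ge0 ?sqrtr_ge0 ?exp_weight_ge0.
  rewrite integral_cst; last exact: measurable_cell.
  rewrite [X in (_ * X)%E](_ : _ = c%:E); last exact: cell_measure.
  rewrite -EFinM lee_fin mulrC mulrA.
  exact: lexx.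
rewrite sumEFin lee_fin -big_distrr/= ler_wpM2l// big_split/= lerD//.
  by rewrite big_mkord hS.
apply: le_trans (hS N.+1).
by rewrite big_mkord big_ord_recl/= lerDr exp_weight_ge0.
Qed.

End Criterion.

(** * Weighted laws and the Gaussian moment generating function *)

Section WeightedLaw.
Context {dT : measure_display} {T : measurableType dT} {R : realType}.
Variables (P : {measure set T -> \bar R}) (mu : {measure set (measurableTypeR R) -> \bar R}).
Variables (Z Y : T -> R) (k : R).
Hypotheses (mZ : measurable_fun setT Z) (Z0 : forall w, 0 <= Z w)
  (mY : measurable_fun setT (Y : T -> measurableTypeR R)).
Hypothesis law : forall U : set (measurableTypeR R), measurable U ->
  (\int[P]_w (Z w * \1_U (Y w))%:E = k%:E * mu U)%E.

Import HBNNSimple.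
Local Open Scope ereal_scope.

Let law_nnsfun (h : {nnsfun (measurableTypeR R) >-> R}) :
  \int[P]_w ((Z w)%:E * (h (Y w))%:E) = k%:E * \int[mu]_x (h x)%:E.
Proof.
have mh y : measurable (h @^-1` [set y]).
  by rewrite -[_ @^-1` _]setTI; exact: (measurable_funP h).
under eq_integral.
  move=> w _; rewrite fimfunE -fsumEFin// ge0_mule_fsumr; last first.
    by move=> r; rewrite EFinM nnfun_muleindic_ge0.
  over.
rewrite [LHS]ge0_integral_fsum//; last 2 first.
  - move=> r; apply: emeasurable_funM; first exact/measurable_EFinP.
    apply/measurable_EFinP; apply: measurable_funM => //.
    exact: (measurableT_comp (measurable_indic (mh r)) mY).
  - by move=> r w _; rewrite mule_ge0 ?lee_fin// -lee_fin EFinM nnfun_muleindic_ge0.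
under [in RHS]eq_integral do rewrite fimfunE -fsumEFin//.
rewrite [in RHS]ge0_integral_fsum//; last 2 first.
  - by move=> r; apply/measurable_EFinP; apply: measurable_funM.
  - by move=> r w _; rewrite EFinM nnfun_muleindic_ge0.
rewrite ge0_mule_fsumr; last first.
  by move=> r; apply: integral_ge0 => x _; rewrite EFinM nnfun_muleindic_ge0.
apply: eq_fsbigr => r; rewrite inE => -[x _ <-].
rewrite (@integralZl_indic_nnsfun _ _ _ mu setT)//= integral_indic// setIT.
rewrite muleCA -(law (mh _)) -ge0_integralZl//.
- by apply: eq_integral => w _; rewrite -!EFinM mulrCA.
- apply/measurable_EFinP; apply: measurable_funM => //.
  exact: (measurableT_comp (measurable_indic (mh (h x))) mY).
- by move=> w _; rewrite lee_fin mulr_ge0.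
- by rewrite lee_fin.
Qed.

(** Independence and product laws are given on events; approximation by simple
    functions carries them over to exponentials. *)
Lemma integral_weighted_law (f : R -> R) : measurable_fun setT (f : measurableTypeR R -> R) ->
  (forall x, (0 <= f x)%R) ->
  \int[P]_w (Z w * f (Y w))%:E = k%:E * \int[mu]_x (f x)%:E.
Proof.
move=> mf f0.
have mEf : measurable_fun [set: measurableTypeR R] (EFin \o f) by exact/measurable_EFinP.
pose f_ := nnsfun_approx measurableT mEf.
have nd x : {homo (fun n => f_ n x) : m n / (m <= n)%N >-> (m <= n)%R}.
  by move=> m n mn; exact/lefP/nd_nnsfun_approx.
have fcv x : (f_ n x)%:E @[n --> \oo] --> (f x)%:E.
  by apply: (@cvg_nnsfun_approx _ _ _ _ measurableT _ mEf) => // y _; rewrite lee_fin.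
transitivity (limn (fun n => \int[P]_w ((Z w)%:E * (f_ n (Y w))%:E))).
  rewrite -monotone_convergence//=.
  - apply: eq_integral => w _; rewrite EFinM; apply/esym/cvg_lim => //.
    by apply: cvgeZl => //; exact: fcv.
  - move=> n; apply: emeasurable_funM; first exact/measurable_EFinP.
    by apply/measurable_EFinP; apply: (measurableT_comp (f := f_ n)) => //.
  - by move=> n w _; rewrite mule_ge0// lee_fin.
  - by move=> w _ a b ab; rewrite lee_wpmul2l// ?lee_fin//; exact: nd.
rewrite (_ : \int[mu]_x _ = limn (fun n => \int[mu]_x (f_ n x)%:E)); last first.
  rewrite -monotone_convergence//=.
  - by apply: eq_integral => x _; apply/esym/cvg_lim => //; exact: fcv.
  - by move=> n; exact/measurable_EFinP.
  - by move=> n x _; rewrite lee_fin.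
  - by move=> x _ a b ab; rewrite lee_fin; exact: nd.
rewrite -limeMl//.
  by congr (limn _); apply/funext => n /=; rewrite law_nnsfun.
apply/ereal_nondecreasing_is_cvgn => a b ab; apply: ge0_le_integral => //.
- by move=> x _; rewrite lee_fin.
- exact/measurable_EFinP.
- exact/measurable_EFinP.
- by move=> x _; rewrite lee_fin; exact: nd.
Qed.

End WeightedLaw.

Section NormalMgf.
Context {R : realType}.

(** Lebesgue measure weighted by the density is an instance of
    [integral_weighted_law]. *)
Lemma integral_normal_prob_ge0 (v : R) (f : R -> R) :
  measurable_fun setT (f : measurableTypeR R -> R) -> (forall x, 0 <= f x) ->
  (\int[normal_prob 0 v]_x (f x)%:E =
   \int[lebesgue_measure]_x (normal_pdf 0 v x * f x)%:E)%E.
Proof.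
move=> mf f0.
rewrite (@integral_weighted_law _ (measurableTypeR R) R lebesgue_measure (normal_prob 0 v)
  (normal_pdf 0 v) id 1)//.
- by rewrite mul1e.
- exact: measurable_normal_pdf.
- by move=> w; exact: normal_pdf_ge0.
- move=> U mU; rewrite mul1e /normal_prob [RHS]integral_mkcond.
  apply: eq_integral => x _; rewrite patchE indicE.
  by case: (x \in U); rewrite ?mulr1 ?mulr0.
Qed.

(** Completing the square leaves the normal density of mean [a v]. *)
Lemma normal_mgf (v a : R) : 0 < v ->
  (\int[normal_prob 0 (Num.sqrt v)]_x (expR (a * x))%:E = (expR (a ^+ 2 * v / 2))%:E)%E.
Proof.
move=> v0; have sv0 : Num.sqrt v != 0 by rewrite gt_eqF// sqrtr_gt0.
rewrite integral_normal_prob_ge0; last 2 first.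
- apply: measurableT_comp => //; exact: measurable_funM.
- by move=> x; exact: expR_ge0.
rewrite (_ : (fun x => _) = (fun x => (expR (a ^+ 2 * v / 2))%:E *
   (normal_pdf (a * v) (Num.sqrt v) x)%:E)%E); last first.
  apply/funext => x; rewrite -EFinM; congr EFin.
  rewrite !normal_pdfE// -[LHS]mulrA [RHS]mulrCA; congr (_ * _).
  rewrite /normal_fun -!expRD sqr_sqrtr ?ltW//; congr expR.
  by field; rewrite gt_eqF.
rewrite ge0_integralZl//.
- by rewrite integral_normal_pdf mule1.
- by apply/measurable_EFinP; exact: measurable_normal_pdf.
- by move=> x _; rewrite lee_fin normal_pdf_ge0.
Qed.

End NormalMgf.

(** * Tail bounds for conditionally Gaussian increments *)

Section SubSigmaAlgebra.
Context {dT : measure_display} {T : measurableType dT} {R : realType}.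
Variable P : probability T R.
Implicit Types (G H : set (set T)) (f g Z W : T -> R).

(** A condition on preimages only, so that one function can be tested against all
    the sigma-algebras of a filtration. *)
Definition gmeas G f := forall U : set (measurableTypeR R), measurable U -> G (f @^-1` U).

Lemma gmeas_comp G f (g : R -> R) : gmeas G f ->
  measurable_fun setT (g : measurableTypeR R -> measurableTypeR R) -> gmeas G (fun w => g (f w)).
Proof.
move=> hf mg U mU; rewrite (_ : _ @^-1` U = f @^-1` (g @^-1` U))//.
by apply: hf; rewrite -[X in measurable X]setTI; exact: mg.
Qed.

Lemma gmeasS G H f : G `<=` H -> gmeas G f -> gmeas H f.
Proof. by move=> GH hf U mU; exact/GH/hf. Qed.

Lemma gmeas_measurable G f : G `<=` measurable -> gmeas G f -> measurable_fun setT f.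
Proof. by move=> Gm hf _ U mU; rewrite setTI; exact/Gm/hf. Qed.

(** Sums and products are handled in the type whose measurable sets are those of G. *)
Lemma gmeasP G f : sigma_algebra setT G -> gmeas G f <->
  measurable_fun setT (f : g_sigma_algebraType G -> measurableTypeR R).
Proof.
move=> sG; have E := measurable_g_measurableTypeE sG; split=> [hf _ U mU|mf U mU].
  by rewrite setTI E; exact: hf.
by rewrite -E -[X in measurable X]setTI; exact: mf.
Qed.

Lemma gmeasD G f g : sigma_algebra setT G -> gmeas G f -> gmeas G g ->
  gmeas G (fun w => f w + g w).
Proof.
move=> sG /(gmeasP _ sG) hf /(gmeasP _ sG) hg; apply/gmeasP => //.
exact: measurable_funD.
Qed.

Lemma gmeasM G f g : sigma_algebra setT G -> gmeas G f -> gmeas G g ->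
  gmeas G (fun w => f w * g w).
Proof.
move=> sG /(gmeasP _ sG) hf /(gmeasP _ sG) hg; apply/gmeasP => //.
exact: measurable_funM.
Qed.

Lemma gmeas_cst G (c : R) : sigma_algebra setT G -> gmeas G (fun=> c).
Proof. by move=> sG; apply/gmeasP => //; exact: measurable_cst. Qed.

Lemma gmeas_indic G A : sigma_algebra setT G -> G A -> gmeas G \1_A.
Proof.
move=> sG GA; apply/gmeasP => //; apply: measurable_indic.
by rewrite measurable_g_measurableTypeE.
Qed.

Lemma gmeas_expR G (theta : R) f : gmeas G f -> gmeas G (fun w => expR (theta * f w)).
Proof.
move=> hf; apply: (gmeas_comp (g := fun x => expR (theta * x)) hf).
by apply: measurableT_comp => //; exact: measurable_funM.
Qed.

Lemma gmeas_sum G (I : Type) (s : seq I) (f : I -> T -> R) : sigma_algebra setT G ->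
  (forall i, gmeas G (f i)) -> gmeas G (fun w => \sum_(i <- s) f i w).
Proof.
move=> sG hf; elim: s => [|i s IH].
  by under eq_fun do rewrite big_nil; exact: gmeas_cst.
by under eq_fun do rewrite big_cons; exact: gmeasD.
Qed.

Lemma sigma_setU G A B : sigma_algebra setT G -> G A -> G B -> G (A `|` B).
Proof.
move=> sG; rewrite -(measurable_g_measurableTypeE sG); exact: measurableU.
Qed.

Lemma sigma_setI G A B : sigma_algebra setT G -> G A -> G B -> G (A `&` B).
Proof.
move=> sG; rewrite -(measurable_g_measurableTypeE sG); exact: measurableI.
Qed.

Lemma sigma_setC G A : sigma_algebra setT G -> G A -> G (~` A).
Proof.
move=> sG; rewrite -(measurable_g_measurableTypeE sG); exact: measurableC.
Qed.

Lemma sigma_setT G : sigma_algebra setT G -> G setT.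
Proof.
move=> sG; rewrite -(measurable_g_measurableTypeE sG); exact: measurableT.
Qed.

Local Open Scope ereal_scope.

(** [integral_weighted_law] is used twice: for the indicator of an event of G
    against the law of W, then for W against the law of Z. *)
Lemma integral_indep G H Z W (k : R) : G `<=` measurable -> H `<=` measurable ->
  indep_sigma P G H -> gmeas G Z -> gmeas H W ->
  (forall w, 0 <= Z w)%R -> (forall w, 0 <= W w)%R -> \int[P]_w (W w)%:E = k%:E ->
  \int[P]_w (Z w * W w)%:E = \int[P]_w (Z w)%:E * k%:E.
Proof.
move=> Gm Hm ind gZ gW Z0 W0 EW.
have mZ := gmeas_measurable Gm gZ; have mW := gmeas_measurable Hm gW.
pose W' : {mfun T >-> measurableTypeR R} :=
  HB.pack (W : T -> measurableTypeR R) (isMeasurableFun.Build _ _ T (measurableTypeR R) W mW).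
pose Z' : {mfun T >-> measurableTypeR R} :=
  HB.pack (Z : T -> measurableTypeR R) (isMeasurableFun.Build _ _ T (measurableTypeR R) Z mZ).
have k0 : (0 <= k)%R by rewrite -lee_fin -EW integral_ge0// => w _; rewrite lee_fin.
have step A : G A -> \int[P]_w (\1_A w * W w)%:E = P A * k%:E.
  move=> GA; have mA := Gm _ GA.
  have PAfin : P A \is a fin_num by exact: fin_num_measure.
  have law U : measurable U ->
      \int[P]_w (\1_A w * \1_U (W w))%:E = (fine (P A))%:E * pushforward P W' U.
    move=> mU; rewrite fineK// /pushforward -ind//; last exact: gW.
    have mWU : measurable (W @^-1` U) by exact/Hm/gW.
    rewrite -(setIT (A `&` _)) -integral_indic//=; last exact: measurableI.
    apply: eq_integral => w _.
    by rewrite !indicE in_setI; case: (w \in A); rewrite ?mul1r ?mul0r.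
  under eq_integral do rewrite -[W _]ger0_norm//.
  rewrite (integral_weighted_law (measurable_indic mA) _ mW law
    (f := fun x : R => `|x|%R))//; last exact: normr_measurable.
  rewrite fineK// ge0_integral_pushforward//; last first.
    by apply/measurable_EFinP; exact: normr_measurable.
  congr (_ * _); rewrite -EW; apply: eq_integral => w _ /=.
  by rewrite ger0_norm.
have law U : measurable U -> \int[P]_w (W w * \1_U (Z w))%:E = k%:E * pushforward P Z' U.
  move=> mU; rewrite /pushforward muleC -step; last exact: gZ.
  by apply: eq_integral => w _; rewrite mulrC.
rewrite muleC.
under eq_integral do rewrite mulrC -[Z _]ger0_norm//.
rewrite (integral_weighted_law mW W0 mZ law (f := fun x : R => `|x|%R))//;
  last exact: normr_measurable.
rewrite ge0_integral_pushforward//; last first.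
  by apply/measurable_EFinP; exact: normr_measurable.
congr (_ * _); apply: eq_integral => w _ /=.
by rewrite ger0_norm.
Qed.

End SubSigmaAlgebra.

Section RealValuedIntegrals.
Context {dT : measure_display} {T : measurableType dT} {R : realType}.
Variable P : {measure set T -> \bar R}.
Local Open Scope ereal_scope.

Lemma ge0_integral_scale (f : T -> R) (c x : R) : measurable_fun setT f -> (forall w, 0 <= f w)%R ->
  (0 <= c)%R -> \int[P]_w (f w)%:E = x%:E -> \int[P]_w (f w * c)%:E = (x * c)%:E.
Proof.
move=> mf f0 c0 fx; rewrite EFinM -fx -ge0_integralZr//; first exact/measurable_EFinP.
by move=> w _; rewrite lee_fin.
Qed.

Lemma ge0_integral_add (f g : T -> R) (x y : R) : measurable_fun setT f -> (forall w, 0 <= f w)%R ->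
  measurable_fun setT g -> (forall w, 0 <= g w)%R ->
  \int[P]_w (f w)%:E = x%:E -> \int[P]_w (g w)%:E = y%:E ->
  \int[P]_w (f w + g w)%:E = (x + y)%:E.
Proof.
move=> mf f0 mg g0 fx gy; rewrite EFinD -fx -gy -ge0_integralD//.
- by move=> w _; rewrite lee_fin.
- exact/measurable_EFinP.
- by move=> w _; rewrite lee_fin.
- exact/measurable_EFinP.
Qed.

End RealValuedIntegrals.

Section GaussianIncrements.
Context {dT : measure_display} {T : measurableType dT} {R : realType}.
Variable P : probability T R.
Local Open Scope ereal_scope.

(** Increments that are, conditionally on the past, centered Gaussian with
    deterministic variances. The weights Z, which depend on the past, encode the
    conditioning; the moment generating function is all that the tail bounds use. *)
Record gaussian_increments (G : nat -> set (set T)) (zeta : nat -> T -> R) (v : nat -> R) : Prop := {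
  gi_sigma : forall i, sigma_algebra setT (G i) ;
  gi_meas : forall i, G i `<=` measurable ;
  gi_mono : forall i, G i `<=` G i.+1 ;
  gi_adapted : forall i, gmeas (G i.+1) (zeta i) ;
  gi_var : forall i, (0 <= v i)%R ;
  gi_mgf : forall i (theta : R) Z, gmeas (G i) Z -> (forall w, 0 <= Z w)%R ->
    \int[P]_w (Z w * expR (theta * zeta i w))%:E =
    \int[P]_w (Z w)%:E * (expR (theta ^+ 2 * v i / 2))%:E }.

Lemma gaussian_incrementsN G zeta v : gaussian_increments G zeta v ->
  gaussian_increments G (fun i w => - zeta i w)%R v.
Proof.
move=> [h1 h2 h3 h4 h5 h6]; split=> //.
- move=> i; apply: (gmeas_comp (g := fun x : R => (- x)%R) (h4 i)).
  exact: oppr_measurable.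
- move=> i theta Z gZ Z0; have := h6 i (- theta)%R Z gZ Z0; rewrite sqrrN => <-.
  by apply: eq_integral => w _; rewrite mulrN mulNr.
Qed.

Lemma gaussian_increments_shift m G zeta v : gaussian_increments G zeta v ->
  gaussian_increments (fun i => G (m + i)%N) (fun i => zeta (m + i)%N) (fun i => v (m + i)%N).
Proof.
move=> [h1 h2 h3 h4 h5 h6]; split=> i; rewrite ?addnS;
  [exact: h1|exact: h2|exact: h3|exact: h4|exact: h5|exact: h6].
Qed.

Section OneSequence.
Variables (G : nat -> set (set T)) (zeta : nat -> T -> R) (v : nat -> R).
Hypothesis gi : gaussian_increments G zeta v.

Let S n w : R := (\sum_(i < n) zeta i w)%R.
Let V n : R := (\sum_(i < n) v i)%R.

Let sG i : sigma_algebra setT (G i). Proof. exact: (gi_sigma gi). Qed.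
Let GM i : G i `<=` measurable. Proof. exact: (gi_meas gi). Qed.
Let GS i : G i `<=` G i.+1. Proof. exact: (gi_mono gi). Qed.

Let SS n w : S n.+1 w = (S n w + zeta n w)%R.
Proof. by rewrite /S big_ord_recr. Qed.
Let VS n : V n.+1 = (V n + v n)%R.
Proof. by rewrite /V big_ord_recr. Qed.

Lemma gi_le m n : (m <= n)%N -> G m `<=` G n.
Proof.
move=> /subnK <-; elim: (n - m)%N => // k IH; apply: subset_trans IH _.
exact: GS.
Qed.

Let gmeas_S n : gmeas (G n) (S n).
Proof.
elim: n => [|n IH].
  rewrite (_ : S 0 = fun=> 0%R); first by apply: gmeas_cst; exact: sG.
  by apply/funext => w; rewrite /S big_ord0.
rewrite (_ : S n.+1 = fun w => (S n w + zeta n w)%R); last by apply/funext => w; rewrite SS.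
apply: gmeasD; [exact: sG| |exact: (gi_adapted gi)].
by apply: gmeasS IH; exact: (gi_mono gi).
Qed.

Let mG n (f : T -> R) : gmeas (G n) f -> measurable_fun setT f.
Proof. by move=> gf; exact: gmeas_measurable (@GM n) gf. Qed.

Lemma partial_sum_mgf n (theta : R) Z : gmeas (G 0%N) Z -> (forall w, 0 <= Z w)%R ->
  \int[P]_w (Z w * expR (theta * S n w))%:E =
  \int[P]_w (Z w)%:E * (expR (theta ^+ 2 * V n / 2))%:E.
Proof.
move=> gZ Z0; elim: n => [|n IH].
  rewrite /V big_ord0 mulr0 mul0r expR0 mule1; apply: eq_integral => w _.
  by rewrite /S big_ord0 mulr0 expR0 mulr1.
under eq_integral do rewrite SS mulrDr expRD mulrA.
rewrite (gi_mgf gi).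
- by rewrite IH -muleA -EFinM -expRD VS; congr (_ * (expR _)%:E); ring.
- apply: gmeasM (sG _) _ _; first exact: gmeasS (gi_le (leq0n n)) gZ.
  exact: gmeas_expR.
- by move=> w; rewrite mulr_ge0// expR_ge0.
Qed.

Let A eps n : set T := [set w | exists k, (k <= n)%N /\ (eps <= S k w)%R].

Let AS eps n : A eps n.+1 = A eps n `|` [set w | (eps <= S n.+1 w)%R].
Proof.
apply/seteqP; split=> [w [k [kn h]]|w [[k [kn h]]|h]].
- by move: kn; rewrite leq_eqVlt => /predU1P[<-|kn]; [right|left; exists k].
- by exists k; rewrite (leqW kn).
- by exists n.+1.
Qed.

Let G_ge n eps : G n [set w | (eps <= S n w)%R].
Proof.
have := gmeas_S n (measurable_itv `[eps, +oo[); congr (G n _).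
by apply/seteqP; split=> w/=; rewrite in_itv/= andbT.
Qed.

Let G_A eps n : G n (A eps n).
Proof.
elim: n => [|n IH].
  rewrite (_ : A _ _ = [set w | (eps <= S 0 w)%R]); first exact: G_ge.
  by apply/seteqP; split=> [w [k [/[!leqn0]/eqP->]]//|w h]; exists 0%N.
rewrite AS; apply: sigma_setU (sG _) _ (G_ge _ _).
exact: (gi_mono gi).
Qed.

(** Doob's argument: [exp (theta S)] is a submartingale, so after the level eps has
    been reached its mean can only grow. The induction splits off the paths that
    reach the level at the last step. *)
Let maximal_mgf eps n (theta : R) : (0 <= theta)%R ->
  (expR (theta * eps))%:E * P (A eps n) <= \int[P]_w (\1_(A eps n) w * expR (theta * S n w))%:E.
Proof.
move=> th0.
have mexp k : measurable_fun setT (fun w => expR (theta * S k w)).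
  by apply: (@mG k); exact: gmeas_expR.
have markov k B : G k B -> (forall w, B w -> eps <= S k w)%R ->
    (expR (theta * eps))%:E * P B <= \int[P]_w (\1_B w * expR (theta * S k w))%:E.
  move=> GB hB; have mB : measurable B by exact: GM GB.
  rewrite -(setIT B) -integral_indic// setIT -ge0_integralZl//; last first.
    by apply/measurable_EFinP; exact: measurable_indic.
  apply: ge0_le_integral; first exact: measurableT.
  - by move=> w _; rewrite -EFinM lee_fin mulr_ge0// expR_ge0.
  - apply/measurable_EFinP; apply: measurable_funM => //; exact: measurable_indic.
  - apply/measurable_EFinP; apply: measurable_funM => //; exact: measurable_indic.
  move=> w _; rewrite -EFinM lee_fin indicE.
  have [/set_mem Bw|_] := boolP (w \in B); last by rewrite mulr0 mul0r.
  by rewrite mulr1 mul1r ler_expR ler_wpM2l// hB.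
elim: n => [|n IH].
  by apply: markov => // w [k [/[!leqn0]/eqP->]].
pose B := A eps n.+1 `\` A eps n.
have GB : G n.+1 B.
  rewrite /B setDE; apply: sigma_setI (sG _) (G_A _ _) _.
  by apply: sigma_setC (sG _) _; exact: (gi_mono gi).
have mA k : measurable (A eps k) by exact: GM (G_A _ _).
have mB : measurable B by exact: GM GB.
have AnAB : A eps n.+1 = A eps n `|` B by rewrite /B setDUK// AS; exact: subsetUl.
have PAn : P (A eps n.+1) = P (A eps n) + P B.
  by rewrite AnAB measureU// /B setDIK.
rewrite PAn ge0_muleDr; [|exact: measure_ge0|exact: measure_ge0].
have -> : \int[P]_w (\1_(A eps n.+1) w * expR (theta * S n.+1 w))%:E =
    \int[P]_w (\1_(A eps n) w * expR (theta * S n.+1 w))%:E +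
    \int[P]_w (\1_B w * expR (theta * S n.+1 w))%:E.
  rewrite -ge0_integralD//.
  - apply: eq_integral => w _; rewrite -EFinD -mulrDl; congr (_ * _)%:E.
    rewrite AnAB !indicE in_setU /B in_setD.
    by case: (w \in A eps n) => /=; rewrite ?andbF ?andbT ?addr0 ?add0r.
  - by apply/measurable_EFinP; apply: measurable_funM => //; exact: measurable_indic.
  - by apply/measurable_EFinP; apply: measurable_funM => //; exact: measurable_indic.
apply: leeD; last first.
  apply: markov => // w [] [k [kn h]] nA; move: kn; rewrite leq_eqVlt => /predU1P[<-//|kn].
  by exfalso; apply: nA; exists k.
apply: (le_trans IH).
under [in leRHS]eq_integral do rewrite SS mulrDr expRD mulrA.
rewrite (@gi_mgf _ _ _ gi n theta (fun w => \1_(A eps n) w * expR (theta * S n w))%R).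
- rewrite -[leLHS]mule1 lee_wpmul2l//.
    by apply: integral_ge0 => w _; rewrite lee_fin mulr_ge0// expR_ge0.
  by rewrite lee_fin -expR0 ler_expR divr_ge0// mulr_ge0 ?sqr_ge0// (gi_var gi).
- apply: gmeasM (sG _) _ _; last exact: gmeas_expR.
  by apply: gmeas_indic (sG _) _.
- by move=> w; rewrite mulr_ge0// expR_ge0.
Qed.

Lemma measurable_maximal_event n (eps : R) :
  measurable [set w | exists k, (k <= n)%N /\ (eps <= \sum_(i < k) zeta i w)%R].
Proof. exact: GM (G_A eps n). Qed.

(** Markov's inequality for [exp (theta S)], with the optimal [theta = eps / x]. *)
Lemma maximal_one_sided n (eps x : R) : (0 < eps)%R -> (0 < x)%R -> (V n <= x)%R ->
  P [set w | exists k, (k <= n)%N /\ (eps <= S k w)%R] <= (expR (- (eps ^+ 2 / (2 * x))))%:E.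
Proof.
move=> e0 x0 Vx; pose theta := (eps / x)%R.
have th0 : (0 <= theta)%R by rewrite divr_ge0// ltW.
have mA : measurable (A eps n) by exact: GM (G_A _ _).
have h1 : (expR (theta * eps))%:E * P (A eps n) <= (expR (theta ^+ 2 * V n / 2))%:E.
  apply: (le_trans (maximal_mgf eps n th0)).
  apply: (@le_trans _ _ (\int[P]_w (1 * expR (theta * S n w))%:E)).
    apply: ge0_le_integral; first exact: measurableT.
    - by move=> w _; rewrite lee_fin mulr_ge0// expR_ge0.
    - apply/measurable_EFinP; apply: measurable_funM; first exact: measurable_indic.
      by apply: (@mG n); exact: gmeas_expR.
    - apply/measurable_EFinP; apply: measurable_funM => //.
      by apply: (@mG n); exact: gmeas_expR.
    - by move=> w _; rewrite lee_fin ler_wpM2r ?expR_ge0// indicE; case: (_ \in _).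
  rewrite (partial_sum_mgf n theta (Z := fun=> 1%R))//; last by apply: gmeas_cst; exact: sG.
  rewrite (_ : \int[P]_w 1%:E = 1); first by rewrite mul1e.
  by rewrite (integral_cst P (measurableT) 1) mul1e; exact: probability_setT.
have h2 : P (A eps n) <= (expR (- (theta * eps)))%:E * (expR (theta ^+ 2 * V n / 2))%:E.
  by rewrite expRN muleC lee_pdivlMr ?expR_gt0// muleC.
apply: (le_trans h2); rewrite -EFinM -expRD lee_fin ler_expR.
have -> : (- (theta * eps) + theta ^+ 2 * V n / 2 =
   - (eps ^+ 2 / (2 * x)) - (eps ^+ 2 / (2 * x ^+ 2)) * (x - V n))%R.
  by rewrite /theta; field; rewrite gt_eqF.
by rewrite gerBl mulr_ge0 ?subr_ge0// divr_ge0 ?sqr_ge0// mulr_ge0// sqr_ge0.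
Qed.

(** Paley-Zygmund for [Z = exp (theta S)], whose first two moments are [exp x] and
    [exp (4 x)] with [x = theta^2 V / 2]: where Z exceeds [exp (x - 2)], it is bounded
    by a multiple of Z^2 plus a constant, by the arithmetic-geometric mean
    inequality. The event B of the past only multiplies the moments by [P B]. *)
Lemma gaussian_lower_tail n (eps : R) B : (0 < eps)%R -> (0 < V n)%R -> G 0%N B ->
  (expR (- (8 + 32 * (eps ^+ 2 / V n))) / 2)%:E * P B <= P (B `&` [set w | (eps < S n w)%R]).
Proof.
move=> e0 V0 GB.
have mB : measurable B by exact: GM GB.
pose s := Num.sqrt (V n).
have s0 : (0 < s)%R by rewrite sqrtr_gt0.
have sV : (s ^+ 2 = V n)%R by rewrite sqr_sqrtr// ltW.
(* With this choice [Z > exp (x - 2)] forces [S n > eps], be eps small or large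
   compared with the standard deviation s. *)
pose theta := (2 / s + 4 * eps / V n)%R.
have th0 : (0 < theta)%R by rewrite addr_gt0// divr_gt0// mulr_gt0.
pose x := (theta ^+ 2 * V n / 2)%R.
pose Z w := expR (theta * S n w).
have gZ : gmeas (G n) Z by exact: gmeas_expR.
have mZ : measurable_fun setT Z by exact: mG gZ.
pose E := [set w | (expR (x - 2) < Z w)%R].
have mE : measurable E.
  have := gmeas_S n (measurable_itv `](x - 2) / theta, +oo[)%R => /(gi_meas gi).
  congr measurable; apply/seteqP; split=> w/=; rewrite in_itv/= andbT /E/= /Z ltr_expR.
    by rewrite ltr_pdivrMr// mulrC.
  by rewrite ltr_pdivrMr// mulrC.
have mBE : measurable (B `&` E) by exact: measurableI.
have gB : gmeas (G 0%N) (\1_B : T -> R) by apply: gmeas_indic (sG _) _.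
have intB : \int[P]_w (\1_B w)%:E = P B by rewrite integral_indic// setIT.
have m1 : \int[P]_w (\1_B w * Z w)%:E = P B * (expR x)%:E.
  by rewrite partial_sum_mgf// intB.
have m2 : \int[P]_w (\1_B w * Z w ^+ 2)%:E = P B * (expR (4 * x))%:E.
  under eq_integral do rewrite /Z expr2 -expRD -mulrDl.
  rewrite partial_sum_mgf// intB; congr (_ * (expR _)%:E).
  by rewrite /x; field.
pose p := fine (P B); pose q := fine (P (B `&` E)).
have pE : P B = p%:E by rewrite fineK// fin_num_measure.
have qE : P (B `&` E) = q%:E by rewrite fineK// fin_num_measure.
have p0 : (0 <= p)%R by rewrite fine_ge0.
pose rhs w := (\1_B w * expR (x - 2) + (\1_B w * Z w ^+ 2 * (expR (- (3 * x)) / 2) +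
     \1_(B `&` E) w * (expR (3 * x) / 2)))%R.
have m1B : measurable_fun setT (\1_B : T -> R) by exact: measurable_indic.
have m1BE : measurable_fun setT (\1_(B `&` E) : T -> R) by exact: measurable_indic.
have mBZ : measurable_fun setT (fun w => \1_B w * Z w)%R by exact: measurable_funM.
have mBZ2 : measurable_fun setT (fun w => \1_B w * Z w ^+ 2)%R.
  by apply: measurable_funM => //; exact: measurable_funX.
have mscale (f : T -> R) c : measurable_fun setT f -> measurable_fun setT (fun w => f w * c)%R.
  by move=> mf; exact: measurable_funM.
have h0 (y : R) : (0 <= expR y / 2)%R by rewrite divr_ge0// expR_ge0.
have B0 w : (0 <= \1_B w :> R)%R by [].
have Z20 w : (0 <= Z w ^+ 2)%R by rewrite sqr_ge0.
have int_rhs : \int[P]_w (rhs w)%:E = (p * expR (x - 2) +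
    (p * expR (4 * x) * (expR (- (3 * x)) / 2) + q * (expR (3 * x) / 2)))%:E.
  apply: ge0_integral_add.
  - exact: mscale.
  - by move=> w; rewrite mulr_ge0// expR_ge0.
  - by apply: measurable_funD; exact: mscale.
  - by move=> w; rewrite addr_ge0// mulr_ge0// mulr_ge0.
  - by apply: ge0_integral_scale; rewrite ?expR_ge0// intB pE.
  apply: ge0_integral_add.
  - exact: mscale.
  - by move=> w; rewrite mulr_ge0// mulr_ge0.
  - exact: mscale.
  - by move=> w; rewrite mulr_ge0.
  - by apply: ge0_integral_scale => //; [move=> w; rewrite mulr_ge0|rewrite m2 pE].
  - apply: ge0_integral_scale => //; rewrite integral_indic// setIT; exact: qE.
have key : (p * expR x <= p * expR (x - 2) + (p * expR (4 * x) * (expR (- (3 * x)) / 2) +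
     q * (expR (3 * x) / 2)))%R.
  rewrite -lee_fin -int_rhs EFinM -pE -m1; apply: ge0_le_integral; first exact: measurableT.
  - by move=> w _; rewrite lee_fin mulr_ge0// expR_ge0.
  - exact/measurable_EFinP.
  - apply/measurable_EFinP; apply: measurable_funD; first exact: mscale.
    by apply: measurable_funD; exact: mscale.
  move=> w _; rewrite lee_fin /rhs !indicE in_setI.
  case: (w \in B) => /=; last by rewrite !mul0r !addr0.
  rewrite !mul1r; have [wE|] := boolP (w \in E); last first.
    rewrite mul0r addr0 notin_setE /E/= => /negP; rewrite -leNgt => h.
    by rewrite (le_trans h)// lerDl mulr_ge0.
  have amgm : (Z w <= Z w ^+ 2 * (expR (- (3 * x)) / 2) + expR (3 * x) / 2)%R.
    have := sqr_ge0 (Z w - expR (3 * x))%R; rewrite expRN.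
    set u := expR (3 * x); have u0 : (0 < u)%R by exact: expR_gt0.
    move=> h; have -> : (Z w ^+ 2 * (u^-1 / 2) + u / 2 = Z w + (Z w - u) ^+ 2 / (2 * u))%R.
      by field; rewrite gt_eqF.
    by rewrite lerDl divr_ge0// mulr_ge0// ltW.
  by rewrite mul1r (le_trans amgm)// lerDr expR_ge0.
have e2 : (4 * expR (x - 2) <= expR x)%R.
  have e1 : (2 <= expR 1 :> R)%R by have := expR_ge1Dx (1 : R); rewrite -[X in (_ <= X)%R -> _]addr0; lra.
  have -> : expR x = (expR (x - 2) * (expR 1 * expR 1))%R by rewrite -!expRD; congr expR; ring.
  have -> : (4 * expR (x - 2) = expR (x - 2) * (2 * 2))%R by ring.
  rewrite ler_pM2l ?expR_gt0//.
  by apply: ler_pM.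
have pq : (expR (- (2 * x)) / 2 * p <= q)%R.
  have e3 : expR (3 * x) = (expR x * expR (2 * x))%R by rewrite -expRD; congr expR; ring.
  have e4 : expR (4 * x) = (expR x * expR (3 * x))%R by rewrite -expRD; congr expR; ring.
  move: key; rewrite expRN e4.
  set u := expR (3 * x); set a := expR x; set a2 := expR (x - 2).
  have u0 : (0 < u)%R by exact: expR_gt0.
  have -> : (p * (a * u) * (u^-1 / 2) = p * a / 2)%R by field; rewrite gt_eqF.
  have a0 : (0 < a)%R by exact: expR_gt0.
  have c0 : (0 < expR (2 * x))%R by exact: expR_gt0.
  rewrite expRN; set c := expR (2 * x) in c0 *.
  have -> : u = (a * c)%R by rewrite /u e3.
  move=> key; rewrite -mulrA ler_pdivrMl// [X in (X <= _)%R]mulrC.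
  have h1 : (p * a2 <= p * a / 4)%R.
    by rewrite -mulrA ler_wpM2l// ler_pdivlMr// mulrC; exact: e2.
  have : (a * (p / 2) <= a * (c * q))%R.
    have -> : (a * (c * q) = 2 * (q * (a * c / 2)))%R by field.
    have -> : (a * (p / 2) = p * a / 2)%R by ring.
    have := key; lra.
  by rewrite ler_pM2l.
have x2 : (2 * x <= 8 + 32 * (eps ^+ 2 / V n))%R.
  rewrite /x /theta -sV.
  have -> : (8 + 32 * (eps ^+ 2 / s ^+ 2) =
     2 * ((2 / s + 4 * eps / s ^+ 2) ^+ 2 * s ^+ 2 / 2) + (2 - 4 * eps / s) ^+ 2)%R.
    by field; rewrite gt_eqF.
  by rewrite lerDl sqr_ge0.
apply: (@le_trans _ _ (P (B `&` E))); last first.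
  apply: le_measure; rewrite ?inE//.
    apply: measurableI => //; have := gmeas_S n (measurable_itv `]eps, +oo[)%R => /GM.
    by congr measurable; apply/seteqP; split=> w/=; rewrite in_itv/= andbT.
  apply: setIS => w; rewrite /E/= /Z ltr_expR => h.
  have h2 : (theta * eps < x - 2)%R.
    rewrite /x /theta -sV.
    have -> : ((2 / s + 4 * eps / s ^+ 2) ^+ 2 * s ^+ 2 / 2 - 2 =
       (2 / s + 4 * eps / s ^+ 2) * eps + (6 * eps / s + 4 * (eps / s) ^+ 2))%R.
      by field; rewrite gt_eqF.
    rewrite ltrDl; apply: addr_gt0; first by apply: divr_gt0 => //; exact: mulr_gt0.
    by apply: mulr_gt0 => //; rewrite exprn_gt0// divr_gt0.
  by rewrite -(ltr_pM2l th0) (lt_trans h2).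
rewrite pE qE -EFinM lee_fin (le_trans _ pq)// ler_wpM2r// ler_wpM2r//.
by rewrite ler_expR lerN2.
Qed.

End OneSequence.

Lemma two_sided_maximal_eventE (zeta : nat -> T -> R) n (eps : R) :
  [set w | exists k, (k <= n)%N /\ (eps <= `|\sum_(i < k) zeta i w|)%R] =
  [set w | exists k, (k <= n)%N /\ (eps <= \sum_(i < k) zeta i w)%R] `|`
  [set w | exists k, (k <= n)%N /\ (eps <= \sum_(i < k) - zeta i w)%R].
Proof.
apply/seteqP; split=> [w [k [kn]]|w [[k [kn h]]|[k [kn h]]]].
- by rewrite ler_normr => /orP[h|h]; [left|right]; exists k; rewrite ?sumrN.
- by exists k; rewrite ler_normr h.
- by exists k; rewrite ler_normr -sumrN h orbT.
Qed.

Lemma maximal_two_sided G zeta v n (eps x : R) : gaussian_increments G zeta v ->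
  (0 < eps)%R -> (0 < x)%R -> (\sum_(i < n) v i <= x)%R ->
  measurable [set w | exists k, (k <= n)%N /\ (eps <= `|\sum_(i < k) zeta i w|)%R] /\
  P [set w | exists k, (k <= n)%N /\ (eps <= `|\sum_(i < k) zeta i w|)%R] <=
    (2 * expR (- (eps ^+ 2 / (2 * x))))%:E.
Proof.
move=> gi e0 x0 Vx; rewrite two_sided_maximal_eventE.
have m1 := measurable_maximal_event gi n eps.
have m2 := measurable_maximal_event (gaussian_incrementsN gi) n eps.
split; first exact: measurableU.
rewrite (le_trans (measureU2 P m1 m2))// mulr_natl mulr2n EFinD.
apply: leeD; first exact: (maximal_one_sided gi).
exact: (maximal_one_sided (gaussian_incrementsN gi)).
Qed.

End GaussianIncrements.

(** * Increments of Brownian motion *)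

Section GaussianVectors.
Context {dT : measure_display} {T : measurableType dT} {R : realType}.
Variable P : probability T R.
Local Open Scope ereal_scope.

Lemma gmeas_sigma_gen n (Y : T -> 'cV[R]_n) i : gmeas (sigma_gen Y) (fun w => Y w i 0%R).
Proof.
move=> U mU; rewrite /sigma_gen /g_sigma_preimage.
apply: sub_sigma_algebra; rewrite (bigD1 i)//=; left.
by exists U => //; rewrite setTI.
Qed.

Lemma sigma_gen_sub n (Y : T -> 'cV[R]_n) G : sigma_algebra setT G ->
  (forall i, gmeas G (fun w => Y w i 0%R)) -> sigma_gen Y `<=` G.
Proof.
move=> sG hY; apply: smallest_sub => //.
elim/big_ind : _ => //= [A B hA hB C [/hA//|/hB//]|i _ _ [U mU <-]].
by rewrite setTI; exact: hY.
Qed.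

(** The law is given on products of indicators; [integral_weighted_law] turns them
    into exponentials, one coordinate at a time. *)
Lemma centered_gaussian_mgf n (v : R) (Y : T -> 'cV[R]_n) (a : 'I_n -> R) : (0 < v)%R ->
  (forall i, measurable_fun setT (fun w => Y w i 0%R)) -> centered_gaussian P v Y ->
  \int[P]_w (expR (\sum_i a i * Y w i 0)%R)%:E = (expR ((\sum_i a i ^+ 2) * v / 2)%R)%:E.
Proof.
move=> v0 mY gY.
pose N : set (measurableTypeR R) -> \bar R := normal_prob 0 (Num.sqrt v).
(* The first j coordinates carry exponentials, the others indicators. *)
pose f (j : nat) (U : 'I_n -> set (measurableTypeR R)) (i : 'I_n) (w : T) : R :=
  if (i < j)%N then expR (a i * Y w i 0%R) else \1_(U i) (Y w i 0%R).
pose c (j : nat) (U : 'I_n -> set (measurableTypeR R)) (i : 'I_n) : R :=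
  if (i < j)%N then expR (a i ^+ 2 * v / 2) else fine (N (U i)).
have mf j U i : (forall i, measurable (U i)) -> measurable_fun setT (f j U i).
  move=> mU; rewrite /f; case: (i < j)%N.
    by apply: measurableT_comp => //; exact: measurable_funM.
  exact: (measurableT_comp (measurable_indic (mU i)) (mY i)).
have f0 j U i w : (0 <= f j U i w)%R by rewrite /f; case: ifP => // _; exact: expR_ge0.
have main j : (j <= n)%N -> forall U, (forall i, measurable (U i)) ->
    \int[P]_w (\prod_(i < n) f j U i w)%:E = (\prod_(i < n) c j U i)%:E.
  elim: j => [_ U mU|j IH jn U mU].
    rewrite -(gY U mU) -[X in P X]setIT -integral_indic//; last first.
      rewrite (_ : [set w | _] = \bigcap_(i in [set: 'I_n]) ((fun w => Y w i 0%R) @^-1` U i)).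
        apply: fin_bigcap_measurable => // i _.
        by rewrite -[X in measurable X]setTI; apply: mY => //; exact: mU.
      by apply/seteqP; split=> [w h i _|w h i]; [exact: h|exact: h].
    apply: eq_integral => w _; congr EFin; rewrite /f indicE.
    have [/set_mem h|/negP h] := boolP (w \in _).
      by rewrite big1// => i _; rewrite indicE mem_set//; exact: h.
    have [i hi] : exists i, ~ U i (Y w i 0%R).
      by apply: contrapT => /forallNP k; apply: h; apply/mem_set => i; apply: contrapT; exact: k.
    by rewrite (bigD1 i)//= indicE memNset// mul0r.
  pose i0 := Ordinal jn.
  pose Z w := (\prod_(i < n | i != i0) f j U i w)%R.
  pose k := (\prod_(i < n | i != i0) c j U i)%R.
  have lt_neq (i : 'I_n) : i != i0 -> (i < j.+1)%N = (i < j)%N.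
    by move=> ii0; rewrite ltnS leq_eqVlt (negbTE (_ : i != j :> nat)).
  have law (W : set (measurableTypeR R)) : measurable W ->
      \int[P]_w (Z w * \1_W (Y w i0 0%R))%:E = k%:E * N W.
    move=> mW; pose U' (i : 'I_n) := if i == i0 then W else U i.
    have mU' i : measurable (U' i) by rewrite /U'; case: ifP.
    have := IH (ltnW jn) U' mU'; rewrite (bigD1 i0)//= {1}/c /= ltnn /U' eqxx => h.
    have NW : N W \is a fin_num.
      by rewrite /N; apply: (fin_num_measure (normal_prob 0 (Num.sqrt v))).
    rewrite -(fineK NW) muleC -EFinM.
    rewrite (_ : k = \prod_(i < n | i != i0) c j U' i)%R; last first.
      by apply: eq_bigr => i ii0; rewrite /c /U' (negbTE ii0).
    rewrite -h; apply: eq_integral => w _; congr EFin.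
    rewrite (bigD1 i0)//= {1}/f /= ltnn eqxx mulrC; congr (_ * _)%R.
    by apply: eq_bigr => i ii0; rewrite /f /U' (negbTE ii0).
  have mZ : measurable_fun setT Z.
    rewrite /Z; under eq_fun do rewrite -big_filter.
    by apply: measurable_prod => i _; exact: mf.
  have Z0 w : (0 <= Z w)%R by apply: prodr_ge0 => i _.
  have mexp : measurable_fun setT (fun x : measurableTypeR R => expR (a i0 * x)%R).
    by apply: measurableT_comp => //; exact: measurable_funM.
  have := integral_weighted_law mZ Z0 (mY i0) law mexp (fun x => expR_ge0 _).
  rewrite normal_mgf// => h.
  rewrite (bigD1 i0)//= {1}/c /= ltnSn mulrC.
  rewrite (_ : (\prod_(i < n | i != i0) c j.+1 U i)%R = k); last first.
    by apply: eq_bigr => i ii0; rewrite /c lt_neq.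
  rewrite EFinM -h; apply: eq_integral => w _; congr EFin.
  rewrite (bigD1 i0)//= {1}/f /= ltnSn mulrC; congr (_ * _)%R.
  by apply: eq_bigr => i ii0; rewrite /f lt_neq.
have := main n (leqnn n) (fun=> setT) (fun=> measurableT).
rewrite /c (eq_bigr (fun i => expR (a i ^+ 2 * v / 2)%R)); last by move=> i _; rewrite ltn_ord.
rewrite -expR_sum => h.
rewrite (_ : (\sum_i a i ^+ 2) * v / 2 = \sum_(i < n) a i ^+ 2 * v / 2)%R; last first.
  by rewrite !big_distrl.
rewrite -h; apply: eq_integral => w _; congr EFin; rewrite expR_sum.
by apply: eq_bigr => i _; rewrite /f ltn_ord.
Qed.

End GaussianVectors.

Section BrownianIncrements.
Context {dT : measure_display} {T : measurableType dT} {R : realType}.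
Variables (P : probability T R) (r : nat).
Variables (F : R -> set (set T)) (B : R -> T -> 'cV[R]_r).
Hypotheses (hF : is_filtration F) (hB : brownian_motion P F B).

Lemma adapted_gmeas n (Y : R -> T -> 'cV[R]_n) (t : R) i : adapted F Y -> 0 <= t ->
  gmeas (F t) (fun w => Y t w i 0).
Proof. by move=> aY t0; apply: gmeasS (gmeas_sigma_gen i); exact: aY. Qed.

Lemma adapted_measurable n (Y : R -> T -> 'cV[R]_n) (t : R) i : adapted F Y -> 0 <= t ->
  measurable_fun setT (fun w => Y t w i 0).
Proof.
move=> aY t0; have [_ h _] := hF.
exact: gmeas_measurable (h t t0) (adapted_gmeas i aY t0).
Qed.

(** A linear form in an increment of B is independent of the past, and its moment
    generating function is that of [centered_gaussian_mgf]. *)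
Lemma brownian_gaussian_increments (delta : R) (c : nat -> 'I_r -> R) : 0 < delta ->
  gaussian_increments P (fun i => F (i%:R * delta))
    (fun i w => \sum_j c i j * (B (i.+1%:R * delta) w - B (i%:R * delta) w) j 0)
    (fun i => (\sum_j c i j ^+ 2) * delta).
Proof.
move=> d0; have [sF mF ndF] := hF; have [aB cB B0 gB iB] := hB.
have t0 (i : nat) : 0 <= i%:R * delta by rewrite mulr_ge0// ltW.
have ltS (i : nat) : i%:R * delta < i.+1%:R * delta by rewrite ltr_pM2r// ltr_nat.
have dS (i : nat) : i.+1%:R * delta - i%:R * delta = delta.
  by rewrite -mulrBl -natr1 addrAC subrr add0r mul1r.
have gincr i j : gmeas (F (i.+1%:R * delta))
    (fun w => (B (i.+1%:R * delta) w - B (i%:R * delta) w) j 0).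
  rewrite (_ : (fun w => _) = (fun w => B (i.+1%:R * delta) w j 0 + (- 1) * B (i%:R * delta) w j 0)); last first.
    by apply/funext => w; rewrite !mxE mulN1r.
  apply: gmeasD (sF _ (t0 _)) (adapted_gmeas j aB (t0 _)) _.
  apply: (gmeas_comp (g := fun x => -1 * x)); last exact: measurable_funM.
  apply: gmeasS (adapted_gmeas j aB (t0 i)); apply: ndF => //; exact: ltW.
split.
- by move=> i; exact: sF.
- by move=> i; exact: mF.
- by move=> i; apply: ndF => //; exact: ltW.
- move=> i; apply: gmeas_sum => [|j]; first exact: sF.
  by apply: (gmeas_comp (g := fun x => c i j * x)) => //; exact: measurable_funM.
- by move=> i; rewrite mulr_ge0 ?(ltW d0)// sumr_ge0 // => j _; rewrite sqr_ge0.
move=> i theta Z gZ Z0.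
pose Y w := B (i.+1%:R * delta) w - B (i%:R * delta) w.
have sY : sigma_gen Y `<=` F (i.+1%:R * delta).
  by apply: sigma_gen_sub => [|j]; [exact: sF|exact: gincr].
have ssY : sigma_algebra setT (sigma_gen Y) by exact: smallest_sigma_algebra.
apply: (integral_indep (mF _ (t0 i)) (subset_trans sY (mF _ (t0 _))) (iB _ _ (t0 i) (ltS i)) gZ) => //.
- apply: gmeas_expR; apply: gmeas_sum => // j.
  apply: (gmeas_comp (g := fun x => c i j * x)); last exact: measurable_funM.
  exact: gmeas_sigma_gen.
- under eq_integral do rewrite big_distrr/=.
  under eq_integral => w _ do under eq_bigr do rewrite mulrA.
  rewrite (@centered_gaussian_mgf _ _ _ P r delta Y (fun j => theta * c i j))//.
  + congr (expR _)%:E; under eq_bigr do rewrite exprMn.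
    by rewrite -big_distrr/= mulrA.
  + by move=> j; exact: gmeas_measurable (mF _ (t0 _)) (gincr i j).
  + by rewrite -(dS i); exact: gB.
Qed.

End BrownianIncrements.

(** * Dyadic grids and step functions *)

Section DyadicGrids.
Context {R : realType}.
Local Notation mu := (@lebesgue_measure R).

(** Dyadic meshes make the grids nested, with the ends of the windows among the
    nodes of all of them. *)
Definition mesh (h : R) (k : nat) : R := h / 2 ^+ k.

Lemma mesh_gt0 h k : 0 < h -> 0 < mesh h k.
Proof. by move=> h0; rewrite divr_gt0// exprn_gt0. Qed.

Lemma mesh_refine h l j (p : nat) : p%:R * mesh h l = (p * 2 ^ j)%:R * mesh h (l + j).
Proof.
rewrite /mesh exprD natrM natrX; field.
by rewrite !expf_neq0.
Qed.

Lemma mesh_block h k (n : nat) : (n * 2 ^ k)%:R * mesh h k = n%:R * h.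
Proof. by rewrite /mesh natrM natrX; field; rewrite expf_neq0. Qed.

Lemma mesh_small h (e : R) : 0 < e -> \forall k \near \oo, mesh h k <= e.
Proof.
move=> e0; near=> k.
rewrite /mesh ler_pdivrMr ?exprn_gt0//.
apply: (@le_trans _ _ (e * k%:R)).
  rewrite -ler_pdivrMl// mulrC (le_trans (ltW (truncnS_gt (h / e))))// ler_nat.
  by near: k; exact: nbhs_infty_ge.
by rewrite ler_pM2l// -natrX ler_nat ltnW// ltn_expl.
Unshelve. all: by end_near. Qed.

(** Uniform continuity on a segment, by compactness; the second point may lie
    outside of the segment. *)
Lemma uniform_dyadic (f : R -> R) (a b h e : R) : continuous f -> 0 < e ->
  \forall k \near \oo, forall s, a <= s -> s <= b ->
    forall u, `|u - s| <= mesh h k -> `|f u - f s| <= e.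
Proof.
move=> cf e0.
have /compact_near_coveringP K := @segment_compact R a b.
suff hx : forall x, `[a, b]%classic x -> \forall x' \near x & k \near \oo,
    forall u, `|u - x'| <= mesh h k -> `|f u - f x'| <= e.
  have [N _ hN] := K nat \oo (fun k s => forall u, `|u - s| <= mesh h k -> `|f u - f s| <= e)
    eventually_filter hx.
  by exists N => // k Nk s sa sb; apply: (hN k Nk); rewrite /= in_itv/= sa sb.
move=> x _.
have e20 : 0 < e / 2 by rewrite divr_gt0.
have /cvgrPdist_le/(_ _ e20)/nbhs_ballP[rho /= rho0 hrho] := cf x.
have rho20 : 0 < rho / 2 by rewrite divr_gt0.
exists (ball x (rho / 2), [set k | mesh h k < rho / 2]).
  split; first exact: nbhsx_ballx.
  have rho40 : 0 < rho / 4 by rewrite divr_gt0.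
  by have := mesh_small h rho40; apply: filterS => k /= hk; lra.
move=> [s k]/= [bs hk] u us.
rewrite /ball/= in bs.
have hs := hrho s; have hu := hrho u.
rewrite /ball/= in hs hu.
have h1 : `|f x - f s| <= e / 2 by apply: hs; lra.
have h2 : `|f x - f u| <= e / 2.
  apply: hu; have := ler_normD (x - s) (s - u).
  by move: us; rewrite (distrC u) addrA subrK => us; lra.
have := ler_normB (f x - f s) (f x - f u).
have -> : f x - f s - (f x - f u) = f u - f s by ring.
lra.
Qed.

Lemma grid_point_approx (f : R -> R) (h t e : R) : 0 < h -> 0 < e -> 0 <= t ->
  {within `[0, +oo[, continuous f} ->
  exists l p : nat, [/\ p%:R * mesh h l <= t, t < p.+1%:R * mesh h l &
    `|f t - f (p%:R * mesh h l)| <= e].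
Proof.
move=> h0 e0 t0 cf.
have cf0 := continuous_within_max0 cf.
have [l hl] : exists l, forall s, 0 <= s -> s <= t -> forall u, `|u - s| <= mesh h l ->
    `|f (Num.max u 0) - f (Num.max s 0)| <= e.
  have [N _ hN] := uniform_dyadic 0 t h cf0 e0.
  by exists N; apply: (hN N) => /=.
have m0 := mesh_gt0 l h0.
have tm0 : 0 <= t / mesh h l by rewrite divr_ge0// ltW.
have /andP[p1 p2] := truncn_itv tm0; set p := Num.truncn _ in p1 p2.
exists l, p; have {}p1 : p%:R * mesh h l <= t by rewrite -ler_pdivlMr.
have {}p2 : t < p.+1%:R * mesh h l by rewrite -ltr_pdivrMr.
have pp0 : 0 <= p%:R * mesh h l by rewrite mulr_ge0// ltW.
split=> //; rewrite distrC.
have := hl t t0 (lexx _) (p%:R * mesh h l); rewrite !max_l//; apply.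
rewrite distrC ger0_norm ?subr_ge0//.
by move: p2; rewrite -natr1 mulrDl mul1r => p2; lra.
Qed.

Lemma cvge0_le (u : nat -> \bar R) : (forall k, (0 <= u k)%E) ->
  (forall e : R, 0 < e -> \forall k \near \oo, (u k <= e%:E)%E) -> u k @[k --> \oo] --> 0%E.
Proof.
move=> u0 hu; apply/fine_cvgP; split.
  have := hu 1 ltr01; apply: filterS => k uk.
  by rewrite ge0_fin_numE// (le_lt_trans uk)// ltry.
apply/cvgrPdist_le => e e0; have := hu e e0; apply: filterS => k uk.
rewrite sub0r normrN ger0_norm ?fine_ge0//.
have fk : u k \is a fin_num by rewrite ge0_fin_numE// (le_lt_trans uk)// ltry.
by rewrite -lee_fin fineK.
Qed.

Variables (d r : nat) (sigma : R -> 'M[R]_(d, r)).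
Hypothesis hsigma : {within `[0, +oo[, continuous sigma}.
Variable h : R.
Hypothesis h0 : 0 < h.

Lemma sigma_uniform (b e : R) : 0 < e -> \forall k \near \oo, forall s u, 0 <= s -> s <= b ->
  0 <= u -> `|u - s| <= mesh h k -> frobenius_norm (sigma u - sigma s) ^+ 2 <= e.
Proof.
move=> e0.
(* As [e1 <= 1], entries that differ by at most e1 have [d r] squared differences of
   sum at most e. *)
pose e1 := Num.min 1 (e / (d * r).+1%:R).
have e10 : 0 < e1 by rewrite lt_min ltr01/= divr_gt0.
have : \forall k \near \oo, forall ij : 'I_d * 'I_r, forall s, 0 <= s -> s <= b ->
    forall u, `|u - s| <= mesh h k ->
    `|sigma (Num.max u 0) ij.1 ij.2 - sigma (Num.max s 0) ij.1 ij.2| <= e1.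
  apply: filter_forall => -[i j]/=.
  apply: (uniform_dyadic 0 b h (f := fun t => sigma (Num.max t 0) i j)) => //.
  exact: (continuous_within_max0 (within_continuous_coord (i:=i) (j:=j) hsigma)).
apply: filterS => k Hk s u s0 sb u0 us; rewrite frobenius_sq.
apply: (@le_trans _ _ (\sum_(i < d) \sum_(j < r) e1)).
  apply: ler_sum => i _; apply: ler_sum => j _.
  have := Hk (i, j) s s0 sb u us; rewrite !max_l//= !mxE => hij.
  rewrite -real_normK ?num_real//.
  have e11 : e1 <= 1 by rewrite ge_min lexx.
  apply: (@le_trans _ _ (e1 ^+ 2)); first by rewrite lerXn2r// nnegrE// ltW.
  by rewrite expr2 ger_pMl.
rewrite !sumr_const !card_ord -mulrnA -mulr_natl mulnC.
apply: (@le_trans _ _ ((d * r)%:R * (e / (d * r).+1%:R))).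
  by rewrite ler_wpM2l// ge_min lexx orbT.
rewrite mulrCA ger_pMr// ler_pdivrMr// mul1r ler_nat.
exact: leqnSn.
Qed.

Definition grid_step (k n : nat) : stepfun d r :=
  StepFun n (fun i => i%:R * mesh h k) (fun i => sigma (i%:R * mesh h k)).

Lemma grid_step_on k n : stepfun_on (n%:R * mesh h k) (grid_step k n).
Proof.
split=> //=; first by rewrite mul0r.
by move=> i _; rewrite ler_wpM2r ?ler_nat// ltW// mesh_gt0.
Qed.

Lemma grid_step_eval k n (i : nat) s : (i < n)%N -> i%:R * mesh h k < s -> s <= i.+1%:R * mesh h k ->
  step_eval (grid_step k n) s = sigma (i%:R * mesh h k).
Proof.
move=> lin si1 si2; have m0 := mesh_gt0 k h0.
rewrite /step_eval/= (bigD1 (Ordinal lin))//= big1 => [|i' ii'].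
  by rewrite addr0 indicE mem_set ?scale1r//= in_itv/= si1 si2.
rewrite indicE memNset ?scale0r//= in_itv/= => /andP[s1 s2].
move/eqP: ii'; apply; apply/val_inj => /=.
have h1 : (i < i'.+1)%N by have := lt_le_trans si1 s2; rewrite ltr_pM2r// ltr_nat.
have h2 : (i' < i.+1)%N by have := lt_le_trans s1 si2; rewrite ltr_pM2r// ltr_nat.
by apply/eqP; rewrite eqn_leq -ltnS h2 -ltnS h1.
Qed.

Lemma grid_cell k n s : 0 < s -> s <= n%:R * mesh h k ->
  exists2 i, (i < n)%N & i%:R * mesh h k < s /\ s <= i.+1%:R * mesh h k.
Proof.
move=> s0 sn; have exm : exists m : nat, s <= m%:R * mesh h k by exists n.
case: (ex_minnP exm) => -[|m] sm minm; first by move: sm; rewrite mul0r leNgt s0.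
exists m; first by exact: minm.
by split=> //; rewrite ltNge; apply/negP => /minm; rewrite ltnn.
Qed.

(** On each cell the step function takes the value of sigma at the left end, so the
    integrand is uniformly small; the point 0 lies in no cell but is negligible. *)
Lemma grid_step_cvg l p :
  (\int[mu]_(s in `[0%R, (p%:R * mesh h l)%R])
     (frobenius_norm (step_eval (grid_step (l + j) (p * 2 ^ j)) s - sigma s) ^+ 2)%:E)%E
    @[j --> \oo] --> 0%E.
Proof.
set t := p%:R * mesh h l; have t0 : 0 <= t by rewrite mulr_ge0// ltW// mesh_gt0.
apply: cvge0_le => [j|e e0].
  by apply: integral_ge0 => s _; rewrite lee_fin sqr_ge0.
have t10 : 0 < t + 1 by rewrite ltr_wpDl.
have et0 : 0 < e / (t + 1) by rewrite divr_gt0.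
have [N _ hN] := sigma_uniform t et0.
exists N => // j /= Nj; set n := (p * 2 ^ j)%N; set k := (l + j)%N.
have tE : t = n%:R * mesh h k by rewrite /t (mesh_refine h l j).
have m0 := mesh_gt0 k h0.
pose g s := frobenius_norm (step_eval (grid_step k n) s - sigma s) ^+ 2.
have mg : measurable_fun `]0%R, t] g.
  apply: (@eq_measurable_fun _ _ _ _ _ (fun s => \sum_i \sum_j
      (step_eval (grid_step k n) s i j - sigma (Num.max s 0) i j) ^+ 2)).
    move=> s; rewrite inE/= in_itv/= => /andP[s0 _]; rewrite /g frobenius_sq.
    by rewrite max_l ?ltW//; apply: eq_bigr => i _; apply: eq_bigr => j' _; rewrite !mxE.
  apply: measurable_sum => i; apply: measurable_sum => j'.
  apply: measurable_funX; apply: measurable_funB.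
    rewrite (_ : (fun s => _) = fun s => \sum_(i' < n)
       (\1_(`]i'%:R * mesh h k, i'.+1%:R * mesh h k]%classic) s * sigma (i'%:R * mesh h k) i j')); last first.
      by apply/funext => s; rewrite /step_eval summxE; apply: eq_bigr => i' _; rewrite mxE.
    apply: measurable_sum => i'; apply: measurable_funM => //.
  apply: measurable_funTS; apply: continuous_measurable_fun.
  exact: (continuous_within_max0 (within_continuous_coord (i:=i) (j:=j') hsigma)).
have mEg : measurable_fun `]0%R, t] (fun s => (g s)%:E) by exact/measurable_EFinP.
rewrite -/g -(integral_itv_obnd_cbnd mEg).
apply: (@le_trans _ _ (\int[mu]_(s in `]0%R, t]) cst (e / (t + 1))%:E s)%E).
  apply: ge0_le_integral.
  - exact: measurable_itv.
  - by move=> s _; rewrite lee_fin sqr_ge0.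
  - exact: mEg.
  - exact: measurable_cst.
  move=> s; rewrite /= in_itv/= => /andP[s0 st]; rewrite lee_fin /g.
  have st' : s <= n%:R * mesh h k by rewrite -tE.
  have [i lin [si1 si2]] := grid_cell s0 st'.
  rewrite (grid_step_eval lin si1 si2).
  apply: (hN k); rewrite /= ?(leq_trans Nj) ?leq_addl//; first exact: ltW.
    by rewrite mulr_ge0// ltW.
  rewrite distrC ger0_norm ?subr_ge0; last exact: ltW.
  by move: si2; rewrite -natr1 mulrDl mul1r lerBlDl.
have mt : (mu `]0%R, t] <= t%:E)%E.
  rewrite lebesgue_measure_itv/= lte_fin; case: ifP => _; last by rewrite lee_fin.
  by rewrite -EFinB subr0.
rewrite integral_cst; last exact: measurable_itv.
apply: (@le_trans _ _ ((e / (t + 1))%:E * t%:E)%E).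
  by apply: lee_wpmul2l mt; rewrite lee_fin ltW.
rewrite -EFinM lee_fin mulrAC ler_pdivrMr// ler_wpM2l ?(ltW e0)//.
by rewrite lerDl.
Qed.

End DyadicGrids.

(** * Riemann sums and countable events *)

Section RiemannSums.
Context {R : realType}.
Variables (d r : nat) (sigma : R -> 'M[R]_(d, r)).
Hypothesis hsigma : {within `[0, +oo[, continuous sigma}.
Variable h : R.
Hypothesis h0 : 0 < h.

Definition grid_energy (k n : nat) : R :=
  \sum_(i < 2 ^ k) frobenius_norm (sigma ((n * 2 ^ k + i)%:R * mesh h k)) ^+ 2 * mesh h k.

(** A Riemann sum: on each cell, the increment of the primitive is compared with the
    derivative at the left end. *)
Lemma grid_energy_cvg n (e : R) : 0 < e -> \forall k \near \oo,
  `|grid_energy k n - energy sigma (n%:R * h) (n.+1%:R * h)| <= e.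
Proof.
move=> e0; have [Phi [dPhi hPhi]] := energy_primitive hsigma.
have eh0 : 0 < e / h by rewrite divr_gt0.
have [N _ hN] := uniform_dyadic 0 (n.+1%:R * h) h (continuous_frobenius_max0 hsigma) eh0.
exists N => // k Nk; have m0 := mesh_gt0 k h0.
pose t (i : nat) := (n * 2 ^ k + i)%:R * mesh h k.
have t0 i : 0 <= t i by rewrite mulr_ge0// ltW.
have tS i : t i.+1 = t i + mesh h k.
  by rewrite /t addnS -natr1 mulrDl mul1r.
have tn : t 0%N = n%:R * h by rewrite /t addn0 mesh_block.
have tN : t (2 ^ k)%N = n.+1%:R * h by rewrite /t addnC -mulSn mesh_block.
have -> : energy sigma (n%:R * h) (n.+1%:R * h) =
    \sum_(i < 2 ^ k) (Phi (t i.+1) - Phi (t i)).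
  rewrite hPhi; last 2 first.
  - by rewrite mulr_ge0// ltW.
  - by rewrite ler_wpM2r ?ler_nat// ltW.
  rewrite -tn -tN -(big_mkord xpredT (fun i => Phi (t i.+1) - Phi (t i))).
  by rewrite telescope_sumr.
rewrite /grid_energy -sumrB (le_trans (ler_norm_sum _ _ _))//.
apply: (@le_trans _ _ (\sum_(i < 2 ^ k) (e / h * mesh h k))); last first.
  rewrite sumr_const card_ord -mulr_natl natrX /mesh.
  have -> : 2 ^+ k * (e / h * (h / 2 ^+ k)) = e; last exact: lexx.
  by field; rewrite expf_neq0//= gt_eqF.
apply: ler_sum => i _; rewrite -/(t i) distrC.
set q := frobenius_norm _ ^+ 2.
have tiS : t i <= t i.+1 by rewrite tS lerDl ltW.
have := @increment_bound R (fun s => Phi s + - (q * s))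
  (fun s => frobenius_norm (sigma s) ^+ 2 - q) (t i) (t i.+1) (e / h) (ltW eh0) tiS.
have -> : Phi (t i.+1) + - (q * t i.+1) - (Phi (t i) + - (q * t i)) =
   Phi (t i.+1) - Phi (t i) - q * mesh h k by rewrite tS; ring.
have -> : t i.+1 - t i = mesh h k by rewrite tS; ring.
apply.
- move=> x tx; have x0 := le_trans (t0 i) tx.
  apply: (is_derive_eq (is_derive_add (dPhi x x0) (is_deriveN (is_derive_scale q (is_derive_id x 1))))).
  by rewrite mulr1.
- move=> x tx xt; have x0 := le_trans (t0 i) tx.
  have := hN k Nk (t i) (t0 i); rewrite !max_l//.
  have -> : t i <= n.+1%:R * h by rewrite -tN /t ler_pM2r// ler_nat leq_add2l ltnW.
  move=> /(_ isT x); rewrite max_l//; apply.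
  by rewrite ger0_norm ?subr_ge0// lerBlDl -tS.
Qed.

End RiemannSums.

Section Probability.
Context {dT : measure_display} {T : measurableType dT} {R : realType}.
Variable P : probability T R.
Local Open Scope ereal_scope.

Lemma measurable_set_gt (f : T -> R) (c : R) : measurable_fun setT f ->
  measurable [set w | (c < f w)%R].
Proof.
move=> mf; have := mf measurableT _ (measurable_itv `]c, +oo[).
by rewrite setTI; congr measurable; apply/seteqP; split=> w/=; rewrite in_itv/= andbT.
Qed.

Lemma measurable_set_ge (f : T -> R) (c : R) : measurable_fun setT f ->
  measurable [set w | (c <= f w)%R].
Proof.
move=> mf; have := mf measurableT _ (measurable_itv `[c, +oo[).
by rewrite setTI; congr measurable; apply/seteqP; split=> w/=; rewrite in_itv/= andbT.
Qed.

Lemma measurable_exists (I : countType) (A : I -> set T) : (forall i, measurable (A i)) ->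
  measurable [set w | exists i, A i w].
Proof.
move=> mA; rewrite (_ : [set w | _] = \bigcup_i (if unpickle i is Some i' then A i' else set0)).
  by apply: bigcup_measurable => i _; case: (unpickle i).
apply/seteqP; split=> [w [i Ai]|w [i _]]; first by exists (pickle i) => //; rewrite pickleK.
by case: (unpickle i) => // i' Ai; exists i'.
Qed.

Lemma measurable_forall (I : countType) (A : I -> set T) : (forall i, measurable (A i)) ->
  measurable [set w | forall i, A i w].
Proof.
move=> mA; rewrite (_ : [set w | _] = ~` [set w | exists i, (~` A i) w]).
  by apply: measurableC; apply: measurable_exists => i; exact: measurableC.
by apply/seteqP; split=> w /= H; [move=> [k]; exact|move=> i; apply: contrapT => Ai; apply: H; exists i].
Qed.

Lemma measurable_exists_seq (I : eqType) (s : seq I) (A : I -> set T) :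
  (forall a, measurable (A a)) -> measurable [set w | exists2 a, a \in s & A a w].
Proof.
move=> mA; elim: s => [|a s IH].
  by rewrite (_ : [set w | _] = set0)//; apply/seteqP; split=> // w [].
rewrite (_ : [set w | _] = A a `|` [set w | exists2 a, a \in s & A a w]).
  exact: measurableU.
apply/seteqP; split=> [w [b]|w [Aa|[b bs Ab]]].
- by rewrite inE => /predU1P[->|bs] Ab; [left|right; exists b].
- by exists a => //; rewrite mem_head.
- by exists b => //; rewrite inE bs orbT.
Qed.

Lemma probability_exists_seq_le (I : eqType) (s : seq I) (A : I -> set T) :
  (forall a, measurable (A a)) ->
  P [set w | exists2 a, a \in s & A a w] <= \sum_(a <- s) P (A a).
Proof.
move=> mA; elim: s => [|a s IH].
  by rewrite (_ : [set w | _] = set0) ?measure0// ?big_nil//; apply/seteqP; split=> // w [].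
rewrite (_ : [set w | _] = A a `|` [set w | exists2 a, a \in s & A a w]).
  rewrite big_cons (le_trans (measureU2 P (mA a) (measurable_exists_seq s mA)))//.
  exact: leeD.
apply/seteqP; split=> [w [b]|w [Aa|[b bs Ab]]].
- by rewrite inE => /predU1P[->|bs] Ab; [left|right; exists b].
- by exists a => //; rewrite mem_head.
- by exists b => //; rewrite inE bs orbT.
Qed.

End Probability.

(** * Grid sums and their limit in probability *)

Section Frobenius.
Context {dT : measure_display} {T : measurableType dT} {R : realType}.

Lemma frobenius_coord_le m n (M : 'M[R]_(m, n)) i j : `|M i j| <= frobenius_norm M.
Proof.
rewrite -ler_sqr ?nnegrE// ?sqrtr_ge0// frobenius_sq real_normK ?num_real//.
rewrite (bigD1 i)//= (bigD1 j)//= -addrA lerDl addr_ge0// sumr_ge0// => k _.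
  by rewrite sqr_ge0.
by rewrite sumr_ge0// => l _; rewrite sqr_ge0.
Qed.

Lemma measurable_frobenius_sq n (Y : T -> 'cV[R]_n) :
  (forall i, measurable_fun setT (fun w => Y w i 0)) ->
  measurable_fun setT (fun w => frobenius_norm (Y w) ^+ 2).
Proof.
move=> mY; rewrite (_ : (fun w => _) = fun w => \sum_i \sum_(j < 1) Y w i j ^+ 2); last first.
  by apply/funext => w; rewrite frobenius_sq.
apply: measurable_sum => i; apply: measurable_sum => j; rewrite (ord1 j).
exact: measurable_funX.
Qed.

End Frobenius.

Section NoiseEstimates.
Context {dT : measure_display} {T : measurableType dT} {R : realType}.
Variables (P : probability T R) (d r : nat).
Variables (F : R -> set (set T)) (B : R -> T -> 'cV[R]_r).
Hypotheses (hF : is_filtration F) (hB : brownian_motion P F B).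
Variables (sigma : R -> 'M[R]_(d, r)).
Hypothesis hsigma : {within `[0, +oo[, continuous sigma}.
Variable h : R.
Hypothesis h0 : 0 < h.

Definition grid_ito k n w : 'cV[R]_d := step_ito B (grid_step sigma h k n) w.
Local Notation S := grid_ito.
Local Notation delta := (mesh h).

Definition grid_incr k (a : 'I_d) (i : nat) (w : T) : R :=
  \sum_j sigma (i%:R * delta k) a j * (B (i.+1%:R * delta k) w - B (i%:R * delta k) w) j 0.

Definition grid_var k (a : 'I_d) (i : nat) : R := (\sum_j sigma (i%:R * delta k) a j ^+ 2) * delta k.

Lemma grid_itoE k n w a : S k n w a 0 = \sum_(i < n) grid_incr k a i w.
Proof. by rewrite /grid_ito /step_ito summxE; apply: eq_bigr => i _; rewrite mxE. Qed.

Lemma grid_gaussian_increments k a m : gaussian_increments P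
  (fun i => F ((m + i)%:R * delta k)) (fun i => grid_incr k a (m + i)) (fun i => grid_var k a (m + i)).
Proof.
exact: (gaussian_increments_shift m (brownian_gaussian_increments hF hB
  (fun i j => sigma (i%:R * delta k) a j) (mesh_gt0 k h0))).
Qed.

Lemma grid_ito_incr k m q w a :
  S k (m + q) w a 0 - S k m w a 0 = \sum_(i < q) grid_incr k a (m + i) w.
Proof. by rewrite !grid_itoE big_split_ord/= addrAC subrr add0r. Qed.

Lemma gmeas_grid_ito k n a : gmeas (F (n%:R * delta k)) (fun w => S k n w a 0).
Proof.
have gi := grid_gaussian_increments k a 0.
have sF : sigma_algebra setT (F (n%:R * delta k)) by have := gi_sigma gi n; rewrite add0n.
under eq_fun do rewrite grid_itoE.
elim: n sF => [|n IH] sF.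
  by under eq_fun do rewrite big_ord0; exact: gmeas_cst.
under eq_fun do rewrite big_ord_recr/=.
apply: gmeasD => //; last by have := gi_adapted gi n; rewrite !add0n.
have sFn : sigma_algebra setT (F (n%:R * delta k)) by have := gi_sigma gi n; rewrite add0n.
by apply: gmeasS (IH sFn); have := gi_mono gi (i:=n); rewrite !add0n.
Qed.

Lemma measurable_grid_ito k n a : measurable_fun setT (fun w => S k n w a 0).
Proof.
apply: gmeas_measurable (gmeas_grid_ito k n a).
by have := @gi_meas _ _ _ _ _ _ _ (grid_gaussian_increments k a 0) n; rewrite add0n.
Qed.

Lemma grid_var_sum k n : \sum_a \sum_(i < 2 ^ k) grid_var k a (n * 2 ^ k + i) = grid_energy sigma h k n.
Proof.
rewrite exchange_big/=; apply: eq_bigr => i _.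
by rewrite frobenius_sq -big_distrl.
Qed.

Lemma grid_var_ge0 k a i : 0 <= grid_var k a i.
Proof. by rewrite mulr_ge0 ?(ltW (mesh_gt0 k h0))// sumr_ge0// => j _; rewrite sqr_ge0. Qed.

Variable M : R -> T -> 'cV[R]_d.
Hypothesis hM : is_ito_integral P F B sigma M.

Lemma measurable_noise t i : 0 <= t -> measurable_fun setT (fun w => M t w i 0).
Proof. by move=> t0; have [aM _ _] := hM; exact: (adapted_measurable hF i aM t0). Qed.

Lemma dyadic_ge0 l p : 0 <= p%:R * delta l.
Proof. by rewrite mulr_ge0// ltW// mesh_gt0. Qed.

Let err l p j w := S (l + j) (p * 2 ^ j) w - M (p%:R * delta l) w.

Let measurable_err l p j i : measurable_fun setT (fun w => err l p j w i 0).
Proof.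
rewrite (_ : (fun w => _) = fun w => S (l + j) (p * 2 ^ j) w i 0 - M (p%:R * delta l) w i 0); last first.
  by apply/funext => w; rewrite !mxE.
apply: measurable_funB; first exact: measurable_grid_ito.
exact: (measurable_noise _ (dyadic_ge0 _ _)).
Qed.

Lemma cvge0_near (u : nat -> \bar R) : u k @[k --> \oo] --> 0%E ->
  forall e : R, 0 < e -> \forall k \near \oo, (u k <= e%:E)%E.
Proof.
move=> /fine_cvgP[fu /cvgrPdist_le hu] e e0; have := hu e e0.
move=> H; near=> k.
have fk : u k \is a fin_num by near: k.
have : `|0 - fine (u k)| <= e by near: k.
by rewrite sub0r normrN => /(le_trans (ler_norm _)); rewrite -lee_fin fineK.
Unshelve. all: by end_near. Qed.

(** Chebyshev's inequality turns the L2 limit that defines the Ito integral into a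
    limit in probability. *)
Lemma ito_cvg_prob l p (e : R) : 0 < e ->
  P [set w | e <= frobenius_norm (err l p j w)] @[j --> \oo] --> 0%E.
Proof.
move=> e0; have [_ _ /(_ (p%:R * delta l) (dyadic_ge0 l p)) hito] := hM.
have on_t j : stepfun_on (p%:R * delta l) (grid_step sigma h (l + j) (p * 2 ^ j)).
  by rewrite (mesh_refine h l j); exact: grid_step_on.
apply: cvge0_le => // x x0.
have ex0 : 0 < e ^+ 2 * x by rewrite mulr_gt0// exprn_gt0.
have := cvge0_near (hito _ on_t (grid_step_cvg hsigma h0 l p)) ex0.
apply: filterS => j Ej.
have mg : measurable_fun setT (fun w => (frobenius_norm (err l p j w) ^+ 2)%:E).
  by apply/measurable_EFinP; apply: measurable_frobenius_sq => i; exact: measurable_err.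
have e20 : 0 < e ^+ 2 by rewrite exprn_gt0.
have := le_integral_abse P measurableT mg e20.
rewrite setTI (_ : [set w | _] = [set w | e <= frobenius_norm (err l p j w)]); last first.
  by apply/seteqP; split=> w/=;
    rewrite lee_fin ger0_norm ?sqr_ge0// ler_sqr ?nnegrE ?(ltW e0) ?sqrtr_ge0.
under [X in (_ <= X)%E]eq_integral do rewrite gee0_abs ?lee_fin ?sqr_ge0//.
move=> /le_trans/(_ Ej); rewrite (EFinM (e ^+ 2) x) lee_pmul2l//.
Qed.

(** Off this event, whose probability vanishes as j grows, bounds for the grid sums
    at the first N nodes of level l are bounds for M there. *)
Definition bad_event l N (e : R) j : set T :=
  [set w | exists2 p, p \in iota 0 N & e <= frobenius_norm (err l p j w)].

Let measurable_err_ge l p (e : R) j : 0 < e ->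
  measurable [set w | e <= frobenius_norm (err l p j w)].
Proof.
move=> e0; rewrite (_ : [set w | _] = [set w | e ^+ 2 <= frobenius_norm (err l p j w) ^+ 2]).
  by apply: measurable_set_ge; apply: measurable_frobenius_sq => i; exact: measurable_err.
by apply/seteqP; split=> w/=; rewrite ler_sqr ?nnegrE ?sqrtr_ge0// ltW.
Qed.

Lemma measurable_bad_event l N (e : R) j : 0 < e -> measurable (bad_event l N e j).
Proof. by move=> e0; apply: measurable_exists_seq => p; exact: measurable_err_ge. Qed.

Lemma bad_event_cvg l N (e : R) : 0 < e ->
  forall x : R, 0 < x -> \forall j \near \oo, (P (bad_event l N e j) <= x%:E)%E.
Proof.
move=> e0; have mA p j := @measurable_err_ge l p e j e0.
have sum0 : (\sum_(p <- iota 0 N) P [set w | (e <= frobenius_norm (err l p j w))%R])%E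
    @[j --> \oo] --> 0%E.
  elim: (iota 0 N) => [|p s IH].
    by under eq_fun do rewrite big_nil; exact: cvg_cst.
  under eq_fun do rewrite big_cons.
  have := cvgeD _ (@ito_cvg_prob l p e e0) IH; rewrite adde0; exact.
move=> x x0; have := cvge0_near sum0 x0; apply: filterS => j; apply: le_trans.
exact: (probability_exists_seq_le P (iota 0 N) (fun p => mA p j)).
Qed.

End NoiseEstimates.

(** * Tail bounds for the noise *)

Section NoiseTails.
Context {dT : measure_display} {T : measurableType dT} {R : realType}.
Variables (P : probability T R) (d r : nat).
Variables (F : R -> set (set T)) (B : R -> T -> 'cV[R]_r).
Hypotheses (hF : is_filtration F) (hB : brownian_motion P F B).
Variables (sigma : R -> 'M[R]_(d, r)).
Hypothesis hsigma : {within `[0, +oo[, continuous sigma}.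
Variable h : R.
Hypothesis h0 : 0 < h.
Variable M : R -> T -> 'cV[R]_d.
Hypothesis hM : is_ito_integral P F B sigma M.

Local Notation S := (grid_ito B sigma h).
Local Notation delta := (mesh h).
Local Notation bad := (bad_event B sigma h M).
Local Notation block_energy n := (energy sigma (n%:R * h) (n.+1%:R * h)).

Lemma not_bad l N e j w p a : ~ bad l N e j w -> (p < N)%N ->
  `|S (l + j) (p * 2 ^ j) w a 0 - M (p%:R * delta l) w a 0| <= e.
Proof.
move=> nb pN; rewrite leNgt; apply/negP => lt_e; apply: nb; exists p.
  by rewrite mem_iota.
rewrite (le_trans (ltW lt_e))//.
have := frobenius_coord_le (S (l + j) (p * 2 ^ j) w - M (p%:R * delta l) w) a 0.
by rewrite !mxE.
Qed.

Definition window_exceeds n l (e : R) : set T := [set w | exists a, exists2 p,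
  p \in iota 0 (2 ^ l).+1 &
  e < `|M ((n * 2 ^ l + p)%:R * delta l) w a 0 - M (n%:R * h) w a 0|].

Lemma measurable_window_exceeds n l e : measurable (window_exceeds n l e).
Proof.
apply: measurable_exists => a; apply: measurable_exists_seq => p.
apply: (@measurable_set_gt _ _ _ (fun w => `|M ((n * 2 ^ l + p)%:R * delta l) w a 0 - M (n%:R * h) w a 0|)).
apply: measurableT_comp; first exact: normr_measurable.
apply: measurable_funB; apply: (measurable_noise hF hM); first exact: dyadic_ge0.
by rewrite mulr_ge0// ltW.
Qed.

(** Of the threshold [3 e] for M, one part is left for the grid sums and two make up
    for the approximation errors at the two ends. *)
Lemma window_exceeds_le n l (e x : R) : 0 < e -> 0 < x -> block_energy n < x ->
  (P (window_exceeds n l (3 * e)) <= (d%:R * (2 * expR (- (e ^+ 2 / (2 * x)))))%:E)%E.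
Proof.
move=> e0 x0 enx; apply/lee_addgt0Pr => y y0.
set N := ((n.+1 * 2 ^ l).+1)%N.
have [J1 _ hJ1] := bad_event_cvg hF hB hsigma h0 hM l N e0 y0.
have xe0 : 0 < x - block_energy n by rewrite subr_gt0.
have [J2 _ hJ2] := grid_energy_cvg hsigma h0 n xe0.
pose j := maxn J1 J2; pose k := (l + j)%N; pose m := (n * 2 ^ k)%N.
have Pbad : (P (bad l N e j) <= y%:E)%E by apply: hJ1; rewrite /= leq_maxl.
have gx : grid_energy sigma h k n <= x.
  have := hJ2 k; rewrite /= /k (leq_trans (leq_maxr J1 J2)) ?leq_addl//.
  by move=> /(_ isT)/(le_trans (ler_norm _)); rewrite lerBlDr subrK.
pose A a : set T := [set w | exists q, (q <= 2 ^ k)%N /\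
  e <= `|\sum_(i < q) grid_incr B sigma h k a (m + i) w|].
have hA a : measurable (A a) /\ (P (A a) <= (2 * expR (- (e ^+ 2 / (2 * x))))%:E)%E.
  apply: (maximal_two_sided (grid_gaussian_increments hF hB sigma h0 k a m)) => //.
  apply: le_trans gx; rewrite -grid_var_sum (bigD1 a)//= lerDl.
  by apply: sumr_ge0 => b _; apply: sumr_ge0 => i _; exact: grid_var_ge0.
have mbad := measurable_bad_event hF hB h0 hM l N j e0.
have mA : measurable [set w | exists2 a, a \in enum 'I_d & A a w].
  by apply: measurable_exists_seq => a; exact: (hA a).1.
apply: (@le_trans _ _ (P ([set w | exists2 a, a \in enum 'I_d & A a w] `|` bad l N e j))).
  apply: le_measure; rewrite ?inE//.
  - exact: measurable_window_exceeds.
  - exact: measurableU.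
  move=> w [a [p]]; rewrite mem_iota add0n ltnS => /andP[_ pl] ep.
  have [|nb] := pselect (bad l N e j w); first by right.
  left; exists a; first by rewrite mem_enum.
  have pj : (p * 2 ^ j <= 2 ^ k)%N by rewrite /k expnD leq_mul2r pl orbT.
  exists (p * 2 ^ j)%N; split=> //.
  rewrite -grid_ito_incr.
  have -> : (m + p * 2 ^ j = (n * 2 ^ l + p) * 2 ^ j)%N.
    by rewrite /m /k expnD mulnA -mulnDl.
  have -> : m = (n * 2 ^ l * 2 ^ j)%N by rewrite /m /k expnD mulnA.
  have nlN : (n * 2 ^ l < N)%N by rewrite /N ltnS leq_mul2r leqnSn orbT.
  have npN : (n * 2 ^ l + p < N)%N by rewrite /N ltnS mulSnr leq_add2l.
  have := not_bad a nb nlN; have := not_bad a nb npN; rewrite mesh_block.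
  move: ep; rewrite -/k.
  set s1 := S _ _ _ _ _; set s0 := S _ _ _ _ _; set m1 := M _ _ _ _; set m0 := M _ _ _ _.
  move=> ep h1 h2.
  have := ler_normD (s1 - s0) (s0 - m0 - (s1 - m1)).
  have := ler_normB (s0 - m0) (s1 - m1).
  have -> : s1 - s0 + (s0 - m0 - (s1 - m1)) = m1 - m0 by ring.
  lra.
apply: (le_trans (measureU2 P mA mbad)); apply: leeD => //.
apply: le_trans (probability_exists_seq_le P (enum 'I_d) (fun a => (hA a).1)) _.
rewrite big_enum/=.
apply: (@le_trans _ _ (\sum_(a < d) (2 * expR (- (e ^+ 2 / (2 * x))))%:E)%E).
  by apply: lee_sum => a _; exact: (hA a).2.
by rewrite sumEFin sumr_const card_ord lee_fin -[leLHS]mulr_natl lexx.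
Qed.

Definition block_incr k n w a : R := S k (n.+1 * 2 ^ k) w a 0 - S k (n * 2 ^ k) w a 0.

Definition small_blocks k N0 L (e : R) : set T :=
  [set w | forall n a, (N0 <= n)%N -> (n < L)%N -> `|block_incr k n w a| <= e].

Lemma small_blocksS k N0 L e : (N0 <= L)%N ->
  small_blocks k N0 L.+1 e = small_blocks k N0 L e `&` [set w | forall a, `|block_incr k L w a| <= e].
Proof.
move=> NL; apply/seteqP; split=> [w H|w [H1 H2] n a Nn].
  by split=> [n a Nn nL|a]; apply: H => //; exact: ltnW.
by rewrite ltnS leq_eqVlt => /predU1P[->//|nL]; exact: H1.
Qed.

Let t0 k n : 0 <= n%:R * delta k. Proof. exact: dyadic_ge0. Qed.

Lemma filtration_small_blocks k N0 i e :
  F (((N0 + i) * 2 ^ k)%:R * delta k) (small_blocks k N0 (N0 + i) e).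
Proof.
have [sF mF ndF] := hF.
elim: i => [|i IH].
  rewrite addn0 (_ : small_blocks _ _ _ _ = setT); first exact: sigma_setT (sF _ (t0 _ _)).
  by apply/seteqP; split=> // w _ n a Nn nN; move: (leq_ltn_trans Nn nN); rewrite ltnn.
rewrite addnS small_blocksS ?leq_addr//.
set L := (N0 + i)%N; set t := (L.+1 * 2 ^ k)%:R * delta k.
have Lt : (L * 2 ^ k)%:R * delta k <= t.
  by rewrite /t ler_pM2r ?mesh_gt0// ler_nat leq_mul2r leqnSn orbT.
apply: sigma_setI (sF _ (t0 _ _)) _ _; first exact: ndF (t0 _ _) Lt _ IH.
have Fx a : F t [set w | `|block_incr k L w a| <= e].
  have gx : gmeas (F t) (fun w => S k (L.+1 * 2 ^ k) w a 0 + -1 * S k (L * 2 ^ k) w a 0).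
    apply: gmeasD (sF _ (t0 _ _)) (gmeas_grid_ito hF hB _ h0 _ _ _) _.
    apply: (gmeas_comp (g := fun x => -1 * x)); last exact: measurable_funM.
    exact: gmeasS (ndF _ _ (t0 _ _) Lt) (gmeas_grid_ito hF hB _ h0 _ _ _).
  have := gx _ (measurable_itv `[- e, e]); congr (F t _).
  by apply/seteqP; split=> w/=; rewrite in_itv/= ler_norml mulN1r.
rewrite -(measurable_g_measurableTypeE (sF _ (t0 k (L.+1 * 2 ^ k)%N))).
apply: (@measurable_forall _ (g_sigma_algebraType (F t)) _ (fun a => [set w | `|block_incr k L w a| <= e])) => a.
by rewrite (measurable_g_measurableTypeE (sF _ (t0 k (L.+1 * 2 ^ k)%N))).
Qed.

Lemma measurable_small_blocks k N0 i e : measurable (small_blocks k N0 (N0 + i) e).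
Proof. by have [_ mF _] := hF; exact: mF (t0 _ _) _ (filtration_small_blocks _ _ _ _). Qed.

(** The lower bound of [gaussian_lower_tail] for a variance V. *)
Definition exceed_prob (e V : R) : R := expR (- (8 + 32 * (e ^+ 2 / V))) / 2.

Lemma exceed_prob_mono e V V' : 0 < V -> V <= V' -> exceed_prob e V <= exceed_prob e V'.
Proof.
move=> V0 VV'; rewrite /exceed_prob ler_pM2r// ler_expR lerN2 lerD2l ler_pM2l//.
by rewrite ler_wpM2l ?sqr_ge0// lef_pV2// posrE// (lt_le_trans V0).
Qed.

Lemma large_coordinate n (v : 'I_n -> R) x : (0 < n)%N -> x <= \sum_a v a ->
  exists a, x / n%:R <= v a.
Proof.
move=> n0 xv; apply: contrapT => /forallNP H.
have n0' : (0 : R) < n%:R by rewrite ltr0n.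
suff : \sum_a v a < \sum_(a < n) (x / n%:R).
  rewrite sumr_const card_ord -[ltRHS]mulr_natl mulrC divfK ?gt_eqF// => lt_vx.
  by have := le_lt_trans xv lt_vx; rewrite ltxx.
have lt_va a : v a < x / n%:R by rewrite ltNge; exact/negP.
case: n n0 v lt_va {H xv n0'} => // n _ v H.
rewrite !big_ord_recl; apply: ltr_leD; first exact: H.
by apply: ler_sum => a _; exact: ltW.
Qed.

Hypothesis d0 : (0 < d)%N.

(** Some coordinate carries at least the d-th part of the energy of the block, and
    [gaussian_lower_tail] applies to it given the event that the earlier blocks are
    small. *)
Lemma small_blocks_step k N0 i (e x kap : R) : 0 < e ->
  kap <= 0 \/ [/\ 0 < x, x <= grid_energy sigma h k (N0 + i) & kap <= exceed_prob e (x / d%:R)] ->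
  (P (small_blocks k N0 (N0 + i).+1 e) <= (1 - kap)%:E * P (small_blocks k N0 (N0 + i) e))%E.
Proof.
move=> e0 hkap; set L := (N0 + i)%N; set D := small_blocks k N0 L e.
have mD : measurable D by exact: measurable_small_blocks.
have mD' : measurable (small_blocks k N0 L.+1 e) by rewrite /L -addnS; exact: measurable_small_blocks.
have sub : small_blocks k N0 L.+1 e `<=` D by rewrite small_blocksS ?leq_addr//; exact: subIsetl.
pose p := fine (P D).
have pE : P D = p%:E by rewrite fineK// fin_num_measure.
have p0 : 0 <= p by rewrite fine_ge0.
case: hkap => [kap0|[x0 xV hk]].
  apply: (@le_trans _ _ (P D)); first by apply: le_measure; rewrite ?inE.
  by rewrite pE -EFinM lee_fin ler_peMl// lerBrDr gerDl.
have := grid_var_sum sigma h k L; move: xV => /[swap] <- /(large_coordinate d0)[a xa].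
pose m := (L * 2 ^ k)%N.
have gi := grid_gaussian_increments hF hB sigma h0 k a m.
have d0' : (0 : R) < d%:R by rewrite ltr0n.
have xd0 : 0 < x / d%:R by rewrite divr_gt0.
have V0 : 0 < \sum_(i < 2 ^ k) grid_var sigma h k a (m + i) by exact: lt_le_trans xa.
have FD : F ((m + 0)%:R * delta k) D by rewrite addn0; exact: filtration_small_blocks.
have := gaussian_lower_tail gi e0 V0 FD.
set X := [set w | (e < _)%R] => hX.
have mX : measurable X.
  apply: measurable_set_gt; apply: measurable_sum => i'.
  exact: gmeas_measurable (gi_meas gi (i:=i'.+1)) (gi_adapted gi i').
have DX : small_blocks k N0 L.+1 e `<=` D `\` X.
  rewrite small_blocksS ?leq_addr// => w [Dw H]; split=> // Xw.
  have := H a; rewrite /block_incr mulSnr grid_ito_incr leNgt => /negP; apply.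
  by apply: (lt_le_trans Xw); rewrite ler_norm.
apply: (@le_trans _ _ (P (D `\` X))).
  by apply: le_measure => //; rewrite inE//; exact: measurableD.
pose q := fine (P (D `&` X)).
have qE : P (D `&` X) = q%:E by rewrite fineK// fin_num_measure//; exact: measurableI.
have -> : P (D `\` X) = (p - q)%:E.
  have Dfin : (P D < +oo)%E by apply: (le_lt_trans (probability_le1 P mD)); rewrite ltry.
  by rewrite EFinB -pE -qE; exact: measureD.
move: hX; rewrite qE pE -!EFinM !lee_fin => hX.
have : kap * p <= q.
  apply: le_trans hX; rewrite ler_wpM2r// (le_trans hk)//.
  exact: exceed_prob_mono.
lra.
Qed.

(** The threshold is tripled and the energy halved to leave room for the passage
    from M to the grid sums. *)
Definition kappa e n : R :=
  if 0 < block_energy n then exceed_prob (3 * e) (block_energy n / 2 / d%:R) else 0.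

Lemma exceed_prob_bounds e V : 0 < V -> 0 <= exceed_prob e V /\ exceed_prob e V <= 1.
Proof.
move=> V0; rewrite /exceed_prob; split; first by rewrite divr_ge0// expR_ge0.
rewrite ler_pdivrMr// mul1r (@le_trans _ _ 1)//; last by lra.
by rewrite -[leRHS]expR0 ler_expR oppr_le0 addr_ge0// mulr_ge0// divr_ge0 ?sqr_ge0// ltW.
Qed.

Lemma kappa_bounds e n : 0 <= kappa e n /\ kappa e n <= 1.
Proof.
rewrite /kappa; case: ifPn => // V0; apply: exceed_prob_bounds.
by rewrite !divr_gt0// ltr0n.
Qed.

Lemma small_blocks_le k N0 i (e : R) : 0 < e ->
  (forall n, (N0 <= n)%N -> (n < N0 + i)%N -> 0 < block_energy n ->
     block_energy n / 2 <= grid_energy sigma h k n) ->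
  (P (small_blocks k N0 (N0 + i) (3 * e)) <= (\prod_(N0 <= n < N0 + i) (1 - kappa e n))%:E)%E.
Proof.
move=> e0; elim: i => [|i IH] H.
  have m := measurable_small_blocks k N0 0 (3 * e); rewrite addn0 in m *.
  by rewrite big_geq//; exact: probability_le1.
rewrite addnS big_nat_recr ?leq_addr//= EFinM [leRHS]muleC.
have [k0 k1] := kappa_bounds e (N0 + i).
have e30 : 0 < 3 * e by rewrite mulr_gt0.
apply: (@le_trans _ _ ((1 - kappa e (N0 + i))%:E * P (small_blocks k N0 (N0 + i) (3 * e)))%E).
  apply: (@small_blocks_step _ _ _ _ (block_energy (N0 + i) / 2)) => //.
  rewrite /kappa; case: ifPn => [V0|_]; last by left.
  right; split=> //; first by rewrite divr_gt0.
  by apply: H => //; rewrite ?leq_addr// addnS.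
apply: lee_wpmul2l; first by rewrite lee_fin subr_ge0.
by apply: IH => n Nn nN; apply: H => //; rewrite addnS ltnW// ltnS.
Qed.

Definition small_windows N0 L (e : R) : set T := [set w | forall n a, (N0 <= n)%N -> (n < L)%N ->
  `|M (n.+1%:R * h) w a 0 - M (n%:R * h) w a 0| <= e].

Lemma measurable_small_windows_cond (A : pred nat) e : measurable [set w | forall n a, A n ->
  `|M (n.+1%:R * h) w a 0 - M (n%:R * h) w a 0| <= e].
Proof.
rewrite (_ : [set w | _] = [set w | forall na : nat * 'I_d, A na.1 ->
  `|M (na.1.+1%:R * h) w na.2 0 - M (na.1%:R * h) w na.2 0| <= e]); last first.
  by apply/seteqP; split=> w H; [move=> [n a]; exact: H|move=> n a; exact: (H (n, a))].
apply: measurable_forall => -[n a]/=.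
case: (A n); last by rewrite (_ : (fun w => _) = setT)//; apply/seteqP; split.
rewrite (_ : (fun w => _) = ~` [set w | e < `|M (n.+1%:R * h) w a 0 - M (n%:R * h) w a 0|]); last first.
  apply/seteqP; split=> w/=; last by move=> H _; rewrite leNgt; exact/negP.
  by move=> /(_ isT); rewrite leNgt => /negP.
apply: measurableC; apply: measurable_set_gt.
apply: measurableT_comp; first exact: normr_measurable.
by apply: measurable_funB; apply: (measurable_noise hF hM); rewrite mulr_ge0// ltW.
Qed.

(** The product bound behind the second Borel-Cantelli lemma, carried over from the
    grid sums to M. *)
Lemma small_windows_le N0 i (e : R) : 0 < e ->
  (P (small_windows N0 (N0 + i) e) <= (\prod_(N0 <= n < N0 + i) (1 - kappa e n))%:E)%E.
Proof.
move=> e0; apply/lee_addgt0Pr => y y0; set L := (N0 + i)%N.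
have [J1 _ hJ1] := bad_event_cvg hF hB hsigma h0 hM 0 L.+1 e0 y0.
have [J2 hJ2] : exists J2, forall k, (J2 <= k)%N -> forall n : 'I_L, 0 < block_energy n ->
    block_energy n / 2 <= grid_energy sigma h k n.
  have : \forall k \near \oo, forall n : 'I_L, 0 < block_energy n ->
      block_energy n / 2 <= grid_energy sigma h k n.
    apply: filter_forall => n.
    have [V0|_] := ltP 0 (block_energy n); last by apply: nearW.
    have V20 : 0 < block_energy n / 2 by rewrite divr_gt0.
    have := grid_energy_cvg hsigma h0 n V20; apply: filterS => k.
    by rewrite distrC => /(le_trans (ler_norm _)) H _; lra.
  by move=> [J2 _ hJ2]; exists J2 => k; exact: hJ2.
pose j := maxn J1 J2.
have Pbad : (P (bad 0 L.+1 e j) <= y%:E)%E by apply: hJ1; rewrite /= leq_maxl.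
have mbad := measurable_bad_event hF hB h0 hM 0 L.+1 j e0.
have msmall := measurable_small_blocks j N0 i (3 * e).
apply: (@le_trans _ _ (P (small_blocks j N0 L (3 * e) `|` bad 0 L.+1 e j))).
  apply: le_measure; rewrite ?inE.
  - rewrite (_ : small_windows _ _ _ = [set w | forall n a, ((N0 <= n) && (n < L))%N ->
       `|M (n.+1%:R * h) w a 0 - M (n%:R * h) w a 0| <= e]).
      exact: (@measurable_small_windows_cond (fun n => (N0 <= n) && (n < L))%N).
    by apply/seteqP; split=> w H n a; [move=> /andP[]; exact: H|move=> h1 h2; apply: H; rewrite h1].
  - exact: measurableU.
  move=> w H; have [|nb] := pselect (bad 0 L.+1 e j w); first by right.
  left=> n a Nn nL; rewrite /block_incr.
  have := not_bad a nb (ltnW (nL : (n < L)%N) : (n < L.+1)%N).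
  have := not_bad a nb (nL : (n.+1 < L.+1)%N).
  have d0E q : q%:R * delta 0 = q%:R * h by rewrite /mesh expr0 divr1.
  rewrite !d0E add0n; have := H n a Nn nL.
  set s1 := S _ _ _ _ _; set s0 := S _ _ _ _ _; set m1 := M _ _ _ _; set m0 := M _ _ _ _.
  move=> h1 h2 h3.
  have := ler_normD (m1 - m0) (s1 - m1 - (s0 - m0)).
  have := ler_normB (s1 - m1) (s0 - m0).
  have -> : m1 - m0 + (s1 - m1 - (s0 - m0)) = s1 - s0 by ring.
  lra.
apply: (le_trans (measureU2 P msmall mbad)); apply: leeD => //.
apply: small_blocks_le => // n _ nL; exact: (hJ2 j (leq_maxr _ _) (Ordinal nL)).
Qed.

End NoiseTails.

(** * The Borel-Cantelli lemmas for the noise *)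

Section AlmostSure.
Context {dT : measure_display} {T : measurableType dT} {R : realType}.
Variable P : probability T R.

Lemma ae_forall_count (I : countType) (Q : I -> T -> Prop) :
  (forall i, {ae P, forall w, Q i w}) -> {ae P, forall w, forall i, Q i w}.
Proof.
move=> aeQ.
have : {ae P, forall w, forall n, if unpickle n is Some i then Q i w else True}.
  apply: (@ae_foralln _ _ _ _ (fun n w => if unpickle n is Some i then Q i w else True)) => n.
  by case: (unpickle n) => [i|]; [exact: aeQ|exact: aeW].
by apply: filterS => w H i; have := H (pickle i); rewrite pickleK.
Qed.

Lemma inv_succ_small (e : R) : 0 < e -> exists m : nat, m.+1%:R^-1 <= e.
Proof.
move=> e0; exists (Num.truncn e^-1); rewrite -[leRHS]invrK lef_pV2 ?posrE ?invr_gt0//.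
exact/ltW/truncnS_gt.
Qed.

Variables (d r : nat).
Variables (F : R -> set (set T)) (B : R -> T -> 'cV[R]_r).
Hypotheses (hF : is_filtration F) (hB : brownian_motion P F B).
Variables (sigma : R -> 'M[R]_(d, r)).
Hypothesis hsigma : {within `[0, +oo[, continuous sigma}.
Variable h : R.
Hypothesis h0 : 0 < h.
Local Notation delta := (mesh h).
Local Notation block_energy n := (energy sigma (n%:R * h) (n.+1%:R * h)).

Lemma path_coord_continuous (M : R -> T -> 'cV[R]_d) w a : continuous_paths M ->
  {within `[0, +oo[, continuous (fun t => M t w a 0)}.
Proof. by move=> cM; exact: (within_continuous_coord (cM w)). Qed.

(** At each dyadic time both processes are the limit in probability of the same
    grid sums; the other times follow by path continuity. *)
Lemma noise_unique M M' : is_ito_integral P F B sigma M -> is_ito_integral P F B sigma M' ->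
  {ae P, forall w, forall t, 0 <= t -> M t w = M' t w}.
Proof.
move=> hM hM'; have [_ cM _] := hM; have [_ cM' _] := hM'.
pose Q (x : nat * nat * 'I_d * nat) w :=
  `|M (x.1.1.2%:R * delta x.1.1.1) w x.1.2 0 - M' (x.1.1.2%:R * delta x.1.1.1) w x.1.2 0| <= 2 * x.2.+1%:R^-1.
have aeQ : {ae P, forall w, forall x, Q x w}.
  apply: ae_forall_count => -[[[l p] a] m]; rewrite /Q/=.
  pose e : R := m.+1%:R^-1; have e0 : 0 < e by rewrite invr_gt0.
  pose f w := `|M (p%:R * delta l) w a 0 - M' (p%:R * delta l) w a 0|.
  pose A := [set w | 2 * e < f w].
  have mA : measurable A.
    apply: measurable_set_gt; apply: measurableT_comp; first exact: normr_measurable.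
    by apply: measurable_funB; [apply: (measurable_noise hF hM)|apply: (measurable_noise hF hM')];
      exact: dyadic_ge0.
  exists A; split=> //; last first.
    by move=> w /= /negP; rewrite -ltNge.
  apply/eqP; rewrite eq_le measure_ge0 andbT; apply/lee_addgt0Pr => y y0; rewrite add0e.
  have y20 : 0 < y / 2 by rewrite divr_gt0.
  have [J1 _ hJ1] := bad_event_cvg hF hB hsigma h0 hM l p.+1 e0 y20.
  have [J2 _ hJ2] := bad_event_cvg hF hB hsigma h0 hM' l p.+1 e0 y20.
  pose j := maxn J1 J2.
  have P1 := hJ1 j (leq_maxl _ _); have P2 := hJ2 j (leq_maxr _ _).
  have m1 := measurable_bad_event hF hB h0 hM l p.+1 j e0.
  have m2 := measurable_bad_event hF hB h0 hM' l p.+1 j e0.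
  apply: (@le_trans _ _ (P (bad_event B sigma h M l p.+1 e j `|` bad_event B sigma h M' l p.+1 e j))).
    apply: le_measure; rewrite ?inE//; first exact: measurableU.
    move=> w; rewrite /A/= /f => lt_ef.
    apply: contrapT => /not_orP[n1 n2].
    have := not_bad a n1 (ltnSn p); have := not_bad a n2 (ltnSn p).
    move: lt_ef; set s := grid_ito _ _ _ _ _ _ _ _; set m1' := M _ _ _ _; set m2' := M' _ _ _ _.
    move=> g1 g2 g3; have := ler_normB (s - m2') (s - m1').
    have -> : s - m2' - (s - m1') = m1' - m2' by ring.
    lra.
  apply: (le_trans (measureU2 P m1 m2)); rewrite [y]splitr EFinD; exact: leeD.
apply: filterS aeQ => w H t t0; apply/colP => a; apply/eqP; rewrite -subr_eq0 -normr_le0.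
apply/ler_addgt0Pr => e e0; rewrite add0r.
have e20 : 0 < e / 2 by rewrite divr_gt0.
have e40 : 0 < e / 4 by rewrite divr_gt0.
have cf : {within `[0, +oo[, continuous (fun t => M t w a 0 - M' t w a 0)}.
  have c1 := path_coord_continuous (w:=w) (a:=a) cM; have c2 := path_coord_continuous (w:=w) (a:=a) cM'.
  by move=> x; exact: (continuousB (c1 x) (c2 x)).
have [l [p [_ _ hlp]]] := grid_point_approx h0 e20 t0 cf.
have [m hm] := inv_succ_small e40.
have := H (l, p, a, m); rewrite /Q/= => hQ.
have h2 : 2 * m.+1%:R^-1 <= e / 2.
  by have -> : e / 2 = 2 * (e / 4); [field|rewrite ler_pM2l].
have {}hQ := le_trans hQ h2.
move: hlp hQ; set x := M t _ _ _ - _; set z := M _ _ _ _ - _ => hlp hQ.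
have := ler_normD (x - z) z; rewrite subrK; lra.
Qed.

Section OneNoise.
Variable M : R -> T -> 'cV[R]_d.
Hypothesis hM : is_ito_integral P F B sigma M.

Lemma window_exceeds_nd n e : nondecreasing_seq (fun l => window_exceeds h M n l e).
Proof.
move=> l l' ll'; apply/subsetPset => w [a [p]]; rewrite mem_iota add0n ltnS => /andP[_ pl] ep.
have [j ->] : exists j, l' = (l + j)%N by exists (l' - l)%N; rewrite subnKC.
exists a, (p * 2 ^ j)%N; first by rewrite mem_iota add0n ltnS /= expnD leq_mul2r pl orbT.
rewrite expnD mulnA -mulnDl; move: ep; rewrite (mesh_refine h l j).
by [].
Qed.

Definition window_oscillates n e := \bigcup_l window_exceeds h M n l e.

Lemma measurable_window_oscillates n e : measurable (window_oscillates n e).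
Proof. by apply: bigcup_measurable => l _; exact: (measurable_window_exceeds hF h0 hM). Qed.

Lemma window_oscillates_le n (e x : R) : 0 < e -> 0 < x -> block_energy n < x ->
  (P (window_oscillates n (3 * e)) <= (d%:R * (2 * expR (- (e ^+ 2 / (2 * x)))))%:E)%E.
Proof.
move=> e0 x0 enx.
have mW l : measurable (window_exceeds h M n l (3 * e)).
  exact: (measurable_window_exceeds hF h0 hM).
have cv := @nondecreasing_cvg_mu _ _ _ P _ mW (measurable_window_oscillates n (3 * e)) (window_exceeds_nd n (3 * e)).
rewrite -(cvg_lim _ cv)//; apply: lime_le; first by apply/cvg_ex; eexists; exact: cv.
by apply: nearW => l; exact: (window_exceeds_le hF hB hsigma h0 hM).
Qed.

(** Half of the exponent pays for the prefactor, as [exp (- z^2) <= 1 / (2 z)]. *)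
Lemma exp_tail_weight (e V : R) : 0 < e -> 0 < V ->
  expR (- (e ^+ 2 / (2 * (2 * V)))) <= (Num.sqrt 2 / e) * tail_weight (e / 2) (Num.sqrt V).
Proof.
move=> e0 V0; set s := Num.sqrt V; have s0 : 0 < s by rewrite sqrtr_gt0.
have <- : s ^+ 2 = V by rewrite sqr_sqrtr// ltW.
pose c : R := Num.sqrt 2; have c0 : 0 < c by rewrite sqrtr_gt0.
have c2 : c ^+ 2 = 2 by rewrite sqr_sqrtr.
pose z := e / (2 * c * s).
have z0 : 0 < z by rewrite divr_gt0// !mulr_gt0.
have zz : z ^+ 2 = e ^+ 2 / (8 * s ^+ 2).
  rewrite /z !expr_div_n !exprMn c2; congr (_ / (_ * _)); ring.
have -> : - (e ^+ 2 / (2 * (2 * s ^+ 2))) = - z ^+ 2 - z ^+ 2.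
  by rewrite zz; field; rewrite gt_eqF.
have -> : tail_weight (e / 2) s = s * expR (- z ^+ 2).
  by rewrite /tail_weight zz; congr (_ * expR _); field; rewrite gt_eqF.
rewrite expRD mulrA ler_pM2r ?expR_gt0// expRN.
have h2z : 2 * z <= expR (z ^+ 2).
  apply: le_trans (expR_ge1Dx _); have := sqr_ge0 (z - 1).
  have -> : (z - 1) ^+ 2 = 1 + z ^+ 2 - 2 * z by ring.
  by rewrite subr_ge0.
rewrite -/c; have -> : c / e * s = (2 * z)^-1.
  rewrite /z; have : c * c = 2 by rewrite -expr2.
  move=> cc; apply: (mulIf (x := 2 * (e / (2 * c * s)))).
    by rewrite gt_eqF// mulr_gt0.
  rewrite mulVf; last by rewrite gt_eqF// mulr_gt0.
  by field; rewrite !gt_eqF.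
by rewrite lef_pV2 ?posrE; [exact: h2z|exact: expR_gt0|rewrite mulr_gt0].
Qed.

(** For positive energy, [x = 2 V] in [window_oscillates_le]; for zero energy, where
    the weight is 0, let x decrease to 0. *)
Lemma window_oscillates_weight n (e : R) : 0 < e ->
  (P (window_oscillates n (3 * e)) <=
   (d%:R * 2 * (Num.sqrt 2 / e) * tail_weight (e / 2) (Num.sqrt (block_energy n)))%:E)%E.
Proof.
move=> e0; have := energy_ge0 sigma (n%:R * h) (n.+1%:R * h).
rewrite le_eqVlt => /predU1P[V0|V0]; last first.
  apply: (le_trans (window_oscillates_le (x := 2 * block_energy n) e0 _ _)).
  - by rewrite mulr_gt0.
  - by rewrite ltr_pMl// ltr1n.
  rewrite lee_fin [leLHS]mulrA -[leRHS]mulrA ler_wpM2l ?mulr_ge0//.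
  exact: exp_tail_weight.
rewrite -V0 sqrtr0 /tail_weight mul0r mulr0; apply/lee_addgt0Pr => y y0; rewrite add0e.
pose x := y * e ^+ 2 / (4 * d.+1%:R).
have x0 : 0 < x by rewrite divr_gt0// ?mulr_gt0// exprn_gt0.
apply: (le_trans (window_oscillates_le (x := x) e0 x0 _)); first by rewrite -V0.
rewrite lee_fin; set z := e ^+ 2 / (2 * x).
have z0 : 0 < z by rewrite divr_gt0 ?exprn_gt0// mulr_gt0.
have hz : expR (- z) <= z^-1.
  rewrite expRN lef_pV2 ?posrE ?expR_gt0//.
  by rewrite (le_trans _ (expR_ge1Dx _))// lerDr.
have -> : y = d.+1%:R * (2 * z^-1) by rewrite /z /x; field; rewrite !gt_eqF.
apply: ler_pM; [exact: ler0n|by rewrite mulr_ge0 ?expR_ge0|by rewrite ler_nat|].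
by rewrite ler_pM2l.
Qed.

(** The first Borel-Cantelli lemma for the oscillations of M, with thresholds that
    decrease to 0. *)
Lemma noise_flat :
  (forall eps, 0 < eps -> (\sum_(n <oo) (tail_weight eps
     (Num.sqrt (energy sigma (n.+1%:R * h) (n.+2%:R * h))))%:E < +oo)%E) ->
  {ae P, forall w, forall i, flat h (fun t => M t w i 0)}.
Proof.
move=> Hsum; have [_ cM _] := hM.
have aeQ : {ae P, forall w, forall m : nat, exists N : nat, forall n, (N <= n)%N ->
    ~ window_oscillates n.+1 (3 * m.+1%:R^-1) w}.
  apply: ae_foralln => m; set e : R := m.+1%:R^-1.
  have e0 : 0 < e by rewrite invr_gt0.
  have e20 : 0 < e / 2 by rewrite divr_gt0.
  pose E n := window_oscillates n.+1 (3 * e).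
  have mE n : measurable (E n) by exact: measurable_window_oscillates.
  exists (lim_sup_set E); split.
  - by apply: bigcap_measurableType => n _; exact: bigcup_measurable.
  - apply: lim_sup_set_cvg0 => //.
    pose c := d%:R * 2 * (Num.sqrt 2 / e).
    have c0 : 0 <= c by apply: mulr_ge0; [rewrite mulr_ge0|rewrite divr_ge0 ?sqrtr_ge0 ?(ltW e0)].
    apply: (@le_lt_trans _ _ (\sum_(n <oo) (c%:E * (tail_weight (e / 2)
        (Num.sqrt (energy sigma (n.+1%:R * h) (n.+2%:R * h))))%:E))%E).
      apply: lee_nneseries => [n _ _|n _]; first exact: measure_ge0.
      by rewrite -EFinM; exact: window_oscillates_weight.
    rewrite nneseriesZl; last by move=> n _; rewrite lee_fin tail_weight_ge0 ?sqrtr_ge0.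
    by apply: lte_mul_pinfty; rewrite ?lee_fin//; exact: Hsum.
  - move=> w /= H N _; apply: contrapT => H2; apply: H; exists N => n Nn Enw.
    by apply: H2; exists n.
apply: filterS aeQ => w H i e e0.
have e60 : 0 < e / 6 by rewrite divr_gt0.
have [m hm] := inv_succ_small e60.
have [N hN] := H m; exists N.+1 => -[//|n] u Nn u0 uh.
have e20 : 0 < e / 2 by rewrite divr_gt0.
set t := n.+1%:R * h + u.
have n0 : 0 <= n.+1%:R * h by rewrite mulr_ge0// ltW.
have t0 : 0 <= t by rewrite addr_ge0.
have [l [p [p1 p2 hp]]] := grid_point_approx h0 e20 t0 (path_coord_continuous (w:=w) (a:=i) cM).
have m0 := mesh_gt0 l h0.
have np : (n.+1 * 2 ^ l <= p)%N.
  rewrite -ltnS -(ltr_nat R) -(ltr_pM2r m0) mesh_block (le_lt_trans _ p2)//.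
  by rewrite /t lerDl.
have pn : (p <= n.+2 * 2 ^ l)%N.
  rewrite -(ler_nat R) -(ler_pM2r m0) mesh_block (le_trans p1)//.
  by rewrite /t -[n.+2%:R]natr1 mulrDl mul1r lerD2l.
have : `|M (p%:R * delta l) w i 0 - M (n.+1%:R * h) w i 0| <= 3 * m.+1%:R^-1.
  rewrite leNgt; apply/negP => lt_M; apply: (hN n Nn); exists l => //.
  exists i, (p - n.+1 * 2 ^ l)%N; last by rewrite subnKC.
  by rewrite mem_iota add0n ltnS/= leq_subLR addnC -mulSn.
have h3 : 3 * m.+1%:R^-1 <= e / 2.
  by have -> : e / 2 = 3 * (e / 6); [field|rewrite ler_pM2l].
move=> /le_trans/(_ h3).
move: hp; rewrite -/t; set x := M t _ _ _; set y := M _ _ _ _; set z := M _ _ _ _ => h1 h2.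
have := ler_normD (x - y) (y - z); rewrite addrA subrK; lra.
Qed.

Hypothesis d0 : (0 < d)%N.

Lemma kappaE e n : kappa sigma h e n = expR (- 8) / 2 * exp_weight (18 * 32 * d%:R * e ^+ 2) (block_energy n).
Proof.
rewrite /kappa /exp_weight; case: ifPn => [V0|_]; last by rewrite mulr0.
have dn0 : (d%:R : R) != 0 by rewrite pnatr_eq0 -lt0n.
rewrite /exceed_prob opprD expRD mulrAC; congr (_ * _); congr expR.
by field; rewrite dn0 gt_eqF.
Qed.

Lemma prod_onem_le (I : Type) (s : seq I) (u : I -> R) : (forall n, 0 <= u n <= 1) ->
  \prod_(n <- s) (1 - u n) <= expR (- \sum_(n <- s) u n).
Proof.
move=> u01; elim: s => [|n s IH]; first by rewrite !big_nil oppr0 expR0.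
have /andP[u0 u1] := u01 n.
rewrite !big_cons opprD expRD; apply: ler_pM => //; first by rewrite subr_ge0.
  by apply: prodr_ge0 => k _; rewrite subr_ge0; have /andP[] := u01 k.
exact: expR_ge1Dx.
Qed.

Definition eventually_small e : set T := [set w | exists N : nat, forall n a, (N <= n)%N ->
  `|M (n.+1%:R * h) w a 0 - M (n%:R * h) w a 0| <= e].

Lemma measurable_tail_small N e : measurable [set w | forall n a, (N <= n)%N ->
  `|M (n.+1%:R * h) w a 0 - M (n%:R * h) w a 0| <= e].
Proof. exact: (measurable_small_windows_cond hF h0 hM (fun n => N <= n)%N). Qed.

(** The second Borel-Cantelli lemma: if the sums were unbounded, the products of
    [small_windows_le] would vanish, and the increments would almost surely exceed e
    infinitely often. *)
Lemma exp_weight_bounded : (forall e, 0 < e -> (0 < P (eventually_small e))%E) ->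
  forall K, 0 < K -> exists s, forall N : nat, \sum_(n < N) exp_weight K (block_energy n) <= s.
Proof.
move=> Hpos K K0.
have dn0 : (0 : R) < d%:R by rewrite ltr0n.
(* The threshold at which the exponent of [kappaE] is K. *)
pose e := Num.sqrt (K / (18 * 32 * d%:R)).
have Kd0 : 0 < K / (18 * 32 * d%:R) by rewrite divr_gt0// !mulr_gt0.
have e0 : 0 < e by rewrite sqrtr_gt0.
have KE : 18 * 32 * d%:R * e ^+ 2 = K.
  by rewrite sqr_sqrtr ?ltW// mulrC divfK// gt_eqF// mulr_gt0.
pose u n := exp_weight K (block_energy n).
have u0 n : 0 <= u n by exact: exp_weight_ge0.
pose c : R := expR (- 8) / 2.
have c0 : 0 < c by rewrite divr_gt0// expR_gt0.
apply: contrapT => /forallNP Hs.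
have unb s : exists N : nat, s < \sum_(n < N) u n.
  have /existsNP[N hN] := Hs s; exists N.
  by rewrite ltNge; exact/negP.
pose E N := [set w | forall n a, (N <= n)%N ->
  `|M (n.+1%:R * h) w a 0 - M (n%:R * h) w a 0| <= e].
have mE N : measurable (E N) by exact: measurable_tail_small.
have PE0 N : P (E N) = 0%E.
  apply/eqP; rewrite eq_le measure_ge0 andbT; apply/lee_addgt0Pr => y y0; rewrite add0e.
  have [i hi] := unb (\sum_(n < N) u n + (c * y)^-1).
  have Ni : (N <= N + i)%N by exact: leq_addr.
  apply: (@le_trans _ _ (P (small_windows h M N (N + i) e))).
    apply: le_measure; rewrite ?inE//.
      rewrite (_ : small_windows _ _ _ _ _ = [set w | forall n a, ((N <= n) && (n < N + i))%N ->
          `|M (n.+1%:R * h) w a 0 - M (n%:R * h) w a 0| <= e]).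
        exact: (measurable_small_windows_cond hF h0 hM (fun n => (N <= n) && (n < N + i))%N).
      by apply/seteqP; split=> w H n a; [move=> /andP[]; exact: H|move=> h1 h2; apply: H; rewrite h1].
    by move=> w H n a Nn _; exact: H.
  apply: (le_trans (small_windows_le hF hB hsigma h0 hM d0 _ _ e0)); rewrite lee_fin.
  apply: (le_trans (prod_onem_le _ _)).
    by move=> n; have [k0 k1] := kappa_bounds sigma h d0 e n; rewrite k0 k1.
  under eq_bigr do rewrite kappaE KE.
  rewrite -big_distrr/= -/c.
  have sE : (c * y)^-1 <= \sum_(N <= n < N + i) u n.
    have le_i : \sum_(n < i) u n <= \sum_(0 <= n < N + i) u n.
      rewrite -(big_mkord xpredT u) (big_cat_nat (leq0n i) (leq_addl N i))/= lerDl.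
      by apply: sumr_ge0 => n _.
    have := ltW (lt_le_trans hi le_i).
    by rewrite (big_cat_nat (leq0n N) Ni)/= big_mkord lerD2l.
  have cy0 : 0 < c * y by rewrite mulr_gt0.
  have h1 : y^-1 <= c * \sum_(N <= n < N + i) u n.
    have := sE; rewrite -(ler_pM2l c0); apply: le_trans.
    by rewrite invfM mulrA divff ?mul1r// gt_eqF.
  rewrite expRN -[leRHS]invrK lef_pV2 ?posrE ?expR_gt0 ?invr_gt0//.
  by rewrite (le_trans h1)// (le_trans _ (expR_ge1Dx _))// lerDr.
have := Hpos e e0; rewrite (_ : eventually_small e = \bigcup_N E N); last first.
  by apply/seteqP; split=> [w [N H]|w [N _ H]]; exists N.
suff -> : P (\bigcup_N E N) = 0%E by rewrite ltxx.
apply: measure_negligible; first exact: bigcup_measurable.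
apply: negligible_bigcup => N; apply/negligibleP; [exact: mE|exact: PE0].
Qed.

End OneNoise.

End AlmostSure.

(** * Convergence events and the equivalence *)

Section Events.
Context {dT : measure_display} {T : measurableType dT} {R : realType}.
Variable P : probability T R.

Lemma positive_probability_transfer (C E : set T) (Q : T -> Prop) :
  measurable C -> measurable E -> (0 < P C)%E -> {ae P, forall w, Q w} ->
  (forall w, C w -> Q w -> E w) -> (0 < P E)%E.
Proof.
move=> mC mE PC aeQ CQE; rewrite lt0e measure_ge0 andbT; apply/eqP => PE0.
have : P.-negligible C.
  apply: (@negligibleS _ _ _ _ (E `|` ~` [set w | Q w])).
    by move=> w Cw; have [Qw|nQ] := pselect (Q w); [left; exact: CQE|right].
  apply: negligibleU; first exact/negligibleP.
  exact: aeQ.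
by move=> /(measure_negligible mC) PC0; move: PC; rewrite PC0 ltxx.
Qed.

Lemma positive_probability_witness (C : set T) (Q : T -> Prop) :
  measurable C -> (0 < P C)%E -> {ae P, forall w, Q w} -> exists2 w, C w & Q w.
Proof.
move=> mC PC aeQ; apply: contrapT => H.
have : (0 < P set0)%E.
  apply: (positive_probability_transfer mC _ PC aeQ) => // w Cw Qw.
  by apply: H; exists w.
by rewrite measure0 ltxx.
Qed.

Lemma ae_probability_gt0 (C : set T) : measurable C -> {ae P, forall w, C w} -> (0 < P C)%E.
Proof.
move=> mC aeC; apply: (positive_probability_transfer _ mC _ aeC (C := setT)) => //.
by rewrite probability_setT lte01.
Qed.

(** By path continuity, convergence at infinity can be tested on the countably many
    dyadic times. *)
Lemma measurable_cvg0 n (F : R -> set (set T)) (Y : R -> T -> 'cV[R]_n) :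
  is_filtration F -> adapted F Y -> continuous_paths Y ->
  measurable [set w | Y t w @[t --> +oo] --> (0 : 'cV[R]_n)].
Proof.
move=> hF aY cY.
have dy0 l p : 0 <= p%:R * mesh (1 : R) l by exact: dyadic_ge0.
rewrite (_ : [set w | _] = [set w | forall m : nat, exists N : nat, forall x : nat * nat * 'I_n,
  N%:R <= x.1.2%:R * mesh (1 : R) x.1.1 ->
  `|Y (x.1.2%:R * mesh 1 x.1.1) w x.2 0| <= m.+1%:R^-1]).
  apply: measurable_forall => m; apply: measurable_exists => N.
  apply: measurable_forall => -[[l p] a]/=.
  case: (N%:R <= _); last by rewrite (_ : (fun w => _) = setT)//; apply/seteqP; split.
  rewrite (_ : (fun w => _) = ~` [set w | m.+1%:R^-1 < `|Y (p%:R * mesh 1 l) w a 0|]).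
    apply: measurableC; apply: measurable_set_gt.
    apply: measurableT_comp; first exact: normr_measurable.
    exact: (adapted_measurable hF a aY (dy0 l p)).
  apply/seteqP; split=> w/=; last by move=> H _; rewrite leNgt; exact/negP.
  by move=> /(_ isT); rewrite leNgt => /negP.
apply/seteqP; split=> w.
- move=> /cvg_mxP Y0 m; have m0 : (0 : R) < m.+1%:R^-1 by rewrite invr_gt0.
  have : \forall t \near +oo, forall a, `|Y t w a 0| <= m.+1%:R^-1.
    apply: filter_forall => a; have := Y0 a 0; rewrite mxE.
    by move=> /cvgrPdist_le/(_ _ m0); apply: filterS => t; rewrite sub0r normrN.
  move=> [T0 [_ hT0]]; exists (Num.truncn T0).+1 => -[[l p] a]/= Nt.
  by apply: hT0; apply: lt_le_trans Nt; exact: truncnS_gt.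
- move=> /= H; apply/cvg_mxP => a j; rewrite (ord1 j) mxE.
  apply/cvgrPdist_le => e e0.
  have e20 : 0 < e / 2 by rewrite divr_gt0.
  have [m hm] := inv_succ_small e20.
  have [N hN] := H m.
  exists (N%:R + 1); split; first exact: num_real.
  move=> t Nt; rewrite sub0r normrN.
  have t0 : 0 <= t by rewrite (le_trans _ (ltW Nt))// addr_ge0.
  have cYa : {within `[0, +oo[, continuous (fun t => Y t w a 0)}.
    exact: (path_coord_continuous (w:=w) (a:=a) cY).
  have [l [p [p1 p2 hp]]] := grid_point_approx ltr01 e20 t0 cYa.
  have m1 : mesh (1 : R) l <= 1.
    by rewrite /mesh ler_pdivrMr ?exprn_gt0// mul1r exprn_ege1// ler1n.
  have Np : N%:R <= p%:R * mesh (1 : R) l.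
    by move: p2; rewrite -natr1 mulrDl mul1r => p2; lra.
  have := hN (l, p, a) Np; move=> /= /le_trans/(_ hm).
  move: hp; set x := Y t _ _ _; set y := Y _ _ _ _ => h1 h2.
  have := ler_normD (x - y) y; rewrite subrK; lra.
Qed.

End Events.

Theorem theorem9 (R : realType) (d r : nat) (hd : (0 < d)%N) (hr : (0 < r)%N)
    (disp : measure_display) (T : measurableType disp) (P : probability T R)
    (F : R -> set (set T)) (hF : is_filtration F)
    (B : R -> T -> 'cV[R]_r) (hB : brownian_motion P F B)
    (sigma : R -> 'M[R]_(d, r)) (hsigma : {within `[0, +oo[, continuous sigma})
    (A : 'M[R]_d)
    (X : 'cV[R]_d -> R -> T -> 'cV[R]_d)
    (hX : forall xi, is_solution P F B A sigma xi (X xi))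
    (c : R) (hc : 0 < c) :
  let condA :=
    stable_mx A /\ (forall eps : R, 0 < eps -> (I_crit sigma c eps < +oo)%E) in
  let C (xi : d.-tuple 'cV[R]_d) : set T :=
    [set w | (forall i : 'I_d, X (tnth xi i) t w @[t --> +oo] --> (0 : 'cV[R]_d)) /\
             X 0 t w @[t --> +oo] --> (0 : 'cV[R]_d)] in
  let condB :=
    exists2 xi : d.-tuple 'cV[R]_d, basis_of fullv xi & (0 < P (C xi))%E in
  let condC :=
    forall xi : 'cV[R]_d,
      {ae P, forall w, X xi t w @[t --> +oo] --> (0 : 'cV[R]_d)} in
  (condA <-> condB) /\ (condB <-> condC).
Proof.
move=> condA C condB condC.
have mX0 xi : measurable [set w | X xi t w @[t --> +oo] --> (0 : 'cV[R]_d)].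
  by have [aX cX _] := hX xi; exact: measurable_cvg0 hF aX cX.
have mC xi : measurable (C xi).
  apply: measurableI (mX0 0).
  apply: (measurable_forall (A := fun i =>
    [set w | X (tnth xi i) t w @[t --> +oo] --> (0 : 'cV[R]_d)])) => i; exact: mX0.
have AC : condA -> condC.
  move=> [stA IA] xi; have [aX cX [M hM eqX]] := hX xi; have [_ cM _] := hM.
  (* Windows of length [c / 2], as in [I_crit_sum]. *)
  have h0 : 0 < c / 2 by rewrite divr_gt0.
  have flatM := noise_flat hF hB hsigma h0 hM
    (fun eps eps0 => I_crit_sum hsigma hc (IA eps eps0)).
  apply: filterS2 eqX flatM => w eqw flatw.
  exact: (solution_cvg0 hd stA h0 (cX w) (cM w) eqw flatw).
have CB : condC -> condB.
  move=> HC.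
  have dimE : \dim (fullv : {vspace 'cV[R]_d}) = d by rewrite dimvf/= /dim/= muln1.
  exists (tcast dimE (vbasis fullv)); first by rewrite val_tcast; exact: vbasisP.
  apply: ae_probability_gt0 => //.
  set xi := tcast _ _.
  have aeX : {ae P, forall w, forall i : 'I_d, X (tnth xi i) t w @[t --> +oo] --> (0 : 'cV[R]_d)}.
    by apply: ae_forall_count => i; exact: HC.
  by apply: filterS2 aeX (HC 0) => w h1 h2; split.
have BA : condB -> condA.
  move=> [xi bxi PC].
  have [aX0 cX0 [M hM eqX0]] := hX 0.
  (* Each solution comes with its own version of the Ito integral; replace it by that
   of the solution started at 0. *)
  have aeEq : {ae P, forall w, forall i : 'I_d,
      drift_equation A (tnth xi i) (fun t => X (tnth xi i) t w) (M ^~ w)}.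
    apply: ae_forall_count => i.
    have [aXi cXi [Mi hMi eqXi]] := hX (tnth xi i).
    apply: filterS2 eqXi (noise_unique hF hB hsigma hc hMi hM) => w eqw Mw t t0.
    by rewrite -Mw//; exact: eqw.
  split.
    have [w [Cw C0w] [eqw eq0w]] :=
      positive_probability_witness (mC xi) PC (filterI aeEq eqX0).
    apply: (common_noise_stable bxi _ _ eqw eq0w Cw C0w).
    - by move=> i; have [_ cXi _] := hX (tnth xi i); exact: cXi.
    - exact: cX0.
  move=> eps eps0; apply: (I_crit_fin hsigma hc eps0).
  apply: (exp_weight_bounded hF hB hsigma hc hM hd) => e e0.
  apply: (positive_probability_transfer (mC xi) _ PC eqX0).
    by apply: measurable_exists => N; exact: (measurable_tail_small hF hc hM).
  move=> w [_ X0w] eq0w.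
  have H := solution_noise_increments hc (cX0 w) eq0w X0w.
  have /choice[N hN] := fun i => H i e e0.
  exists (\max_i N i)%N => n a Nn; apply: hN; apply: leq_trans Nn.
  exact: leq_bigmax.
split; split.
- by move=> /AC/CB.
- exact: BA.
- by move=> /BA/AC.
- exact: CB.
Qed.
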